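(* Let $E$ be a nonempty closed subset of $\mathbb{T}$ with logarithmic capacity zero. Let $x_0\ge0$ and let $\psi:[x_0,\infty)\to(0,\infty)$ be any continuous strictly decreasing function such that $\psi(x)\to0$ as $x\to+\infty$ and $\int_{x_0}^{+\infty}\psi(x)\,x\,dx<\infty$. Fix $t_0\in(0,2]$ such that $\mathrm{cap}(E_{t_0})\le\psi(x_0)$, and for $0<t\le t_0$ define $$\omega(t)=\exp\big(-e^{\psi^{-1}(\mathrm{cap}(E_t))}\big).$$ Let $(r_n)_{n\ge1}$ be any sequence in $(0,1)$ with $r_n\to1$ which satisfies $$\sum_{n=1}^\infty(1-r_n)\int_{2(1-r_n)}^{t_0}\frac{\omega(t)}{t^2}\,dt<\infty,$$ where the integral is interpreted as $0$ when $2(1-r_n)\ge t_0$. Then there exist real numbers $(\theta_n)_{n\ge1}$ such that $(r_ne^{i\theta_n})_{n\ge1}$ is a zero set for $\mathcal{D}$ and the set of accumulation points of $(r_ne^{i\theta_n})_{n\ge1}$ on $\mathbb{T}$ is precisely equal to $E$.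
   Context: $\mathbb{D}$ is the open unit disk and $\mathbb{T}$ the unit circle in $\mathbb{C}$. The Dirichlet space $\mathcal{D}$ is the set of analytic functions $f=\sum_{n\ge0}a_nz^n$ on $\mathbb{D}$ with $\int_{\mathbb{D}}|f'(z)|^2\,dA(z)=\sum_{n\ge1}n|a_n|^2<\infty$, where $dA=dx\,dy/\pi$. A sequence $(z_n)_{n\ge1}$ in $\mathbb{D}$ is a zero set for $\mathcal{D}$ if there is $f\in\mathcal{D}$, $f\not\equiv0$, with $f(z_n)=0$ for all $n\ge1$. The energy of a Borel probability measure $\mu$ on $\mathbb{T}$ is $I(\mu)=\iint\log\frac{1}{|\zeta-\xi|}\,d\mu(\zeta)\,d\mu(\xi)\in[0,\infty]$. For a Borel set $F\subset\mathbb{T}$, let $\mathcal{P}(F)$ be the set of Borel probability measures supported on a compact subset of $F$; the logarithmic capacity of $F$ is $\mathrm{cap}(F)=1/\inf\{I(\mu):\mu\in\mathcal{P}(F)\}$ (with $1/\infty=0$, $1/0=\infty$, $\inf\emptyset=\infty$). For $t>0$, $E_t=\{\zeta\in\mathbb{T}: d(\zeta,E)\le t\}$, where $d(\zeta,E)=\inf_{\xi\in E}|\zeta-\xi|$ is the Euclidean distance. *)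

(* Defs.v *)
From HB Require Import structures.
From mathcomp Require Import all_boot all_order all_algebra.
From mathcomp Require Import all_classical all_reals all_analysis.
From mathcomp Require Import complex.

Set Implicit Arguments.
Unset Strict Implicit.
Unset Printing Implicit Defensive.

Import Order.TTheory GRing.Theory Num.Theory numFieldNormedType.Exports.

Local Open Scope classical_set_scope.
Local Open Scope complex_scope.
Local Open Scope ring_scope.

(* The usual topology of the complex plane, given by the modulus. *)
HB.instance Definition _ (R : realType) := NormedModule.copy R[i] R[i]^o.

(* Real-valued modulus (`|z| itself has type R[i]). *)
Notation modc := Normc.normc.

Definition unit_disk {R : realType} : set R[i] := [set z | modc z < 1].

Definition unit_circle {R : realType} : set R[i] := [set z | modc z = 1].

Definition cexpi (R : realType) (t : R) : R[i] := cos t +i* sin t.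

(* Only the values of f on the unit disk matter.  The Dirichlet integral
   of f is expressed by its value \sum_(n >= 1) n |a_n|^2. *)
Definition dirichlet_space {R : realType} : set (R[i] -> R[i]) :=
  [set f | exists a : nat -> R[i],
    (forall z, unit_disk z -> series (fun n => a n * z ^+ n) @ \oo --> f z) /\
    (\sum_(0 <= n <oo) (n%:R * modc (a n) ^+ 2)%:E < +oo)%E].

Definition dirichlet_zero_set {R : realType} (z : nat -> R[i]) : Prop :=
  (forall n, unit_disk (z n)) /\
  exists f, [/\ dirichlet_space f,
                exists2 w, unit_disk w & f w != 0 &
                forall n, f (z n) = 0].

Definition borelC (R : realType) := g_sigma_algebraType (@open R[i]).

(* As lne 0 = -oo, the kernel is +oo on the diagonal. *)
Definition energy (R : realType) (mu : probability (borelC R) R) : \bar R :=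
  (\int[mu]_(x in setT) \int[mu]_(y in setT)
      - lne (modc ((x : R[i]) - (y : R[i])))%:E)%E.

(* A Borel probability measure on the circle supported on a compact subset of
   F is encoded as a Borel probability measure on the plane carried by it. *)
Definition supported_probability (R : realType) (F : set R[i]) :
    set (probability (borelC R) R) :=
  [set mu | exists K : set R[i], [/\ compact K, K `<=` F & mu (~` K) = 0%E]].

(* In \bar R, 0^-1 = +oo, +oo^-1 = 0 and ereal_inf set0 = +oo. *)
Definition cap (R : realType) (F : set R[i]) : \bar R :=
  ((ereal_inf [set energy mu | mu in supported_probability F])^-1)%E.

Definition distE (R : realType) (E : set R[i]) (z : R[i]) : R :=
  inf [set modc (z - w) | w in E].

Definition nbhdT (R : realType) (E : set R[i]) (t : R) : set R[i] :=
  [set z | unit_circle z /\ distE E z <= t].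

(* psi^-1 is the inverse of the restriction of psi to [x0, +oo[; its value
   outside the range of this restriction is the arbitrary default x0. *)
Definition omega (R : realType) (E : set R[i]) (x0 : R) (psi : R -> R) (t : R)
    : R :=
  expR (- expR ('pinv_(fun=> x0) `[x0, +oo[ psi (fine (cap (nbhdT E t))))).

(* Main.v *)
(* The function is built from polynomials.  If every probability measure on E_t
   has energy at least 1/c, then c times the truncated logarithmic potential of
   a discrete equilibrium distribution near E is a polynomial g with Re g
   bounded above on the circle and close to at least 1 near E.  Pairing a
   polynomial h with g in the Dirichlet inner product averages c Re h, so that
   adding g to h costs little Dirichlet energy.  Stacking such blocks with
   c = psi k, which sum because of the integrability of x psi(x), gives h of
   bounded energy with exp (Re h) at least a multiple of exp (psi^-1 (cap E_t))
   within distance t/2 of E.  A polynomial f close to exp (- C e^h) then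
   satisfies |f|^2 <= const * omega(t) there, with f(0) bounded away from 0.
   By the algebraic form of Carleson's formula, giving f a zero at
   w = r e^(i theta), with e^(i theta) in E, increases the Dirichlet energy by at
   most (1 - r^2) ||q||^2, where |q| = |f / (1 - w^* z)| on the circle; this is
   estimated by the integral of omega(t) / t^2.  Hence the energies stay bounded
   as zeros are added, and an ultrafilter limit of the coefficients has all the
   zeros, and is not 0 because the products of the r_n stay away from 0.
   The e^(i theta_n) run through points of E, approaching each infinitely often.
   The convergent series also forces omega to have infimum 0, so that all the
   scales needed for the blocks exist. *)

Require Import Defs.
From HB Require Import structures.
From mathcomp Require Import all_boot all_order all_algebra.
From mathcomp Require Import all_classical all_reals all_analysis.
From mathcomp Require Import measurable_realfun.
From mathcomp Require Import complex polyrcf zify ring lra.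
Set Implicit Arguments.
Unset Strict Implicit.
Unset Printing Implicit Defensive.
Import Order.TTheory GRing.Theory Num.Theory numFieldNormedType.Exports.
Local Open Scope classical_set_scope.
Local Open Scope complex_scope.
Local Open Scope ring_scope.
Local Notation Re := complex.Re.
Local Notation Im := complex.Im.
Local Notation "z ^*" := (conjc z) : ring_scope.

(** * The modulus and polynomials with their Dirichlet and Hardy norms *)

(** A polynomial of size at most [N] has its mean square given by its values at the [N]-th roots of
    unity, so circle integrals become finite averages and area integrals become integrals of such
    averages in the squared radius. Discretisation changes energies by additive constants, harmless
    against [1 / c] once [c] is small; hence only levels beyond a large [k1] are used, and the
    constant [C] pays for the levels skipped. The weight [x psi(x)] arises because block [k] is
    paired with a sum whose real part may already be [2 k] on the circle. The outer exponential
    costs no energy: with [y = C e^h], [f'] is close to [- y e^(-y) h'], and this factor is bounded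
    whatever [C] is. A polynomial follows [omega] only up to a positive error, which is fixed after
    the number of zeros, so the bounds must be uniform in both. A further obstacle is [psi^-1]:
    outside the range of [psi] it returns [x0], so [omega] is known to be monotone only once the
    convergent series has excluded capacity 0 at positive scales. *)

Section Modulus.
Variable R : rcfType.
Implicit Types (x y z w : R[i]).

Lemma sqr_modcE z : modc z ^+ 2 = Re z ^+ 2 + Im z ^+ 2.
Proof. by case: z => a b /=; rewrite sqr_sqrtr // addr_ge0 ?sqr_ge0. Qed.

Lemma modc_ge0 z : 0 <= modc z.
Proof. by case: z => a b /=; rewrite sqrtr_ge0. Qed.

Lemma modcX z n : modc (z ^+ n) = modc z ^+ n.
Proof.
elim: n => [|n IHn]; first by rewrite !expr0 Normc.normc1.
by rewrite !exprS Normc.normcM IHn.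
Qed.

Lemma modc_real (a : R) : modc a%:C = `|a|.
Proof. by rewrite /= expr0n /= addr0 sqrtr_sqr. Qed.

Lemma modcD x y : modc (x + y) <= modc x + modc y.
Proof. exact: le_normcD. Qed.

Lemma modcN x : modc (- x) = modc x.
Proof. exact: normcN. Qed.

Lemma modcB x y : modc (x - y) <= modc x + modc y.
Proof. by rewrite -(modcN y) modcD. Qed.

Lemma modcBC x y : modc (x - y) = modc (y - x).
Proof. by rewrite -modcN opprB. Qed.

Lemma modc_sum I (r : seq I) (P : pred I) (F : I -> R[i]) :
  modc (\sum_(i <- r | P i) F i) <= \sum_(i <- r | P i) modc (F i).
Proof.
elim/big_rec2: _ => [|i a z _ IH]; first by rewrite Normc.normc0.
by apply: (le_trans (modcD _ _)); rewrite lerD2l.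
Qed.

Lemma modc_conj x : modc x^* = modc x.
Proof. by case: x => a b /=; rewrite sqrrN. Qed.

Lemma Re_le_modc z : `|Re z| <= modc z.
Proof.
rewrite -ler_sqr ?nnegrE ?modc_ge0 // sqr_modcE real_normK ?num_real //.
by rewrite lerDl sqr_ge0.
Qed.

Lemma Im_le_modc z : `|Im z| <= modc z.
Proof.
rewrite -ler_sqr ?nnegrE ?modc_ge0 // sqr_modcE real_normK ?num_real //.
by rewrite lerDr sqr_ge0.
Qed.

Lemma sqr_modc_conj z : (modc z ^+ 2)%:C = z * z^*.
Proof.
rewrite sqr_modcE; case: z => a b /=; apply/eqP; rewrite eq_complex /=.
by apply/andP; split; apply/eqP; ring.
Qed.

Lemma ReD x y : Re (x + y) = Re x + Re y. Proof. by case: x; case: y. Qed.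
Lemma ReN x : Re (- x) = - Re x. Proof. by case: x. Qed.
Lemma ImD x y : Im (x + y) = Im x + Im y. Proof. by case: x; case: y. Qed.
Lemma ImN x : Im (- x) = - Im x. Proof. by case: x. Qed.
Lemma ReM x y : Re (x * y) = Re x * Re y - Im x * Im y.
Proof. by case: x; case: y. Qed.
Lemma ImM x y : Im (x * y) = Re x * Im y + Im x * Re y.
Proof. by case: x; case: y. Qed.
Lemma Re_realM (a : R) z : Re (a%:C * z) = a * Re z.
Proof. by rewrite ReM /= mul0r subr0. Qed.
Lemma Im_realM (a : R) z : Im (a%:C * z) = a * Im z.
Proof. by rewrite ImM /= mul0r addr0. Qed.

Lemma Re_sum I (r : seq I) (P : pred I) (F : I -> R[i]) :
  Re (\sum_(i <- r | P i) F i) = \sum_(i <- r | P i) Re (F i).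
Proof. by elim/big_rec2: _ => [//|i a z _ <-]; rewrite ReD. Qed.

Lemma Im_sum I (r : seq I) (P : pred I) (F : I -> R[i]) :
  Im (\sum_(i <- r | P i) F i) = \sum_(i <- r | P i) Im (F i).
Proof. by elim/big_rec2: _ => [//|i a z _ <-]; rewrite ImD. Qed.

Lemma sqr_modcD x y :
  modc (x + y) ^+ 2 = modc x ^+ 2 + modc y ^+ 2 + 2 * Re (x * y^*).
Proof.
by rewrite !sqr_modcE; case: x => a b; case: y => c d /=; ring.
Qed.

Lemma modc_circle_conj z : modc z = 1 -> z * z^* = 1.
Proof. by move=> z1; rewrite -sqr_modc_conj z1 expr1n. Qed.

Lemma real_complex_natr (n : nat) : (n%:R : R)%:C = n%:R :> R[i].
Proof. by rewrite rmorph_nat. Qed.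

Lemma modc_nat (n : nat) : modc (n%:R : R[i]) = n%:R.
Proof. by rewrite -real_complex_natr modc_real normr_nat. Qed.

Lemma modcBcircle z w : modc z = 1 -> modc (z - w) = modc (1 - w^* * z).
Proof.
move=> z1; rewrite (_ : z - w = z * (1 - w^* * z)^*).
  by rewrite Normc.normcM z1 mul1r modc_conj.
rewrite rmorphB rmorph1 rmorphM /= conjcK mulrBr mulr1 mulrCA.
by rewrite (modc_circle_conj z1) mulr1.
Qed.

End Modulus.

Section DirichletPoly.
Variable R : rcfType.
Implicit Types (p q f g h F : {poly R[i]}) (z w : R[i]).

Definition dirichlet_poly p : R := \sum_(i < size p) i%:R * modc p`_i ^+ 2.
Definition hardy_poly p : R := \sum_(i < size p) modc p`_i ^+ 2.

Lemma size_polyM_le p q a b :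
  (size p <= a.+1)%N -> (size q <= b)%N -> (size (p * q)%R <= a + b)%N.
Proof.
move=> pa qb; rewrite (leq_trans (size_polyMleq _ _)) //.
by rewrite -subn1 leq_subLR addnA add1n leq_add.
Qed.

Lemma size_1BZXn (a : R[i]) n : (size (1 - a *: 'X^n)%R <= n.+1)%N.
Proof.
rewrite (leq_trans (size_polyD _ _)) // geq_max size_poly1 size_polyN /=.
by rewrite (leq_trans (size_scale_leq _ _)) // size_polyXn.
Qed.

Lemma sum_size_widen (c : nat -> R) p N : (size p <= N)%N ->
  (forall i, p`_i = 0 -> c i = 0) ->
  \sum_(i < size p) c i = \sum_(i < N) c i.
Proof.
move=> sN c0; rewrite (big_ord_widen N c sN) [RHS](bigID (fun i : 'I_N => (i < size p)%N)) /=.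
rewrite [X in _ = _ + X]big1 ?addr0 // => i; rewrite -leqNgt => /leq_sizeP si.
by rewrite c0 // si.
Qed.

Lemma dirichlet_polyE p N : (size p <= N)%N ->
  dirichlet_poly p = \sum_(i < N) i%:R * modc p`_i ^+ 2.
Proof.
move=> sN; apply: (@sum_size_widen (fun i => i%:R * modc p`_i ^+ 2)) => // i ->.
by rewrite Normc.normc0 expr0n mulr0.
Qed.

Lemma hardy_polyE p N : (size p <= N)%N ->
  hardy_poly p = \sum_(i < N) modc p`_i ^+ 2.
Proof.
move=> sN; apply: (@sum_size_widen (fun i => modc p`_i ^+ 2)) => // i ->.
by rewrite Normc.normc0 expr0n.
Qed.

Lemma dirichlet_poly_ge0 p : 0 <= dirichlet_poly p.
Proof. by apply: sumr_ge0 => i _; rewrite mulr_ge0 ?sqr_ge0. Qed.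

Lemma hardy_poly_ge0 p : 0 <= hardy_poly p.
Proof. by apply: sumr_ge0 => i _; rewrite sqr_ge0. Qed.

Lemma dirichlet_polyD h g N : (size h <= N)%N -> (size g <= N)%N ->
  dirichlet_poly (h + g) = dirichlet_poly h + dirichlet_poly g
    + 2 * \sum_(i < N) i%:R * Re (h`_i * (g`_i)^*).
Proof.
move=> sh sg; rewrite (dirichlet_polyE sh) (dirichlet_polyE sg) (@dirichlet_polyE _ N).
  rewrite mulr_sumr -!big_split /=; apply: eq_bigr => i _.
  by rewrite coefD sqr_modcD; ring.
by rewrite (leq_trans (size_polyD _ _)) // geq_max sh.
Qed.

(* The algebraic heart of Carleson's formula: in [n |q_(n-1) - w q_n|^2] and
   [n |q_n - w^* q_(n-1)|^2] the cross terms agree, so the difference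
   telescopes. *)
Lemma dirichlet_poly_factor w q :
  dirichlet_poly (('X - w%:P) * q) =
  dirichlet_poly ((1 - w^* *: 'X) * q) + (1 - modc w ^+ 2) * hardy_poly q.
Proof.
pose N := (size q).+1.
set A := ('X - w%:P) * q; set B := (1 - w^* *: 'X) * q.
have s1 : (size A <= N)%N.
  by rewrite /N -add1n size_polyM_le // size_XsubC.
have s2 : (size B <= N)%N.
  by rewrite /N -add1n size_polyM_le // (size_1BZXn _ 1).
rewrite (dirichlet_polyE s1) (dirichlet_polyE s2).
rewrite -[LHS](subrK (\sum_(i < N) i%:R * modc B`_i ^+ 2)).
rewrite [LHS]addrC; congr (_ + _); rewrite -sumrB.
rewrite (eq_bigr (fun i : 'I_N => (1 - modc w ^+ 2) *
   (i%:R * modc ('X * q)`_i ^+ 2 - i%:R * modc q`_i ^+ 2))); last first.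
  move=> i _; rewrite /A /B !mulrBl mul1r mul_polyC -scalerAl !coefB !coefZ.
  move: ('X * q)`_i q`_i => a b; rewrite !sqr_modcE.
  by case: a => a1 a2; case: b => b1 b2; case: (w) => w1 w2 /=; ring.
rewrite -mulr_sumr; congr (_ * _); rewrite sumrB.
rewrite big_ord_recl mul0r add0r [X in _ - X]big_ord_recr /= /hardy_poly.
have -> : q`_(size q) = 0 by apply/(leq_sizeP q (size q)).
rewrite Normc.normc0 expr0n mulr0 addr0 -sumrB; apply: eq_bigr => i _.
by rewrite coefXM /= -mulrBl -natr1 addrAC subrr add0r mul1r.
Qed.

Lemma geom_polyE w L :
  (1 - w *: 'X) * (\sum_(i < L) w ^+ i *: 'X^i) = 1 - w ^+ L *: 'X^L :> {poly R[i]}.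
Proof.
under eq_bigr do rewrite -exprZn.
rewrite -exprZn; have := @subrX1 {poly R[i]} (w *: 'X) L => H.
by rewrite -[LHS]opprK -mulNr opprB -H opprB.
Qed.

(** As [F] has at most [L] coefficients, [F] and its shift by [L] do not overlap, so their energies
    add; the shifted coefficients carry weights at most [2 L]. For large [L] the power of [modc w]
    wins. *)
Lemma dirichlet_poly_tail w L F : (size F <= L)%N ->
  dirichlet_poly ((1 - w ^+ L *: 'X^L) * F) <=
  dirichlet_poly F + modc w ^+ (L * 2) * ((L * 2)%:R * hardy_poly F).
Proof.
move=> sF; rewrite (@dirichlet_polyE _ (L + size F)); last first.
  by rewrite size_polyM_le // size_1BZXn.
rewrite big_split_ord /= lerD //.
  rewrite (dirichlet_polyE sF) ler_sum // => i _.
  rewrite mulrBl mul1r -scalerAl coefB coefZ coefXnM ltn_ord mulr0 subr0 //.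
rewrite /hardy_poly !mulr_sumr ler_sum // => i _.
rewrite mulrBl mul1r -scalerAl coefB coefZ coefXnM ltnNge leq_addr /= addKn.
rewrite (_ : F`_(L + i) = 0); last by apply/(leq_sizeP F L) => //; rewrite leq_addr.
rewrite sub0r modcN Normc.normcM modcX exprMn -exprM mulrCA ler_wpM2l ?exprn_ge0 ?modc_ge0 //.
rewrite ler_wpM2r ?sqr_ge0 // ler_nat muln2 -addnn leq_add2l.
by rewrite (leq_trans _ sF) // ltnW.
Qed.

(** The area integral of the squared modulus of [p'], in the coefficients of [p']; this form lets
    derivatives be compared pointwise. *)
Lemma dirichlet_poly_deriv p N : (size p <= N.+1)%N ->
  dirichlet_poly p = \sum_(i < N) modc p^`()`_i ^+ 2 / i.+1%:R.
Proof.
move=> sp; rewrite (dirichlet_polyE sp) big_ord_recl mul0r add0r.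
apply: eq_bigr => i _; rewrite coef_deriv /= -[p`_i.+1 *+ _]mulr_natr Normc.normcM modc_nat.
rewrite exprMn expr2 /bump /= add1n.
have : (i.+1%:R : R) != 0 by rewrite pnatr_eq0.
by move: (i.+1%:R : R) => k k0; field.
Qed.

End DirichletPoly.

(** * The discrete Parseval identity *)

Section Parseval.
Variable R : rcfType.
Implicit Types (p q : {poly R[i]}) (z w x : R[i]).

Lemma prim_root_sum w N k : N.-primitive_root w -> ~~ (N %| k)%N ->
  \sum_(j < N) (w ^+ k) ^+ j = 0.
Proof.
move=> wN nk; have w1 : w ^+ k - 1 != 0.
  by rewrite subr_eq0 -(prim_order_dvd wN).
apply: (mulfI w1); rewrite mulr0 -subrX1 -exprM mulnC exprM (prim_expr_order wN).
by rewrite expr1n subrr.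
Qed.

(** [N] is at least the number of coefficients, so two exponents congruent modulo [N] are equal and
    the off-diagonal sums of powers of [w] vanish. The modulus of [x] is free because area norms
    involve all circles. *)
Lemma parseval p N w x : N.-primitive_root w -> modc w = 1 -> (size p <= N)%N ->
  \sum_(k < N) modc p.[x * w ^+ k] ^+ 2 =
  N%:R * \sum_(i < N) modc p`_i ^+ 2 * (modc x ^+ 2) ^+ i.
Proof.
move=> wN w1 sp; apply: (@complexI R).
rewrite rmorphM rmorph_nat !rmorph_sum /=.
have wc := modc_circle_conj w1.
have w0 : w != 0 by apply: contra_eq_neq w1 => ->; rewrite Normc.normc0 eq_sym oner_eq0.
transitivity (\sum_(k < N) \sum_(i < N) \sum_(j < N)
   p`_i * (p`_j)^* * x ^+ i * x^* ^+ j * (w ^+ i / w ^+ j) ^+ k).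
  apply: eq_bigr => k _.
  rewrite sqr_modc_conj (horner_coef_wide _ sp) rmorph_sum /= mulr_suml.
  apply: eq_bigr => i _; rewrite mulr_sumr; apply: eq_bigr => j _.
  rewrite !rmorphM !rmorphXn /= !rmorphM /= !rmorphXn /= !exprMn.
  have -> : w^* = w^-1 by apply: (mulfI w0); rewrite wc divff.
  by rewrite (exprAC w k i) (exprAC w^-1 k j) exprVn; ring.
rewrite exchange_big /= mulr_sumr; apply: eq_bigr => i _.
rewrite exchange_big /= (bigD1 i) //= [X in _ + X]big1 ?addr0 => [|j ji].
  under eq_bigr do rewrite divff ?expf_neq0 // expr1n mulr1.
  rewrite sumr_const card_ord -mulr_natl !rmorphM /= !rmorphXn /=.
  have E z : (modc z)%:C ^+ 2 = z * z^* by rewrite -rmorphXn /= sqr_modc_conj.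
  have E2 z : (modc z)%:C * (modc z)%:C = z * z^* by rewrite -E expr2.
  by rewrite !E E2 exprMn -mulr_natl; ring.
rewrite -mulr_sumr; have wNj : w ^+ N = 1 by exact: prim_expr_order.
have -> : w ^+ i / w ^+ j = w ^+ (i + (N - j)).
  rewrite exprD; congr (_ * _); apply: (mulfI (expf_neq0 j w0)).
  by rewrite divff ?expf_neq0 // -exprD subnKC ?wNj // ltnW.
rewrite prim_root_sum ?mulr0 //.
apply: contra ji => /dvdnP [m Hm]; rewrite -val_eqE /=.
have := ltn_ord i; have := ltn_ord j => hj hi.
have : (m < 2)%N by nia.
by case: m Hm => [|[|m]] //; lia.
Qed.

End Parseval.

(** * Chords, arcs and roots of unity *)

Section Circle.
Variable R : realType.
Implicit Types (a b x y : R) (z w : R[i]).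

Lemma modc_cexpi a : modc (cexpi a) = 1.
Proof. by rewrite /= cos2Dsin2 sqrtr1. Qed.

Lemma cexpiD a b : cexpi (a + b) = cexpi a * cexpi b.
Proof. by rewrite /cexpi cosD sinD; apply/eqP; rewrite eq_complex /= eqxx /= addrC. Qed.

Lemma cexpi0 : cexpi 0 = 1 :> R[i].
Proof. by rewrite /cexpi cos0 sin0. Qed.

Lemma cexpiX a n : cexpi a ^+ n = cexpi (n%:R * a).
Proof.
elim: n => [|n IHn]; first by rewrite expr0 mul0r cexpi0.
by rewrite exprS IHn -cexpiD -natr1 mulrDl mul1r addrC.
Qed.

Lemma cexpi_conj a : (cexpi a)^* = cexpi (- a).
Proof. by rewrite /cexpi cosN sinN. Qed.

Lemma modc_cexpiB a b : modc (cexpi a - cexpi b) = 2 * `|sin ((a - b) / 2)|.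
Proof.
rewrite -[RHS]ger0_norm ?mulr_ge0 // -[LHS]ger0_norm ?modc_ge0 //.
apply/eqP; rewrite -(eqrXn2 (n := 2)) ?normr_ge0 // !real_normK ?num_real //.
rewrite exprMn real_normK ?num_real // sqr_modcE ReD ReN ImD ImN /=.
have := cos_mulr2n ((a - b) / 2).
rewrite (_ : (a - b) / 2 *+ 2 = a - b) => [H|]; last by field.
have {}H : cos (a - b) = 1 - 2 * sin ((a - b) / 2) ^+ 2.
  by rewrite H cos2sin2; ring.
move: H; rewrite cosB => H; apply/eqP.
have := cos2Dsin2 a; have := cos2Dsin2 b; move: H.
move: (sin ((a - b) / 2)) => t; nra.
Qed.

Lemma sin_le x : 0 <= x -> sin x <= x.
Proof.
move=> x0; have [c _] : exists2 c, c \in `[0, x]%R & sin x - sin 0 = cos c * (x - 0).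
  by apply: MVT_segment => //;
    apply: continuous_subspaceT => y; exact: continuous_sin.
by rewrite sin0 !subr0 => ->; rewrite ler_piMl // cos_le1.
Qed.

(** A weak form of Jordan's inequality: up to [pi / 4] the derivative of [sin] is at least [1 / 2];
    beyond, [sin] has already reached [pi / 8] and increases. *)
Lemma sin_ge_quarter x : 0 <= x <= pi / 2 -> x / 4 <= sin x.
Proof.
have piq : 0 <= (pi : R) / 4 by rewrite divr_ge0 // pi_ge0.
have cosq : 1 / 2 <= cos (pi / 4 : R).
  have c0 : 0 <= cos (pi / 4 : R).
    by apply: cos_ge0_pihalf; move: piq; lra.
  have := cos_mulr2n (pi / 4 : R).
  rewrite (_ : pi / 4 *+ 2 = pi / 2); last by field.
  rewrite cos_pihalf; nra.
have small y : 0 <= y <= pi / 4 -> y / 2 <= sin y.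
  move=> /andP[y0 yq].
  have [c cy] : exists2 c, c \in `[0, y]%R & sin y - sin 0 = cos c * (y - 0).
    by apply: MVT_segment => //;
      apply: continuous_subspaceT => z; exact: continuous_sin.
  rewrite sin0 !subr0 => ->; rewrite mulrC ler_wpM2r //.
  move: cy; rewrite in_itv /= => /andP[c0 cy].
  have cq : c <= pi / 4 by exact: le_trans yq.
  suff : cos (pi / 4) <= cos c by move: cosq; lra.
  have pip : c <= (pi : R) by move: piq cq; lra.
  move: cq; rewrite le_eqVlt => /predU1P[-> //|cq].
  by rewrite ltW // ltr_cos // in_itv /= ?c0 ?piq //=; move: piq; lra.
move=> /andP[x0 xh]; have [xq|xq] := leP x (pi / 4).
  by apply: le_trans (small _ _); [lra|rewrite x0].
have : sin (pi / 4) <= sin x.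
  by rewrite ltW // ltr_sin // in_itv /=; apply/andP; split; move: piq; lra.
have := small (pi / 4); rewrite piq lexx => /(_ isT); move: xh; lra.
Qed.

Lemma cexpi_dist_le a b : modc (cexpi a - cexpi b) <= `|a - b|.
Proof.
rewrite modc_cexpiB; wlog ab : a b / b <= a.
  move=> H; have [|ab] := leP b a; first exact: H.
  by rewrite (distrC a) -(opprB b a) mulNr sinN normrN; apply: H; exact: ltW.
rewrite (ger0_norm (_ : 0 <= a - b)) ?subr_ge0 //.
have y0 : 0 <= (a - b) / 2 by rewrite divr_ge0 // subr_ge0.
have := sin_le y0; have := sin_max ((a - b) / 2) => m1 m2.
have [s0|s0] := leP 0 (sin ((a - b) / 2)); first by rewrite ger0_norm //; move: m2; lra.
(* the sine is only negative beyond [pi], where the bound 2 suffices *)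
have : pi <= (a - b) / 2.
  rewrite leNgt; apply/negP => H.
  by move: s0; rewrite ltNge sin_ge0_pi // y0 ltW.
by have := pi_ge2 R; move: m1; lra.
Qed.

Lemma cexpi_dist_ge a b : `|a - b| <= pi -> `|a - b| / 4 <= modc (cexpi a - cexpi b).
Proof.
rewrite modc_cexpiB; wlog ab : a b / b <= a.
  move=> H; have [|ab] := leP b a; first exact: H.
  by rewrite (distrC a) -(opprB b a) mulNr sinN normrN; apply: H; exact: ltW.
have y0 : 0 <= a - b by rewrite subr_ge0.
rewrite (ger0_norm y0) => ypi.
have := @sin_ge_quarter ((a - b) / 2); have := ler_norm (sin ((a - b) / 2)).
by move=> h1 h2; have := h2 _; lra.
Qed.

Lemma cexpi_neq1 x : 0 < x < pi *+ 2 -> cexpi x != 1.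
Proof.
move=> /andP[x0 x2]; rewrite -subr_eq0 -cexpi0; apply/eqP => H.
have : modc (cexpi x - cexpi 0) = 0 by rewrite H Normc.normc0.
rewrite modc_cexpiB subr0; have : 0 < sin (x / 2).
  by apply: sin_gt0_pi; apply/andP; split; lra.
by move=> s0; rewrite (gtr0_norm s0) => H'; move: s0; lra.
Qed.

Definition unity_root (N : nat) : R[i] := cexpi (2 * pi / N%:R).

Lemma unity_rootX N k : unity_root N ^+ k = cexpi (2 * pi * (k%:R / N%:R)).
Proof. by rewrite cexpiX; congr cexpi; ring. Qed.

Lemma unity_root_prim N : (0 < N)%N -> N.-primitive_root (unity_root N).
Proof.
move=> N0; have N0' : (N%:R : R) != 0 by rewrite pnatr_eq0 -lt0n.
rewrite /primitive_root_of_unity N0; apply/forallP => i; apply/eqP.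
rewrite unity_rootE unity_rootX.
have [->|iN] := eqVneq i.+1 N.
  by rewrite divff // mulr1 mulr_natl /cexpi cos2pi sin2pi eqxx.
apply/negbTE/cexpi_neq1; rewrite -[pi *+ 2]mulr_natl.
have i1 : 0 < (i.+1%:R / N%:R : R) < 1.
  by rewrite divr_gt0 ?ltr0n //= ltr_pdivrMr ?ltr0n // mul1r ltr_nat ltn_neqAle iN ltn_ord.
by have := pi_gt0 R; move: i1 => /andP[]; nra.
Qed.

Lemma modc_unity_root N : modc (unity_root N) = 1.
Proof. exact: modc_cexpi. Qed.

End Circle.

(** * Adding one zero to a polynomial *)

Section Bergman.
Variable R : realType.
Implicit Types (p q f h F : {poly R[i]}) (z w : R[i]).

(** Integration over [[0, 1]] without measure theory: the antiderivative [P] has a nonnegative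
    derivative there, and the sum is [P(1) - P(0)]. *)
Lemma sum_divS_ge0 (c : nat -> R) n :
  (forall s, 0 <= s <= 1 -> 0 <= \sum_(i < n) c i * s ^+ i) ->
  0 <= \sum_(i < n) c i / i.+1%:R.
Proof.
move=> c_ge0; pose P : {poly R} := \sum_(i < n) (c i / i.+1%:R) *: 'X^(i.+1).
have P' s : P^`().[s] = \sum_(i < n) c i * s ^+ i.
  rewrite /P raddf_sum /= horner_sum; apply: eq_bigr => i _.
  rewrite derivZ derivXn hornerZ hornerMn hornerXn /= -[s ^+ i *+ _]mulr_natr.
  have : (i.+1%:R : R) != 0 by rewrite pnatr_eq0.
  by move: (i.+1%:R : R) => k k0; field.
have /(_ 0 1) : {in `[0, 1] &, {homo horner P : x y / x <= y}}.
  apply: ler_hornerW => x; rewrite in_itv /= => /andP[x0 x1].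
  by rewrite P' c_ge0 // !ltW.
rewrite !in_itv /= !lexx ler01 => /(_ isT isT isT).
rewrite /P !horner_sum big1 => [|i _]; last by rewrite hornerZ hornerXn expr0n mulr0.
rewrite (eq_bigr (fun i : 'I_n => c i / i.+1%:R)) // => i _.
by rewrite hornerZ hornerXn expr1n mulr1.
Qed.

(** Parseval on the circle of squared radius [s] compares means of squared moduli; integrating in
    [s] divides the coefficient of index [i] by [i + 1], which gives the area norms. *)
Lemma bergman_le p q (K : R) N :
  (size p <= N)%N -> (size q <= N)%N -> 0 <= K ->
  (forall z, modc z <= 1 -> modc p.[z] <= K * modc q.[z]) ->
  \sum_(i < N) modc p`_i ^+ 2 / i.+1%:R <=
  K ^+ 2 * \sum_(i < N) modc q`_i ^+ 2 / i.+1%:R.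
Proof.
have [->|N0] := posnP N; first by rewrite !big_ord0 mulr0.
move=> sp sq K0 pq; rewrite -subr_ge0 mulr_sumr -sumrB.
under eq_bigr do rewrite mulrA -mulrBl.
apply: (@sum_divS_ge0 (fun i => K ^+ 2 * modc q`_i ^+ 2 - modc p`_i ^+ 2)) => s /andP[s0 s1].
under eq_bigr do rewrite mulrBl -mulrA.
rewrite sumrB -mulr_sumr subr_ge0.
have wN := unity_root_prim R N0; have w1 := modc_unity_root R N.
pose x : R[i] := (Num.sqrt s)%:C.
have xs : modc x ^+ 2 = s by rewrite modc_real ger0_norm ?sqrtr_ge0 // sqr_sqrtr.
have := parseval x wN w1 sp; have := parseval x wN w1 sq; rewrite xs => Hq Hp.
have NR : 0 < (N%:R : R) by rewrite ltr0n.
rewrite -(ler_pM2l NR) mulrCA -Hq -Hp mulr_sumr; apply: ler_sum => k _.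
rewrite -exprMn ler_sqr ?nnegrE ?mulr_ge0 ?modc_ge0 // pq //.
rewrite Normc.normcM modcX w1 expr1n mulr1.
by rewrite -(@expr_le1 _ 2) ?modc_ge0 // xs.
Qed.

Lemma dirichlet_poly_le f h (K : R) : 0 <= K ->
  (forall z, modc z <= 1 -> modc f^`().[z] <= K * modc h^`().[z]) ->
  dirichlet_poly f <= K ^+ 2 * dirichlet_poly h.
Proof.
move=> K0 fh; pose N := maxn (size f) (size h).
rewrite (@dirichlet_poly_deriv _ f N) ?leqW ?leq_maxl //.
rewrite (@dirichlet_poly_deriv _ h N) ?leqW ?leq_maxr //.
by apply: bergman_le => //; rewrite (leq_trans (size_poly _ _)) //
  (leq_trans (leq_pred _)) ?leq_maxl ?leq_maxr.
Qed.

Lemma exists_small_pow (r C e : R) n0 : 0 <= r < 1 -> 0 <= C -> 0 < e ->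
  exists2 L, (n0 <= L)%N & r ^+ L <= e /\ r ^+ (L * 2) * ((L * 2)%:R * C) <= e.
Proof.
move=> /andP[r0 r1] C0 e0.
(* [r] may be 0; [s] is positive, so [1 / s = 1 + a] and Bernoulli's inequality bounds [s ^+ L] by
   [1 / (L a)]. The square of this bound still beats the factor [L]. *)
pose s := Num.max r (1 / 2); have s0 : 0 < s by rewrite lt_max; apply/orP; right; lra.
have s1 : s < 1 by rewrite gt_max r1 /=; lra.
pose a := s^-1 - 1; have a0 : 0 < a by rewrite subr_gt0 invf_gt1.
have bern L : s ^+ L * (L%:R * a) <= 1.
  have : 1 + L%:R * a <= (1 + a) ^+ L.
    elim: L => [|L IHL]; first by rewrite mul0r addr0 expr0.
    rewrite exprS -natr1 mulrDl mul1r; have : 0 <= (L%:R : R) * a by rewrite mulr_ge0 // ltW.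
    move: IHL a0; move: (L%:R * a) ((1 + a) ^+ L) => u v; nra.
  rewrite [1 + a]addrC subrK exprVn => H.
  rewrite -ler_pdivlMl ?exprn_gt0 // mulr1; apply: le_trans H.
  by rewrite lerDr.
have rs L : r ^+ L <= s ^+ L by rewrite lerXn2r ?nnegrE // ?(ltW s0) // le_max lexx.
pose L := maxn n0.+1 (Num.bound (Num.max (1 / (a * e)) (2 * C / (a ^+ 2 * e)))).
have L0 : 0 < (L%:R : R) by rewrite ltr0n (leq_trans _ (leq_maxl _ _)).
have LB : Num.max (1 / (a * e)) (2 * C / (a ^+ 2 * e)) <= L%:R.
  apply/ltW/(lt_le_trans (Num.Theory.archi_boundP _)).
    by rewrite le_max divr_ge0 // mulr_ge0 // ltW.
  by rewrite ler_nat leq_maxr.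
move: LB; rewrite ge_max => /andP[L1 L2].
exists L; first by rewrite (leq_trans _ (leq_maxl _ _)).
have sL : 0 < s ^+ L by rewrite exprn_gt0.
have ae : 0 < a * e by rewrite mulr_gt0.
have La1 : 1 <= L%:R * (a * e) by rewrite -ler_pdivrMr.
split.
  apply: le_trans (rs L) _; have := bern L.
  move: La1 sL; move: (s ^+ L) => u La1 sL H.
  have : u * (L%:R * a) * e <= e by rewrite ler_piMl // ltW.
  have : u <= u * (L%:R * (a * e)) by rewrite ler_peMr // ltW.
  by rewrite !mulrA => h1 h2; exact: le_trans h2.
rewrite exprM natrM.
apply: (@le_trans _ _ ((s ^+ L) ^+ 2 * (L%:R * 2 * C))).
  apply: ler_wpM2r; first by rewrite !mulr_ge0.
  apply: lerXn2r; rewrite ?nnegrE ?exprn_ge0 //; exact: ltW.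
have La2 : 2 * C <= L%:R * (a ^+ 2 * e).
  by rewrite -ler_pdivrMr // mulr_gt0 // exprn_gt0.
have /(_ L) := bern; move: sL; move: (s ^+ L) => u sL H.
have H2 : (u * (L%:R * a)) ^+ 2 <= 1.
  by rewrite expr_le1 // ?mulr_ge0 // ltW.
have : u ^+ 2 * L%:R * (2 * C) <= u ^+ 2 * L%:R * (L%:R * (a ^+ 2 * e)).
  by rewrite ler_wpM2l // mulr_ge0 ?sqr_ge0 // ltW.
have : (u * (L%:R * a)) ^+ 2 * e <= e by rewrite ler_piMl // ltW.
rewrite !exprMn => h1 h2; apply: le_trans h1.
rewrite (_ : u ^+ 2 * (L%:R * 2 * C) = u ^+ 2 * L%:R * (2 * C)); last by ring.
by apply: le_trans h2 _; rewrite le_eqVlt; apply/orP; left; apply/eqP; ring.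
Qed.

(* [('X - w) * q] plays the role of [F] times the Blaschke factor of [w]; the
   geometric sum replacing [1 / (1 - w^* z)] keeps everything polynomial. *)
Lemma add_zero F w (e : R) : modc w < 1 -> 0 < e ->
  exists q : {poly R[i]}, [/\
    dirichlet_poly (('X - w%:P) * q) <=
      dirichlet_poly F + e + (1 - modc w ^+ 2) * hardy_poly q,
    (forall z, modc z = 1 ->
       modc (1 - w^* * z) * modc q.[z] <= (1 + e) * modc F.[z]),
    q.[0] = F.[0] & forall x, F.[x] = 0 -> q.[x] = 0].
Proof.
move=> w1 e0; have w01 : 0 <= modc w < 1 by rewrite modc_ge0.
(* [L] beyond the size of [F] keeps the two parts of [qE] from overlapping, and [L > 0] gives [q.[0]
   = F.[0]]. *)
have [L sL [L1 L2]] := exists_small_pow (size F).+1 w01 (hardy_poly_ge0 F) e0.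
have qE : (1 - w^* *: 'X) * (F * \sum_(i < L) w^* ^+ i *: 'X^i) =
          (1 - w^* ^+ L *: 'X^L) * F.
  by rewrite mulrCA geom_polyE mulrC.
exists (F * \sum_(i < L) w^* ^+ i *: 'X^i); split.
- rewrite dirichlet_poly_factor qE lerD2r.
  apply: le_trans (dirichlet_poly_tail _ (ltnW sL)) _.
  by rewrite lerD2l modc_conj.
- move=> z z1; rewrite -Normc.normcM.
  have /(congr1 (horner^~ z)) := qE; rewrite [in LHS]hornerM [in RHS]hornerM.
  rewrite !hornerE => ->; rewrite Normc.normcM ler_wpM2r ?modc_ge0 //.
  apply: le_trans (modcB _ _) _; rewrite Normc.normc1 lerD2l.
  by rewrite Normc.normcM !modcX modc_conj z1 expr1n mulr1.
- have /(congr1 (horner^~ 0)) := qE; rewrite !hornerE /= !expr0n.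
  by rewrite (_ : (L == 0)%N = false) ?mulr0 ?subr0 ?mul1r //; case: (L) sL.
by move=> x Fx; rewrite hornerM Fx mul0r.
Qed.

End Bergman.

(** * The truncated logarithmic kernel *)

Section LogKernel.
Variable R : realType.
Implicit Types (z w : R[i]).

(** The term of index 0 vanishes because [0^-1 = 0]. *)
Definition harmonic_sum n : R := \sum_(m < n.+1) (m%:R)^-1.

Lemma harmonic_sumS n : harmonic_sum n.+1 = harmonic_sum n + (n.+1%:R)^-1.
Proof. by rewrite /harmonic_sum big_ord_recr. Qed.

Lemma harmonic_sum_ge n : ln (n.+1%:R) <= harmonic_sum n.
Proof.
elim: n => [|n IHn]; first by rewrite ln1 /harmonic_sum big_ord1 invr0.
rewrite harmonic_sumS.
have n0 : 0 < (n.+1%:R : R) by rewrite ltr0n.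
have -> : n.+2%:R = n.+1%:R * (1 + (n.+1%:R)^-1) :> R.
  by rewrite mulrDr mulr1 divff ?gt_eqF // natr1.
have v0 : 0 < (n.+1%:R : R)^-1 by rewrite invr_gt0.
by rewrite lnM ?posrE ?addr_gt0 // lerD // le_ln1Dx // (lt_trans _ v0) // ltrN10.
Qed.

Lemma harmonic_sum_le n : harmonic_sum n.+1 <= 1 + ln (n.+1%:R).
Proof.
elim: n => [|n IHn].
  by rewrite ln1 addr0 /harmonic_sum big_ord_recr big_ord1 /= invr0 add0r invr1.
rewrite harmonic_sumS.
have n0 : 0 < (n.+2%:R : R) by rewrite ltr0n.
have : ln (n.+1%:R : R) <= ln n.+2%:R - (n.+2%:R)^-1.
  have -> : n.+1%:R = n.+2%:R * (1 - (n.+2%:R)^-1) :> R.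
    by rewrite mulrBr mulr1 divff ?gt_eqF // -[in RHS]natr1 addrK.
  have v1 : (n.+2%:R : R)^-1 < 1 by rewrite invf_lt1 // ltr1n.
  by rewrite lnM ?posrE ?subr_gt0 // lerD2l le_ln1Dx // ltrN2.
by move=> H; rewrite -lerBrDr; apply: le_trans IHn _; rewrite -addrA lerD2l.
Qed.

(** The Taylor polynomial of [- log (1 - z)]; its constant coefficient is [0^-1 = 0]. *)
Definition log_poly N : {poly R[i]} := \poly_(m < N.+1) (m%:R)^-1.

Lemma modc_XnB1 z n : modc z <= 1 -> modc (z ^+ n - 1) <= n%:R * modc (1 - z).
Proof.
move=> z1; rewrite subrX1 Normc.normcM modcBC mulrC ler_wpM2r ?modc_ge0 //.
apply: le_trans (modc_sum _ _ _) _.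
rewrite -[leRHS]mulr1 mulr_natl -[in leRHS](card_ord n) -sumr_const ler_sum // => i _.
by rewrite modcX exprn_ile1 ?modc_ge0.
Qed.

Lemma modc_invn n : modc ((n%:R : R[i])^-1) = (n%:R)^-1.
Proof. by rewrite Normc.normcV modc_nat. Qed.

Lemma log_sum_head z n : modc z <= 1 ->
  modc (\sum_(m < n.+1) z ^+ m / m%:R - (harmonic_sum n)%:C) <= n%:R * modc (1 - z).
Proof.
move=> z1; rewrite /harmonic_sum rmorph_sum /= -sumrB big_ord_recl.
rewrite invr0 mulr0 fmorphV rmorph0 invr0 subrr add0r.
apply: le_trans (modc_sum _ _ _) _.
rewrite mulr_natl -[in leRHS](card_ord n) -sumr_const ler_sum // => i _.
rewrite fmorphV rmorph_nat -[X in _ - X]mul1r -mulrBl Normc.normcM modc_invn /=.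
rewrite ler_pdivrMr ?ltr0n // mulrC; exact: modc_XnB1.
Qed.

(** Abel summation: multiplying by [1 - z] turns the coefficients into differences of consecutive
    [1 / j], which have one sign and telescope. *)
Lemma log_sum_tail z n N : modc z <= 1 -> (n <= N)%N ->
  modc ((1 - z) * \sum_(n <= j < N) z ^+ j.+1 / j.+1%:R) <= 2 / n.+1%:R.
Proof.
move=> z1 nN; have zX m : modc (z ^+ m) <= 1 by rewrite modcX exprn_ile1 ?modc_ge0.
(* The boundary term of the Abel summation is kept on the left and the bound sharpened accordingly,
   so that the induction closes. *)
suff H : modc ((1 - z) * \sum_(n <= j < N) z ^+ j.+1 / j.+1%:R + z ^+ N.+1 / N.+1%:R)
    <= 2 / n.+1%:R - (N.+1%:R)^-1.
  rewrite -[X in modc X](addrK (z ^+ N.+1 / N.+1%:R)).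
  apply: le_trans (modcB _ _) _; rewrite -(subrK (N.+1%:R^-1) (2 / _)) lerD //.
  by rewrite Normc.normcM modc_invn ler_piMl.
rewrite -(subnKC nN); elim: (N - n)%N => [|k IHk].
  rewrite addn0 big_geq // mulr0 add0r Normc.normcM modc_invn.
  rewrite mulrDl mul1r addrK ler_piMl //.
rewrite addnS big_nat_recr ?leq_addr //=; move: IHk; set T := \sum_(n <= j < _) _.
set M := (n + k)%N => IHk.
have -> : (1 - z) * (T + z ^+ M.+1 / M.+1%:R) + z ^+ M.+2 / M.+2%:R =
  ((1 - z) * T + z ^+ M.+1 / M.+1%:R) - z ^+ M.+2 * ((M.+1%:R)^-1 - (M.+2%:R)^-1).
  by rewrite !exprS; ring.
apply: le_trans (modcB _ _) _.
have -> : 2 / n.+1%:R - (M.+2%:R)^-1 =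
  (2 / n.+1%:R - (M.+1%:R)^-1) + (M.+1%:R^-1 - (M.+2%:R)^-1) :> R by ring.
rewrite lerD // Normc.normcM.
have -> : (M.+1%:R)^-1 - (M.+2%:R)^-1 = ((M.+1%:R)^-1 - (M.+2%:R)^-1 : R)%:C :> R[i].
  by rewrite rmorphB !fmorphV !rmorph_nat.
have d0 : 0 <= (M.+1%:R)^-1 - (M.+2%:R)^-1 :> R.
  by rewrite subr_ge0 lef_pV2 ?posrE ?ltr0n // ler_nat.
by rewrite modc_real (ger0_norm d0) ler_piMl.
Qed.

(** With [d = modc (1 - z)], the series is cut at the integer part [n] of [1 / d]: up to [n] the
    powers of [z] are close to 1 and give a harmonic sum, near [- ln d]; beyond [n] oscillation
    bounds the rest by 2. If [d <= 1 / N] only the first range exists, whence the truncation at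
    [1 / N]. *)
Lemma log_poly_estimate N z : (0 < N)%N -> modc z <= 1 ->
  modc ((log_poly N).[z] + (ln (Num.max (modc (1 - z)) (N%:R)^-1))%:C) <= 5.
Proof.
move=> N0 z1; set d := modc (1 - z).
have NR : 0 < (N%:R : R) by rewrite ltr0n.
have LE : (log_poly N).[z] = \sum_(m < N.+1) z ^+ m / m%:R.
  by rewrite horner_poly; apply: eq_bigr => i _; rewrite mulrC.
have [dN|dN] := leP d (N%:R)^-1.
  have -> : (log_poly N).[z] + (ln N%:R^-1)%:C =
    (\sum_(m < N.+1) z ^+ m / m%:R - (harmonic_sum N)%:C) + (harmonic_sum N - ln N%:R)%:C.
    by rewrite LE lnV ?posrE // rmorphN rmorphB /=; ring.
  apply: le_trans (modcD _ _) _; rewrite modc_real.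
  have := log_sum_head N z1; rewrite -/d.
  have : N%:R * d <= 1 by rewrite -ler_pdivlMl // mulr1.
  have : `|harmonic_sum N - ln N%:R| <= 1.
    have := harmonic_sum_ge N; have : ln (N%:R : R) <= ln N.+1%:R.
      by rewrite ler_ln ?posrE ?ltr0n // ler_nat.
    by case: (N) N0 => // k _; have := harmonic_sum_le k; rewrite ler_norml; lra.
  lra.
have d0 : 0 < d by apply: lt_trans dN; rewrite invr_gt0.
have d2 : d <= 2.
  by rewrite /d; have := modcB 1 z; rewrite Normc.normc1; move: z1; lra.
have dV0 : 0 <= d^-1 by rewrite invr_ge0 ltW.
pose n := Num.truncn d^-1.
have /andP[n1 n2] : n%:R <= d^-1 < n.+1%:R by exact: truncn_itv.
have nN : (n <= N)%N.
  by rewrite -(ler_nat R); apply: le_trans n1 _; rewrite invf_ple ?posrE // ltW.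
have -> : (log_poly N).[z] + (ln d)%:C =
    (\sum_(m < n.+1) z ^+ m / m%:R - (harmonic_sum n)%:C) +
    \sum_(n <= j < N) z ^+ j.+1 / j.+1%:R + (harmonic_sum n + ln d)%:C.
  rewrite LE -(big_mkord xpredT (fun m => z ^+ m / m%:R)).
  rewrite (big_cat_nat (n := n.+1)) //= big_add1 /= big_mkord.
  by rewrite rmorphD /=; ring.
apply: le_trans (modcD _ _) _; rewrite modc_real.
have T : modc (\sum_(n <= j < N) z ^+ j.+1 / j.+1%:R) <= 2.
  have := log_sum_tail z1 nN; rewrite Normc.normcM -/d mulrC -ler_pdivlMr //.
  move=> H; apply: le_trans H _; rewrite -mulrA ler_piMr // -invfM.
  rewrite invf_le1 ?mulr_gt0 ?ltr0n // -ler_pdivrMr // div1r; exact: ltW.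
have S := log_sum_head n z1.
have nd : n%:R * d <= 1 by rewrite -ler_pdivlMr // div1r.
have H : `|harmonic_sum n + ln d| <= 1.
  have l1 : - ln d <= harmonic_sum n.
    apply: le_trans (harmonic_sum_ge n); rewrite -lnV ?posrE //.
    by rewrite ler_ln ?posrE ?invr_gt0 ?ltr0n // ltW.
  have : harmonic_sum n <= 1 - ln d.
    move: nd n1; clear -d0 d2; case: n => [|k] nd n1.
      rewrite /harmonic_sum big_ord1 invr0 subr_ge0.
      by have := @le_ln1Dx R (d - 1); rewrite [1 + _]addrC subrK => H; have := H _; lra.
    apply: le_trans (harmonic_sum_le k) _; rewrite lerD2l -lnV ?posrE //.
    by rewrite ler_ln ?posrE ?invr_gt0 ?ltr0n.
  by rewrite ler_norml; lra.
have := modcD (\sum_(m < n.+1) z ^+ m / m%:R - (harmonic_sum n)%:C)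
  (\sum_(n <= j < N) z ^+ j.+1 / j.+1%:R).
by move: S; rewrite -/d; lra.
Qed.

End LogKernel.

(** * Equilibrium weights *)

Lemma cvg_fsum (R : realType) (T : Type) (F : set_system T) {FF : Filter F}
    (I : Type) (s : seq I) (f : I -> T -> R) (a : I -> R) :
  (forall i, f i x @[x --> F] --> a i) ->
  \sum_(i <- s) f i x @[x --> F] --> \sum_(i <- s) a i.
Proof.
move=> fa; elim: s => [|i s IHs].
  by rewrite big_nil; under eq_fun do rewrite big_nil; exact: cvg_cst.
rewrite big_cons; under eq_fun do rewrite big_cons.
by apply: cvgD => //; exact: fa.
Qed.

Section QuadraticMin.
Variables (R : realType) (n : nat) (kappa : 'I_n -> 'I_n -> R).
Hypothesis kappa_sym : forall i j, kappa i j = kappa j i.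

Definition bilin (x y : 'I_n -> R) : R := \sum_i x i * \sum_j y j * kappa i j.

Lemma bilinC x y : bilin x y = bilin y x.
Proof.
rewrite /bilin; under eq_bigr do rewrite mulr_sumr.
rewrite exchange_big /=; apply: eq_bigr => j _; rewrite mulr_sumr.
by apply: eq_bigr => i _; rewrite (kappa_sym i j); ring.
Qed.

Lemma bilin_line x d e :
  bilin (fun i => x i + e * d i) (fun i => x i + e * d i) =
  bilin x x + 2 * e * bilin d x + e ^+ 2 * bilin d d.
Proof.
have -> : bilin x x + 2 * e * bilin d x + e ^+ 2 * bilin d d =
  bilin x x + e * bilin d x + e * bilin x d + e ^+ 2 * bilin d d.
  by rewrite (bilinC x d); ring.
rewrite /bilin !mulr_sumr -!big_split /=; apply: eq_bigr => i _.
have -> : \sum_j (x j + e * d j) * kappa i j =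
   \sum_j x j * kappa i j + e * \sum_j d j * kappa i j.
  by rewrite mulr_sumr -big_split /=; apply: eq_bigr => j _; ring.
by ring.
Qed.

Lemma continuous_bilin :
  continuous (fun p : 'rV[R]_n => bilin (p ord0) (p ord0)).
Proof.
move=> p; have FF : Filter (nbhs p) := nbhs_filter p.
rewrite /bilin; apply: (cvg_fsum (F := nbhs p)) => i; apply: cvgM.
  exact: coord_continuous.
apply: (cvg_fsum (F := nbhs p)) => j; apply: cvgM; last exact: cvg_cst.
exact: coord_continuous.
Qed.

(** The discrete form of Frostman's theorem. A minimiser of the quadratic form on the simplex over
    [S] exists by compactness; moving a little mass from a charged point [i] to a point [j] of [S]
    cannot lower the energy, so the potential at [i] is at most that at [j]. *)
Lemma exists_equilibrium (S : pred 'I_n) : (exists i, S i) ->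
  exists p : 'I_n -> R, [/\ forall i, 0 <= p i,
    forall i, ~~ S i -> p i = 0,
    \sum_i p i = 1,
    forall j, S j -> bilin p p <= \sum_i p i * kappa i j &
    forall j, 0 < p j -> \sum_i p i * kappa i j = bilin p p].
Proof.
move=> [i0 Si0].
pose A : set 'rV[R]_n := [set p | forall i, (if S i then `[0, 1]%classic else [set 0]) (p ord0 i)]
   `&` [set p | \sum_i p ord0 i = 1].
have A0 : A !=set0.
  exists (\row_i (i == i0)%:R); split => /=.
    move=> i; rewrite mxE; case: ifPn => Si; rewrite /= ?in_itv /=.
      by rewrite ler0n lern1; case: eqP.
    by case: eqP => // E; move: Si; rewrite E Si0.
  rewrite (bigD1 i0) //= mxE eqxx big1 ?addr0 // => i /negbTE ii0.
  by rewrite mxE ii0.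
have cA : compact A.
  apply: compact_closedI.
    have := @rV_compact R n (fun i => if S i then `[0, 1]%classic else [set 0]).
    apply. 
    by move=> i; case: ifP => _; [exact: segment_compact | exact: compact_set1].
  apply: (@preimage_closed _ _ (fun p : 'rV[R]_n => \sum_i p ord0 i) [set 1]).
    move=> p _; have FF : Filter (nbhs p) := nbhs_filter p.
    apply: (cvg_fsum (F := nbhs p)) => i; exact: coord_continuous.
  exact: closed_eq.
have [pv + pmin] := @EVT_min_rV R n _ A A0 cA (continuous_subspaceT continuous_bilin).
move/set_mem => -[/= pA psum]; pose p i := pv ord0 i.
have p0 i : 0 <= p i.
  have := pA i; case: ifP => _ /=; last by rewrite /p => ->.
  by rewrite in_itv /= => /andP[].
have pS i : ~~ S i -> p i = 0 by move=> Si; have := pA i; rewrite (negbTE Si).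
have Sp k : 0 < p k -> S k by move=> pk; apply: contraTT pk => /pS ->; rewrite ltxx.
pose U j := \sum_i p i * kappa i j.
have UE d : bilin d p = \sum_j d j * U j.
  apply: eq_bigr => j _; congr (_ * _); apply: eq_bigr => i _.
  by rewrite kappa_sym.
have step i j : 0 < p i -> S j -> U i <= U j.
  move=> pi Sj; have [->//|ij] := eqVneq i j; rewrite leNgt; apply/negP => Uij.
  pose d k : R := (k == j)%:R - (k == i)%:R.
  have dE (F : 'I_n -> R) : \sum_k d k * F k = F j - F i.
    rewrite /d; under eq_bigr do rewrite mulrBl.
    rewrite sumrB (bigD1 j) //= eqxx mul1r big1 => [|k /negbTE ->]; last by rewrite mul0r.
    rewrite (bigD1 i) //= eqxx mul1r big1 => [|k /negbTE ->]; last by rewrite mul0r.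
    by rewrite !addr0.
  have Bd : bilin d p = U j - U i by rewrite UE dE.
  pose c := Num.max (bilin d d) 1.
  have c1 : 1 <= c by rewrite le_max lexx orbT.
  have c0 : 0 < c by apply: lt_le_trans c1.
  (* At most [p i], so that masses stay nonnegative, and small enough for the second-order term to
     be at most half of the first-order gain [2 e (U i - U j)]. *)
  pose e := Num.min (p i) ((U i - U j) / c).
  have e0 : 0 < e by rewrite lt_min pi divr_gt0 // subr_gt0.
  have Si := Sp _ pi.
  have psum1 : \sum_k p k = 1 by [].
  have pile1 : p i + p j <= 1.
    rewrite -psum1 (bigD1 i) //= lerD2l (bigD1 j) 1?eq_sym //= lerDl.
    by apply: sumr_ge0.
  have := pmin (\row_k (p k + e * d k)).
  have -> : bilin ((\row_k (p k + e * d k)) ord0) ((\row_k (p k + e * d k)) ord0)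
     = bilin (fun i => p i + e * d i) (fun i => p i + e * d i).
    by congr bilin; apply/funext => k; rewrite mxE.
  rewrite bilin_line -[bilin (pv ord0) _]/(bilin p p) => pmin_d.
  have {pmin_d} H : bilin p p <= bilin p p + 2 * e * (U j - U i) + e ^+ 2 * bilin d d.
    rewrite -Bd; apply: pmin_d; apply/mem_set; split => /=.
      move=> k; rewrite mxE /d.
      have ep : e <= p i by rewrite ge_min lexx.
      have [kj|kj] := eqVneq k j; last have [ki|ki] := eqVneq k i.
      - rewrite kj Sj eq_sym (negbTE ij) subr0 mulr1 /= in_itv /=.
        by have := p0 j; lra.
      - rewrite ki Si sub0r mulrN1 /= in_itv /=; have := p0 j; lra.
      by rewrite subr0 mulr0 addr0; exact: pA.
    under eq_bigr do rewrite mxE.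
    rewrite big_split /= -mulr_sumr.
    have := dE (fun=> 1); rewrite (eq_bigr d) => [->|k _]; last by rewrite mulr1.
    by rewrite subrr mulr0 addr0.
  have e2 : e * c <= U i - U j by rewrite -ler_pdivlMr // ge_min lexx orbT.
  have cb : bilin d d <= c by rewrite le_max lexx.
  have : e ^+ 2 * bilin d d <= e * (U i - U j).
    rewrite expr2 -mulrA ler_wpM2l ?(ltW e0) //.
    by apply: le_trans e2; rewrite ler_wpM2l // ltW.
  have : 0 < e * (U i - U j) by rewrite mulr_gt0 // subr_gt0.
  by move: H; lra.
have [i1 pi1] : exists i, 0 < p i.
  apply: contrapT => H; have : \sum_i p i = 1 by [].
  rewrite big1 => [/eqP|i _]; first by rewrite eq_sym oner_eq0.
  apply/eqP; rewrite eq_le p0 andbT leNgt; apply/negP => pi.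
  by apply: H; exists i.
have UQ : bilin p p = U i1.
  rewrite UE -[RHS]mul1r -[1](psum : \sum_i p i = 1) mulr_suml.
  apply: eq_bigr => i _; have [->|pi] := eqVneq (p i) 0; first by rewrite !mul0r.
  have {}pi : 0 < p i by rewrite lt_def pi p0.
  by congr (_ * _); apply/eqP; rewrite eq_le !step ?Sp.
exists p; split => //.
- by move=> j Sj; rewrite UQ; exact: step.
- by move=> j pj; rewrite UQ; apply/eqP; rewrite eq_le !step ?Sp.
Qed.

End QuadraticMin.

(** * Discretised energy *)

Section PlaneTopology.
Variable R : realType.
Implicit Types (z w : R[i]).

Lemma lt_modcE z (e : R[i]) : 0 < e -> (`|z| < e) = (modc z < Re e).
Proof.
case: e => a b; rewrite ltcE /= => /andP[/eqP -> _].
by rewrite normc_def ltcE /= eqxx; case: z.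
Qed.

Lemma nbhs_modcP z (A : set R[i]) :
  nbhs z A <-> exists2 e : R, 0 < e & forall w, modc (z - w) < e -> A w.
Proof.
split.
  move=> /nbhs_ballP[e /= e0 eA]; exists (Re e).
    by move: e0; rewrite ltcE => /andP[].
  move=> w zw; apply: eA; rewrite -ball_normE /=.
  by rewrite lt_modcE.
move=> [e e0 eA]; apply/nbhs_ballP; exists e%:C => /=; first by rewrite ltcR.
by move=> w; rewrite -ball_normE /= lt_modcE ?ltcR //; exact: eA.
Qed.

Lemma continuous_modcP (f : R -> R[i]) (x : R) :
  (forall e : R, 0 < e -> \forall y \near x, modc (f x - f y) < e) ->
  {for x, continuous f}.
Proof.
move=> H A /nbhs_modcP[e e0 eA]; near=> y; apply: eA; near: y; exact: H.
Unshelve. all: by end_near. Qed.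

Lemma continuous_cexpi : continuous (@cexpi R).
Proof.
move=> x; apply: continuous_modcP => e e0.
near=> y; apply: le_lt_trans (cexpi_dist_le _ _) _.
near: y; exact: cvgr_dist_lt.
Unshelve. all: by end_near. Qed.

Lemma closed_modc_le z (s : R) : closed [set w | modc (z - w) <= s].
Proof.
rewrite -openC; rewrite openE => w /= /negP; rewrite -ltNge => sw.
apply/nbhs_modcP; exists (modc (z - w) - s); first by rewrite subr_gt0.
move=> v wv /=; apply/negP; rewrite -ltNge.
have := modcD (z - v) (v - w); rewrite subrKA (modcBC v).
by move: wv; lra.
Qed.

Lemma measurable_modc_le z (s : R) :
  measurable ([set w | modc (z - w) <= s] : set (borelC R)).
Proof.
rewrite -[X in measurable X]setCK; apply: measurableC.
by apply: sub_sigma_algebra; rewrite openC; exact: closed_modc_le.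
Qed.

Lemma measurable_fun_borelC (f : R -> R[i]) : continuous f ->
  measurable_fun setT (f : measurableTypeR R -> borelC R).
Proof.
move=> cf; apply: measurability => //.
move=> _ [A oA <-]; rewrite setTI; apply: open_measurable.
exact: open_comp.
Qed.

End PlaneTopology.

Section IntegralBounds.
Context d (T : measurableType d) (R : realType).
Variable mu : {measure set T -> \bar R}.

(** The integral is a difference of suprema over simple functions, which is monotone for arbitrary
    functions; so the logarithmic kernel and its potentials can be bounded without discussing their
    measurability. *)
Lemma le_integralT (f g : T -> \bar R) : (forall x, f x <= g x)%E ->
  (\int[mu]_x f x <= \int[mu]_x g x)%E.
Proof.
move=> fg; rewrite /integral; apply: leeB.
  apply: ereal_sup_le => _ [h hf <-]; exists h => // x.
  apply: le_trans (hf x) _; rewrite !patch_setT.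
  by apply: (@funepos_le T R setT f g) => //; rewrite inE.
apply: ereal_sup_le => _ [h hf <-]; exists h => // x.
apply: le_trans (hf x) _; rewrite !patch_setT.
by apply: (@funeneg_le T R setT f g) => //; rewrite inE.
Qed.

(** Made for logarithmic kernels: [u i] bounds the integrand away from the diagonal and the [B k]
    are shrinking discs that account for the singularity, so an energy is bounded through masses
    alone. *)
Lemma integral_le_cover n (A : 'I_n -> set T) (u : 'I_n -> R)
    (B : nat -> set T) (f : T -> \bar R) :
  (forall i, measurable (A i)) -> (forall k, measurable (B k)) ->
  (forall i, 0 <= u i) -> mu (~` \bigcup_(i in setT) A i) = 0%E ->
  (forall i x, A i x -> f x <= (u i)%:E + \sum_(k <oo) (\1_(B k) x)%:E)%E ->
  (\int[mu]_x f x <= \sum_(i < n) (u i)%:E * mu (A i) + \sum_(k <oo) mu (B k))%E.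
Proof.
move=> mA mB u0 muN fle; set N := ~` _ in muN.
have mN : measurable N by apply: measurableC; apply: fin_bigcup_measurable.
have mI (D : set T) : measurable D -> measurable_fun setT (fun x => (\1_D x : R)%:E).
  by move=> mD; apply/measurable_EFinP; exact: measurable_indic.
pose g1 x : \bar R := (\sum_(i < n) (u i)%:E * (\1_(A i) x)%:E)%E.
pose g2 x : \bar R := (\sum_(k <oo) (\1_(B k) x)%:E)%E.
(* Infinite on the null set outside the cover, so that the domination holds at every point, at no
   cost in the integral. *)
pose g3 x : \bar R := (+oo * (\1_N x)%:E)%E.
have g1_ge0 x : (0 <= g1 x)%E.
  by apply: sume_ge0 => i _; rewrite mule_ge0 ?lee_fin.
have g2_ge0 x : (0 <= g2 x)%E by apply: nneseries_ge0 => k _ _; rewrite lee_fin.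
have g3_ge0 x : (0 <= g3 x)%E by rewrite mule_ge0 // lee_fin.
have mg1 : measurable_fun setT g1.
  by apply: emeasurable_sum => i; apply: measurable_funeM; exact: mI.
have mg2 : measurable_fun setT g2.
  apply: ge0_emeasurable_sum => [k x _ _|k _]; first by rewrite lee_fin.
  exact: mI.
have mg3 : measurable_fun setT g3 by apply: measurable_funeM; exact: mI.
apply: (@le_trans _ _ (\int[mu]_x (g1 x + g2 x + g3 x))%E).
  apply: le_integralT => x; have [[i _ Aix]|Nx] := pselect ((\bigcup_(i in setT) A i) x).
    apply: le_trans (fle i x Aix) _; rewrite -[leLHS]adde0; apply: leeD => //.
    apply: leeD => //; rewrite /g1 (bigD1 i) //= indicE mem_set // mule1.
    by rewrite leeDl // sume_ge0 // => j _; rewrite mule_ge0 ?lee_fin.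
  rewrite /g3 indicE mem_set // mule1 addey ?leey //.
  by rewrite -ltNye (lt_le_trans (ltNyr 0)) // adde_ge0.
rewrite ge0_integralD //; last 2 first.
- by move=> x _; rewrite adde_ge0.
- exact: emeasurable_funD.
rewrite ge0_integralD //.
have -> : (\int[mu]_x g3 x = 0)%E.
  by rewrite (ge0_integralZl _ measurableT (mI _ mN)) ?integral_indic ?setIT ?muN ?mule0 //.
rewrite adde0; apply: leeD.
  rewrite /g1 ge0_integral_sum //; last 2 first.
  - by move=> i; apply: measurable_funeM; exact: mI.
  - by move=> i x _; rewrite mule_ge0 ?lee_fin.
  apply: lee_sum => i _.
  by rewrite (ge0_integralZl _ measurableT (mI _ (mA i))) ?lee_fin ?integral_indic ?setIT //.
have B0 (k : nat) x : setT x -> (0 <= (\1_(B k) x : R)%:E)%E by rewrite lee_fin.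
rewrite /g2 (integral_nneseries mu measurableT (fun k => mI _ (mB k)) B0).
by apply: lee_nneseries => [k _ _|k _]; rewrite integral_indic ?setIT.
Qed.

End IntegralBounds.

Section Smear.
Variable R : realType.

(** An image under [cexpi] of a combination of restricted Lebesgue measures, so that masses on the
    circle are computed as lengths of sets of angles. *)
Lemma exists_smear (N : nat) (c : nat -> R) (J : nat -> interval R) :
  (forall j, 0 <= c j) ->
  (\sum_(j < N) (c j)%:E * lebesgue_measure [set` J j] = 1%:E)%E ->
  exists mu : probability (borelC R) R, forall A : set (borelC R), measurable A ->
    mu A = (\sum_(j < N) (c j)%:E * lebesgue_measure ((@cexpi R @^-1` A) `&` [set` J j]))%E.
Proof.
move=> c0 csum.
pose m (j : nat) : {measure set (measurableTypeR R) -> \bar R} :=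
  mscale (NngNum (c0 j)) (mrestr lebesgue_measure (measurable_itv (J j))).
pose rho : {measure set (measurableTypeR R) -> \bar R} := msum m N.
have rhoE A : rho A = (\sum_(j < N) (c j)%:E * lebesgue_measure (A `&` [set` J j]))%E.
  by [].
have rho1 : rho setT = 1%:E.
  by rewrite rhoE -csum; apply: eq_bigr => j _; rewrite setTI.
pose rhoP : probability (measurableTypeR R) R :=
  HB.pack (msum m N) (Measure_isProbability.Build _ _ _ rho rho1).
have mX := measurable_fun_borelC (@continuous_cexpi R).
pose X : {mfun (measurableTypeR R) >-> (borelC R)} :=
  HB.pack (cexpi (R := R) : measurableTypeR R -> borelC R) (isMeasurableFun.Build _ _ _ _ _ mX).
by exists (distribution rhoP X).
Qed.

End Smear.

Lemma set_0Vmem_classic T (D : set T) : D = set0 \/ exists x, D x.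
Proof. by have [->|/set0P[x]] := eqVneq D set0; [left|right; exists x]. Qed.

Section Energy.
Variable R : realType.
Implicit Types (x w z : R[i]).

Lemma chord_ge (u : R) : 0 <= u <= 1 -> Num.min u (1 - u) <= modc (cexpi (2 * pi * u) - 1).
Proof.
have p2 := pi_ge2 R; have H (v : R) : 0 <= v <= 1 / 2 -> v <= modc (cexpi (2 * pi * v) - 1).
  move=> /andP[v0 v1]; have := @cexpi_dist_ge R (2 * pi * v) 0.
  have pv : 0 <= 2 * pi * v by rewrite mulr_ge0 // mulr_ge0 ?pi_ge0.
  rewrite subr0 cexpi0 (ger0_norm pv) => H; apply: le_trans (H _); nra.
move=> /andP[u0 u1]; have [u2|u2] := leP u (1 / 2).
  by rewrite ge_min H ?u0.
rewrite ge_min; apply/orP; right.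
have : 1 - u <= modc (cexpi (2 * pi * (1 - u)) - 1) by apply: H; lra.
have -> : 2 * pi * (1 - u) = - (2 * pi * u) + pi *+ 2 by ring.
have -> : cexpi (- (2 * pi * u) + pi *+ 2) = (cexpi (2 * pi * u))^*.
  by rewrite cexpi_conj /cexpi cosD2pi sinD2pi.
by rewrite -(modc_conj (cexpi (2 * pi * u) - 1)) rmorphB rmorph1.
Qed.

Lemma unity_root_dist N i j : (i < N)%N -> (j < N)%N -> i != j ->
  (N%:R)^-1 <= modc (unity_root R N ^+ i - unity_root R N ^+ j).
Proof.
wlog ij : i j / (j < i)%N.
  move=> H iN jN ij; have [|ij'] := ltnP j i; first by move=> h; exact: H.
  by rewrite modcBC H // 1?eq_sym // ltn_neqAle ij.
move=> iN jN _; have N0 : 0 < (N%:R : R) by rewrite ltr0n (leq_ltn_trans _ iN).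
have -> : unity_root R N ^+ i - unity_root R N ^+ j =
   unity_root R N ^+ j * (cexpi (2 * pi * ((i - j)%:R / N%:R)) - 1).
  by rewrite mulrBr mulr1 -unity_rootX -exprD subnKC // ltnW.
rewrite Normc.normcM modcX modc_unity_root expr1n mul1r.
apply: le_trans (chord_ge _); last first.
  by rewrite divr_ge0 //= ler_pdivrMr // mul1r ler_nat (leq_trans (leq_subr _ _)) // ltnW.
have NN : (i - j < N)%N by rewrite (leq_ltn_trans (leq_subr _ _)).
have i1 : 1 <= ((i - j)%:R : R) by rewrite ler1n subn_gt0.
rewrite le_min -[X in X <= _]mul1r ler_pM2r ?invr_gt0 // i1 /=.
rewrite lerBrDl -[X in _ + X]mul1r -mulrDl ler_pdivrMr // mul1r natr1 ler_nat //.
Qed.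

(** Two points of the disc are at chord distance at most [2 s], hence their angles differ by at most
    [8 s], since the interval is no longer than [pi]. *)
Lemma lebesgue_measure_arc_ball (a b s : R) x : 0 < s -> b - a <= pi ->
  (lebesgue_measure ((@cexpi R @^-1` [set w | (modc (x - w) <= s)%R]) `&` `[a, b])
    <= ((16 * s)%R)%:E)%E.
Proof.
move=> s0 ab; set D := _ `&` _.
have mD : measurable (D : set (measurableTypeR R)).
  apply: measurableI => //; rewrite -[X in measurable X]setTI.
  by apply: measurable_fun_borelC; [exact: continuous_cexpi|by []|exact: measurable_modc_le].
have [->|[t0 [/= t0x t0ab]]] := set_0Vmem_classic D.
  by rewrite measure0 lee_fin mulr_ge0 // ltW.
apply: (@le_trans _ _ (lebesgue_measure (`[t0 - 8 * s, t0 + 8 * s]%classic : set R))).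
  apply: le_measure; rewrite ?inE //.
  move=> t [/= tx tab]; rewrite in_itv /=.
  have : `|t - t0| / 4 <= modc (cexpi t - cexpi t0).
    apply: cexpi_dist_ge; move: tab t0ab; rewrite !in_itv /= => /andP[? ?] /andP[? ?].
    by rewrite ler_norml; lra.
  have := modcD (cexpi t - x) (x - cexpi t0); rewrite subrKA (modcBC _ x) => h1 h2.
  have : `|t - t0| <= 8 * s by move: tx t0x; lra.
  by rewrite ler_norml; lra.
rewrite lebesgue_measure_itv /= lte_fin; case: ifP => _; last by rewrite lee_fin mulr_ge0 // ltW.
by rewrite -EFinB lee_fin; lra.
Qed.

End Energy.

Section EnergySmear.
Variable R : realType.
Implicit Types (x w z : R[i]).

(** A dyadic count replaces the logarithm: each halving of [v] below [d] adds 1 to the series but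
    only [ln 2] to the left side. Once integrated, the series is a sum of masses of discs. At
    [v = 0] both sides are infinite. *)
Lemma neg_ln_le_count (v d : R) : 0 < d -> 0 <= v ->
  (- lne v%:E <= (- ln d)%:E + \sum_(k <oo) (if v <= d / 2 ^+ k then 1 else 0)%R%:E)%E.
Proof.
move=> d0; set c := fun k : nat => (if v <= d / 2 ^+ k then 1 else 0 : R).
have c0 (k : nat) : (0 <= (c k)%:E)%E by rewrite lee_fin /c; case: ifP.
pose S := (\sum_(k <oo) (c k)%:E)%E; rewrite -[X in (_ + X)%E]/S.
have Sge0 : (0 <= S)%E by apply: nneseries_ge0.
have partial n : v <= d / 2 ^+ n -> ((n.+1%:R)%:E <= S)%E.
  move=> vn; apply: le_trans (nneseries_lim_ge n.+1 (fun k _ _ => c0 k)).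
  rewrite sumEFin lee_fin big_mkord (eq_bigr (fun=> 1)) ?sumr_const ?card_ord // => k _.
  rewrite /c ifT // (le_trans vn) // ler_pM2l // lef_pV2 ?posrE ?exprn_gt0 //.
  by rewrite ler_weXn2l ?ler1n // -ltnS.
rewrite le_eqVlt => /predU1P[v0|v0].
  have -> : S = +oo%E.
    apply/eqyP => r r0; apply: le_trans (partial (Num.truncn r) _).
      by rewrite lee_fin ltW // truncnS_gt.
    by rewrite -v0 divr_ge0 ?exprn_ge0 // ltW.
  by rewrite addey ?leey.
rewrite lne_EFin // -EFinN; have [dv|vd] := leP d v.
  by rewrite (@le_trans _ _ (- ln d)%:E) ?lee_fin ?lerN2 ?ler_ln ?posrE // leeDl.
have dv1 : 1 < d / v by rewrite ltr_pdivlMr // mul1r.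
have l0 : 0 <= ln (d / v) by rewrite ln_ge0 // ltW.
(* With [n] the integer part of [ln (d / v)], [2 ^ n <= e ^ n <= d / v], so the first [n + 1] terms
   of the series are 1. *)
have /andP[n1 n2] := truncn_itv l0; set n := Num.truncn _ in n1 n2.
have := partial n; have -> : v <= d / 2 ^+ n.
  rewrite ler_pdivlMr ?exprn_gt0 // mulrC -ler_pdivlMr // -[leRHS]lnK ?posrE ?divr_gt0 //.
  apply: (@le_trans _ _ (expR n%:R)); last by rewrite ler_expR.
  rewrite -[n%:R]mulr1 expRM_natl lerXn2r ?nnegrE ?expR_ge0 //.
  by have := expR_ge1Dx (1 : R).
move=> /(_ isT) H; apply: le_trans (leeD2l _ H); rewrite -EFinD lee_fin.
by move/ltW: n2; rewrite ln_div ?posrE //; lra.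
Qed.

(** Each point mass is spread evenly over an arc of length [1 / (4 N)]. Different roots of unity are
    at least [1 / N] apart, so off the diagonal the kernel changes by a constant; on the diagonal
    the density, at most [4 N], gives the kernel truncated at [1 / N], up to a constant. *)
Lemma exists_low_energy (N : nat) (p : 'I_N -> R) (F : set R[i]) :
  (0 < N)%N -> (forall i, 0 <= p i) -> \sum_i p i = 1 ->
  (forall i t, 0 < p i -> 0 <= t <= (4 * N%:R)^-1 ->
     F (unity_root R N ^+ i * cexpi t)) ->
  exists2 mu : probability (borelC R) R, supported_probability F mu &
    (energy mu <= (\sum_i p i * (\sum_j p j * (3 - ln (Num.max
       (modc (unity_root R N ^+ i - unity_root R N ^+ j)) (N%:R)^-1)) + 32))%:E)%E.
Proof.
move=> N0 p0 psum pF; set xi := fun i : nat => unity_root R N ^+ i.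
have NR : 0 < (N%:R : R) by rewrite ltr0n.
have N1 : 1 <= (N%:R : R) by rewrite ler1n.
(* A quarter of the separation [1 / N]: each disc [A i] meets only its own arc, and points in the
   discs of two distinct roots are at least half as far apart as the roots. *)
pose d : R := (4 * N%:R)^-1; have d0 : 0 < d by rewrite invr_gt0 mulr_gt0.
have Nd : 4 * N%:R * d = 1 by rewrite mulfV // gt_eqF // mulr_gt0.
pose a (j : nat) : R := 2 * pi * (j%:R / N%:R).
have xiE j t : cexpi (a j + t) = xi j * cexpi t by rewrite cexpiD -unity_rootX.
pose J (j : nat) := `[a j, a j + d].
pose pn (j : nat) : R := if insub j is Some i then p i else 0.
have pnE (i : 'I_N) : pn i = p i by rewrite /pn valK.
pose c j := pn j * (4 * N%:R).
have pn0 j : 0 <= pn j by rewrite /pn; case: insubP.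
have c0 j : 0 <= c j by rewrite mulr_ge0 // ltW // mulr_gt0.
have lebJ j : lebesgue_measure [set` J j] = d%:E.
  rewrite lebesgue_measure_itv /= lte_fin ltrDl d0 -EFinB.
  by rewrite addrAC subrr add0r.
have cd j : c j * d = pn j by rewrite /c -mulrA Nd mulr1.
have csum : (\sum_(j < N) (c j)%:E * lebesgue_measure [set` J j] = 1%:E)%E.
  under eq_bigr do rewrite lebJ -EFinM cd pnE.
  by rewrite sumEFin psum.
have [mu muE] := exists_smear c0 csum.
have inJ j t : t \in J j -> exists2 s, 0 <= s <= d & cexpi t = xi j * cexpi s.
  rewrite /J in_itv /= => /andP[t1 t2]; exists (t - a j); first by lra.
  by rewrite -xiE addrC subrK.
have xi1 j : modc (xi j) = 1 by rewrite modcX modc_unity_root expr1n.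
have near_xi j t : t \in J j -> modc (xi j - cexpi t) <= d.
  move=> /inJ[s /andP[s0 sd] ->].
  rewrite -[X in X - _]mulr1 -mulrBr Normc.normcM xi1 mul1r -cexpi0.
  by apply: le_trans (cexpi_dist_le _ _) _; rewrite sub0r normrN ger0_norm.
have far (i j : 'I_N) : i != j -> 4 * d <= modc (xi i - xi j).
  move=> ij; have ij' : (i : nat) != j by rewrite val_eqE.
  apply: le_trans (unity_root_dist R (ltn_ord i) (ltn_ord j) ij').
  by rewrite /d invfM mulrA mulfV ?mul1r.
pose A (i : 'I_N) : set (borelC R) := [set w | modc (xi i - w) <= d].
have mA i : measurable (A i) by exact: measurable_modc_le.
have AJ (i j : 'I_N) t : t \in J j -> A i (cexpi t) -> i = j.
  move=> /near_xi tj ti; apply/eqP; apply: contraT => /far.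
  have := modcD (xi i - cexpi t) (cexpi t - xi j); rewrite subrKA (modcBC (cexpi t)).
  by move: ti; rewrite /A /=; lra.
have muA i : mu (A i) = (p i)%:E.
  rewrite muE // (bigD1 i) //= big1 => [|j ji].
    rewrite (_ : _ `&` _ = [set` J i]) ?lebJ -?EFinM ?cd ?pnE ?adde0 //.
    by rewrite setIidr // => t /= tJ; exact: near_xi.
  rewrite (_ : _ `&` _ = set0) ?measure0 ?mule0 //.
  apply/seteqP; split=> // t /= [tA tJ].
  by move: ji; rewrite (AJ _ _ _ tJ tA) eqxx.
have muN : mu (~` \bigcup_(i in setT) A i) = 0%E.
  rewrite muE; last by apply: measurableC; apply: fin_bigcup_measurable.
  rewrite big1 // => j _; rewrite (_ : _ `&` _ = set0) ?measure0 ?mule0 //.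
  apply/seteqP; split=> // t /= [tA tJ]; apply: tA; exists j => //.
  exact: near_xi.
(* The densities are [4 N] times weights of sum 1, and the disc meets each arc in length at most
   [16 s]; for [s = d / 2 ^ k] the mass is at most [16 / 2 ^ k], and these add up to 32. *)
have muB x s : 0 < s -> (mu [set w | (modc (x - w) <= s)%R] <= (64 * N%:R * s)%R%:E)%E.
  move=> s0; rewrite muE; last exact: measurable_modc_le.
  apply: (@le_trans _ _ (\sum_(j < N) (c j * (16 * s))%:E)%E).
    apply: lee_sum => j _; rewrite [leRHS]EFinM; apply: lee_wpmul2l; first by rewrite lee_fin.
    apply: lebesgue_measure_arc_ball => //.
    rewrite addrAC subrr add0r; apply: le_trans (pi_ge2 R).
    apply: (@le_trans _ _ 1); last by rewrite ler1n.
    by rewrite /d invf_le1 ?mulr_gt0 //; move: N1; lra.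
  rewrite sumEFin lee_fin -mulr_suml /c -mulr_suml.
  by rewrite (eq_bigr p) ?psum // mul1r; lra.
(* The 3 absorbs [ln 4] on the diagonal, where [d = 1 / (4 N)], and [ln 2] off it, and keeps [u]
   nonnegative. *)
pose u (i j : 'I_N) := 3 - ln (Num.max (modc (xi i - xi j)) (N%:R)^-1).
have max0 (i j : 'I_N) : 0 < Num.max (modc (xi i - xi j)) (N%:R)^-1.
  by rewrite lt_max invr_gt0 NR orbT.
have u0 i j : 0 <= u i j.
  rewrite subr_ge0; have := @le_ln1Dx R (Num.max (modc (xi i - xi j)) (N%:R)^-1 - 1).
  rewrite [1 + _]addrC subrK ltrBrDl subrr max0 => /(_ isT)/le_trans; apply.
  rewrite lerBlDl ge_max; apply/andP; split.
    by apply: le_trans (modcB _ _) _; rewrite !xi1; lra.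
  by apply: (@le_trans _ _ 1); [rewrite invf_le1|lra].
have ln2 : ln (2 : R) <= 1.
  by have := @le_ln1Dx R 1; rewrite (_ : 1 + 1 = 2 :> R) => [H|]; [apply: H; lra|lra].
have lnd : ln d = - ln (4 * N%:R) by rewrite /d lnV // posrE mulr_gt0.
have inner (i : 'I_N) x : A i x ->
    (\int[mu]_y (- lne (modc (x - (y : R[i])))%:E) <= (\sum_j p j * u i j + 32)%R%:E)%E.
  move=> Aix.
  pose B (k : nat) : set (borelC R) := [set w | modc (x - w) <= d / 2 ^+ k].
  have mB k : measurable (B k) by exact: measurable_modc_le.
  apply: le_trans (@integral_le_cover _ _ _ mu N A (u i) B _ mA mB (u0 i) muN _) _.
    move=> j y Ajy; have [ij|ij] := eqVneq i j.
      apply: le_trans (neg_ln_le_count d0 (modc_ge0 _)) _; apply: leeD.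
        rewrite lee_fin /u -ij subrr Normc.normc0 max_r ?invr_ge0 ?ltW //.
        rewrite lnd lnV ?posrE // !opprK (_ : 4 * N%:R = 2 * (2 * N%:R)); last by ring.
        by rewrite !lnM ?posrE ?mulr_gt0 //; move: ln2; lra.
      apply: lee_nneseries => [k _ _|k _]; first by rewrite lee_fin; case: ifP.
      rewrite lee_fin indicE; case: ifP => [h|//].
      by rewrite mem_set.
    have xy : modc (xi i - xi j) / 2 <= modc (x - y).
      have := far _ _ ij; have := modcD (xi i - x) (x - xi j).
      have := modcD (x - y) (y - xi j); rewrite !subrKA (modcBC y).
      by move: Aix Ajy; rewrite /A /=; lra.
    have f0 : 0 < modc (xi i - xi j) / 2.
      by rewrite divr_gt0 //; apply: lt_le_trans (far _ _ ij); rewrite mulr_gt0.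
    apply: (@le_trans _ _ (u i j)%:E); last first.
      by rewrite leeDl // nneseries_ge0 // => k _ _; rewrite lee_fin.
    rewrite lne_EFin ?(lt_le_trans f0) // -EFinN lee_fin /u.
    rewrite max_l; last first.
      by apply: le_trans (far _ _ ij); rewrite /d invfM mulrA mulfV ?mul1r.
    have : ln (modc (xi i - xi j) / 2) <= ln (modc (x - y)).
      by rewrite ler_ln ?posrE // (lt_le_trans f0).
    rewrite ln_div ?posrE //; last by move: f0; lra.
    by move: ln2; lra.
  rewrite EFinD; apply: leeD.
    rewrite -sumEFin; apply: lee_sum => j _.
    by rewrite [X in (_ * X)%E](muA j) -EFinM lee_fin mulrC.
  apply: (@le_trans _ _ (\sum_(k <oo) (32 / (2 ^ (k + 1))%:R)%:E)%E).
    apply: lee_nneseries => [k _ _|k _]; first exact: measure_ge0.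
    apply: le_trans (muB _ _ _) _; first by rewrite divr_gt0 // exprn_gt0.
    rewrite lee_fin (_ : 64 * N%:R * (d / 2 ^+ k) = 4 * N%:R * d * 16 / 2 ^+ k); last by ring.
    rewrite Nd natrX exprD expr1 invfM mulrA.
    have : 0 <= (2 ^+ k : R)^-1 by rewrite invr_ge0 exprn_ge0.
    by lra.
  have -> : (\sum_(k <oo) (32 / (2 ^ (k + 1))%:R)%:E = 32%:E :> \bar R)%E.
    apply/cvg_lim => //; have := @cvg_geometric_eseries_half R 32 0.
    by rewrite expr0 divr1.
  by [].
exists mu.
  pose K := @cexpi R @` \big[setU/set0]_(j < N | 0 < p j) [set` J j].
  have cK : compact K.
    apply: continuous_compact; last by apply: bigsetU_compact => j _; exact: segment_compact.
    by apply: continuous_subspaceT; exact: continuous_cexpi.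
  have KP t : (\big[setU/set0]_(j < N | 0 < p j) [set` J j]) t <->
      exists2 j : 'I_N, 0 < p j & t \in J j.
    rewrite -bigcup_seq_cond; split=> [[j /andP[_ pj] tj]|[j pj tj]]; first by exists j.
    by exists j => //=; rewrite mem_index_enum.
  exists K; split => //.
    move=> _ [t /KP[j pj tj] <-]; have [s sd ->] := inJ _ _ tj.
    exact: pF.
  rewrite muE; last first.
    apply: measurableC; rewrite -[X in measurable X]setCK; apply: measurableC.
    apply: sub_sigma_algebra; rewrite openC.
    by apply: compact_closed cK; exact: norm_hausdorff.
  rewrite big1 // => j _; have [pj|pj] := ltP 0 (p j).
    rewrite (_ : _ `&` _ = set0) ?measure0 ?mule0 //.
    apply/seteqP; split=> // t /= [tK tJ]; apply: tK; exists t => //.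
    by apply/KP; exists j.
  have pj0 : p j = 0 by apply/eqP; rewrite eq_le pj p0.
  by rewrite /c pnE pj0 mul0r mul0e.
apply: le_trans (@integral_le_cover _ _ _ mu N A
  (fun i => \sum_j p j * u i j + 32) (fun=> set0) _ mA _ _ muN _) _.
- by move=> _; exact: measurable0.
- by move=> i; rewrite addr_ge0 // sumr_ge0 // => j _; rewrite mulr_ge0.
- move=> i x Aix; apply: le_trans (inner i x Aix) _; rewrite leeDl //.
  by apply: nneseries_ge0 => k _ _; rewrite lee_fin.
rewrite eseries0 => [|k _ _]; last by rewrite measure0.
rewrite adde0 -sumEFin; apply: lee_sum => i _.
by rewrite [X in (_ * X)%E](muA i) -EFinM lee_fin mulrC.
Qed.

End EnergySmear.

(** * Polynomials that are large near the set *)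

Section Grid.
Variable R : realType.
Implicit Types (x y w z : R[i]).

Lemma cexpi_surj z : modc z = 1 -> exists2 t : R, 0 <= t < 2 * pi & cexpi t = z.
Proof.
case: z => a b z1; have ab : a ^+ 2 + b ^+ 2 = 1.
  by have := sqr_modcE (a +i* b); rewrite z1 expr1n => <-.
have a1 : -1 <= a <= 1.
  by have := sqr_ge0 b; rewrite -ler_norml -(@expr_le1 _ 2) // real_normK ?num_real //; lra.
have ca : cos (acos a) = a by apply: acosK; rewrite in_itv /=.
have s0 := acos_ge0 a1; have spi := acos_lepi a1; have p0 := pi_gt0 R.
have sa : sin (acos a) = `|b|.
  by rewrite sin_acos // (_ : 1 - a ^+ 2 = b ^+ 2) ?sqrtr_sqr //; lra.
have [b0|b0] := leP 0 b.
  exists (acos a); first by apply/andP; split; lra.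
  by rewrite /cexpi ca sa ger0_norm.
have a_lt1 : a < 1.
  rewrite lt_neqAle; case/andP: a1 => _ ->; rewrite andbT; apply/eqP => a1'.
  have /eqP : b ^+ 2 = 0 by move: ab; rewrite a1' expr1n; lra.
  by rewrite sqrf_eq0 lt_eqF.
have a_pos : 0 < acos a by apply: acos_gt0; case/andP: a1 => -> _.
exists (- acos a + pi *+ 2).
  by apply/andP; split; [rewrite -mulr_natl; lra|rewrite -[pi *+ 2]mulr_natl; lra].
by rewrite /cexpi cosD2pi sinD2pi cosN sinN ca sa ltr0_norm // opprK.
Qed.

Lemma unity_root_near (N : nat) z : (0 < N)%N -> modc z = 1 ->
  exists i : 'I_N, modc (z - unity_root R N ^+ i) <= 8 / N%:R.
Proof.
move=> N0 /cexpi_surj[t /andP[t0 t2] <-].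
have NR : 0 < (N%:R : R) by rewrite ltr0n.
have p0 : 0 < 2 * pi :> R by rewrite mulr_gt0 // pi_gt0.
pose q := t / (2 * pi) * N%:R.
have q0 : 0 <= q by rewrite mulr_ge0 ?divr_ge0 // ltW.
have /andP[n1 n2] := truncn_itv q0; set n := Num.truncn q in n1 n2.
have nN : (n < N)%N.
  rewrite -(ltr_nat R); apply: le_lt_trans n1 _.
  by rewrite /q gtr_pMl // ltr_pdivrMr // mul1r.
exists (Ordinal nN); rewrite unity_rootX /=.
apply: le_trans (cexpi_dist_le _ _) _.
have tq : t = 2 * pi * (q / N%:R).
  by rewrite /q mulfK ?gt_eqF // mulrC divfK ?gt_eqF.
have -> : t - 2 * pi * (n%:R / N%:R) = 2 * pi * ((q - n%:R) / N%:R).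
  by rewrite [in LHS]tq; ring.
rewrite ger0_norm; last first.
  by apply: mulr_ge0; [exact: ltW|apply: divr_ge0; [rewrite subr_ge0|exact: ltW]].
have q1 : (q - n%:R) <= 1 by move: n2; rewrite -natr1 => /ltW; lra.
rewrite mulrA ler_pM2r ?invr_gt0 //.
have p8 : 2 * pi <= 8 :> R by have := pihalf_lt2 R; lra.
by apply: le_trans p8; rewrite ler_piMr // ltW.
Qed.

Lemma distE_lip (E : set R[i]) w z : E !=set0 -> distE E w <= distE E z + modc (w - z).
Proof.
move=> E0; rewrite -lerBlDr; apply: lb_le_inf.
  by case: E0 => e Ee; exists (modc (z - e)); exists e.
move=> _ [e Ee <-]; rewrite lerBlDr.
apply: (@le_trans _ _ (modc (w - e))).
  apply: ge_inf; last by exists e.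
  by exists 0 => _ [f _ <-]; exact: modc_ge0.
by have := modcD (w - z) (z - e); rewrite subrKA; lra.
Qed.

Lemma distE_le (E : set R[i]) w e : E e -> distE E w <= modc (w - e).
Proof.
move=> Ee; apply: ge_inf; last by exists e.
by exists 0 => _ [f _ <-]; exact: modc_ge0.
Qed.

Lemma log_poly_conj N z : (log_poly R N).[z^*] = ((log_poly R N).[z])^*.
Proof.
rewrite !horner_poly rmorph_sum /=; apply: eq_bigr => i _.
by rewrite rmorphM /= fmorphV rmorph_nat rmorphXn.
Qed.

End Grid.

Section Block.
Variable R : realType.
Implicit Types (E : set R[i]) (x y w z : R[i]).

Definition log_potential N (p : 'I_N -> R) (c : R) : {poly R[i]} :=
  \poly_(m < N.+1) (c%:C * (m%:R)^-1 * \sum_j (p j)%:C * (unity_root R N ^+ j)^* ^+ m).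

Lemma log_potentialE N (p : 'I_N -> R) c z :
  (log_potential p c).[z] = c%:C * \sum_j (p j)%:C * (log_poly R N).[(unity_root R N ^+ j)^* * z].
Proof.
rewrite horner_poly; under eq_bigr do rewrite mulr_sumr mulr_suml.
rewrite exchange_big /= mulr_sumr; apply: eq_bigr => j _.
rewrite horner_poly !mulr_sumr; apply: eq_bigr => m _.
by rewrite exprMn; ring.
Qed.

(* [log_potential p c] reproduces point evaluations for the Dirichlet inner
   product. *)
Lemma log_potential_repr N (p : 'I_N -> R) c (h : {poly R[i]}) :
  (size h <= N.+1)%N -> h.[0] = 0 ->
  \sum_(m < N.+1) m%:R * Re (h`_m * ((log_potential p c)`_m)^*) =
  c * \sum_j p j * Re h.[unity_root R N ^+ j].
Proof.
move=> sh h0.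
transitivity (Re (\sum_(m < N.+1) c%:C * (h`_m * \sum_j (p j)%:C * (unity_root R N ^+ j) ^+ m))).
  rewrite Re_sum; apply: eq_bigr => m _.
  rewrite coef_poly ltn_ord -Re_realM !rmorphM /= oppr0 -[c +i* 0]/(c%:C) fmorphV.
  rewrite !rmorph_nat rmorph_sum /=.
  have -> : \sum_j ((p j)%:C * (unity_root R N ^+ j)^* ^+ m)^* =
     \sum_j (p j)%:C * (unity_root R N ^+ j) ^+ m.
    by apply: eq_bigr => j _; rewrite rmorphM /= rmorphXn /= conjcK oppr0.
  (* The Dirichlet pairing ignores constant coefficients while point evaluation does not; this is
     where [h.[0] = 0] enters. *)
  have [m0|m0] := eqVneq (m : nat) 0%N.
    rewrite m0 mul0r; move: h0; rewrite -horner_coef0 => ->.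
    by rewrite mul0r mulr0.
  congr Re; rewrite !mulrA; have mR : (m%:R : R[i]) != 0 by rewrite pnatr_eq0.
  by congr (_ * _); field.
rewrite -mulr_sumr Re_realM; congr (_ * _).
under [in RHS]eq_bigr do rewrite -Re_realM.
rewrite -Re_sum; congr Re; under eq_bigr do rewrite mulr_sumr.
rewrite exchange_big; apply: eq_bigr => j _; rewrite (horner_coef_wide _ sh) mulr_sumr.
by apply: eq_bigr => m _; ring.
Qed.

(** [cap F] is its inverse; bounds on energies are stated before inversion, away from the
    conventions on 0 and infinity. *)
Definition min_energy (F : set R[i]) : \bar R :=
  ereal_inf [set energy mu | mu in supported_probability F].

(** The equilibrium energy [Q] of grid points near [E] is at least [1 / c - 40], since spreading the
    weights gives a measure on [E_t]; for [c <= 1 / 80] this is at least half of [1 / c], and [g] is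
    the potential divided by [Q]. Discretisation errors become multiples of [1 / Q <= 2 c], the
    largest being [18 / Q], whence [36 c]. *)
Lemma exists_block E (t c : R) (d : nat) :
  E !=set0 -> E `<=` unit_circle -> 0 < t -> 0 < c -> c <= 1 / 80 ->
  ((c^-1)%:E <= min_energy (nbhdT E t))%E ->
  exists g : {poly R[i]}, [/\ g.[0] = 0,
    forall z, modc z <= 1 -> `|Im g.[z]| <= 36 * c /\ - (36 * c) <= Re g.[z],
    forall z, modc z = 1 -> Re g.[z] <= 2,
    forall z, modc z = 1 -> distE E z <= 2 * t / 3 -> 1 - 36 * c <= Re g.[z] &
    forall (h : {poly R[i]}) (B : R), (size h <= d)%N -> h.[0] = 0 -> 0 <= B ->
      (forall z, modc z = 1 -> Re h.[z] <= B) ->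
      dirichlet_poly (h + g) <= dirichlet_poly h + 36 * c * (B + 1)].
Proof.
move=> E0 ET t0 c0 c80 cE.
(* [N >= d] lets the pairing see all of [h]; [N >= 27 / t] keeps the arcs in [E_t], as they lie
   within [9 / N <= t / 3] of points at distance at most [2 t / 3] from [E]. *)
pose N := maxn d.+1 (Num.bound (27 / t)).
have N0 : (0 < N)%N by rewrite (leq_trans _ (leq_maxl _ _)).
have dN : (d <= N)%N by rewrite (leq_trans _ (leq_maxl _ _)).
have NR : 0 < (N%:R : R) by rewrite ltr0n.
have N1 : 1 <= (N%:R : R) by rewrite ler1n.
pose e : R := (N%:R)^-1; have e0 : 0 < e by rewrite invr_gt0.
have et : 27 * e <= t.
  rewrite ler_pdivrMr // mulrC -ler_pdivrMr // ltW //.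
  apply: lt_le_trans (Num.Theory.archi_boundP _) _; first by rewrite divr_ge0 // ltW.
  by rewrite ler_nat leq_maxr.
have e1 : e <= 1 by rewrite invf_le1.
pose xi (i : nat) : R[i] := unity_root R N ^+ i.
have xi1 i : modc (xi i) = 1 by rewrite modcX modc_unity_root expr1n.
pose S (i : 'I_N) :=
  `[< exists z, [/\ modc z = 1, distE E z <= 2 * t / 3 & modc (z - xi i) <= 8 * e] >].
have Snear z : modc z = 1 -> distE E z <= 2 * t / 3 ->
    exists2 i : 'I_N, S i & modc (z - xi i) <= 8 * e.
  move=> z1 zt; have [i zi] := unity_root_near N0 z1.
  by exists i => //; apply/asboolP; exists z.
have S0 : exists i, S i.
  case: E0 => a Ea; have a1 : modc a = 1 by exact: ET.
  have [|i Si _] := Snear a a1; last by exists i.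
  apply: le_trans (distE_le a Ea) _; rewrite subrr Normc.normc0; lra.
pose kappa (i j : 'I_N) := Re (log_poly R N).[(xi j)^* * xi i].
have kappaC i j : kappa i j = kappa j i.
  rewrite /kappa -[RHS]/(Re _) -(conjcK ((xi j)^* * xi i)) log_poly_conj.
  by rewrite rmorphM /= conjcK mulrC; case: (_.[_]).
have [p [p0 pS psum pge peq]] := exists_equilibrium kappaC S0.
set Q := bilin kappa p p in pge peq.
pose m z (j : nat) := Num.max (modc (z - xi j)) e.
have m_gt0 z j : 0 < m z j by rewrite lt_max e0 orbT.
pose md z (j : nat) := Num.max (modc (1 - (xi j)^* * z)) e.
have md_gt0 z j : 0 < md z j by rewrite lt_max e0 orbT.
have mdE z j : modc z = 1 -> md z j = m z j by move=> z1; rewrite /md -modcBcircle.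
have est z j : modc z <= 1 ->
    modc ((log_poly R N).[(xi j)^* * z] + (ln (md z j))%:C) <= 5.
  move=> z1; apply: log_poly_estimate => //.
  by rewrite Normc.normcM modc_conj xi1 mul1r.
have estR z j : modc z <= 1 -> `|Re (log_poly R N).[(xi j)^* * z] + ln (md z j)| <= 5.
  by move=> /(est z j); have := Re_le_modc ((log_poly R N).[(xi j)^* * z] + (ln (md z j))%:C);
     rewrite ReD /=; exact: le_trans.
have ln_sub1 (x : R) : 0 < x -> ln x <= x - 1.
  by move=> x0; have := @le_ln1Dx R (x - 1); rewrite [1 + _]addrC subrK; apply; lra.
have kappa_est i j : `|kappa i j + ln (m (xi i) j)| <= 5.
  by rewrite -mdE // estR // xi1.
have Sp i : 0 < p i -> S i by move=> pi; apply: contraTT pi => /pS ->; rewrite ltxx.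
have arcs (i : 'I_N) s : 0 < p i -> 0 <= s <= (4 * N%:R)^-1 -> nbhdT E t (xi i * cexpi s).
  move=> /Sp/asboolP[z [z1 zt zi]] /andP[s0 sN]; split.
    by rewrite /unit_circle /= Normc.normcM xi1 mul1r modc_cexpi.
  apply: le_trans (distE_lip _ z E0) _.
  have h1 : modc (xi i * cexpi s - xi i) <= s.
    rewrite -[X in _ - X]mulr1 -mulrBr Normc.normcM xi1 mul1r -cexpi0.
    by apply: le_trans (cexpi_dist_le _ _) _; rewrite subr0 ger0_norm.
  have h2 : s <= e by apply: le_trans sN _; rewrite lef_pV2 ?posrE ?mulr_gt0 //; lra.
  have := modcD (xi i * cexpi s - xi i) (xi i - z); rewrite subrKA (modcBC (xi i) z).
  by move: h1 h2 zi zt et; lra.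
have cst b : b = \sum_j p j * b by rewrite -mulr_suml psum mul1r.
(* 40 is 5 for replacing the truncated kernel by [kappa], plus 3 and 32 for the spreading. *)
have Qge : c^-1 - 40 <= Q.
  have [mu muF muE] := exists_low_energy N0 p0 psum arcs.
  have inf_le : (min_energy (nbhdT E t) <= energy mu)%E.
    by apply: ereal_inf_lbound; exists mu.
  have := le_trans cE (le_trans inf_le muE); rewrite lee_fin => H.
  rewrite lerBlDr; apply: le_trans H _; rewrite /Q /bilin.
  rewrite [X in _ <= _ + X]cst -big_split /=; apply: ler_sum => i _.
  have split40 (x : R) : x + 40 = x + 8 + 32 by ring.
  rewrite -mulrDr ler_wpM2l // split40 lerD2r.
  rewrite [X in _ <= _ + X]cst -big_split /=; apply: ler_sum => j _.
  rewrite -mulrDr ler_wpM2l //; have := kappa_est i j.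
  by rewrite ler_norml /m; lra.
have cV : 80 <= c^-1 by rewrite -[80]invrK lef_pV2 ?posrE //; lra.
have Q0 : 0 < Q by lra.
pose q := Q^-1; have q0 : 0 < q by rewrite invr_gt0.
have qQ : q * Q = 1 by rewrite mulVf // gt_eqF.
have qc : q <= 2 * c.
  rewrite /q -[2 * c]invrK lef_pV2 ?posrE ?invr_gt0 ?mulr_gt0 //.
  by rewrite invfM; lra.
pose g := log_potential p q.
have gE z : Re g.[z] = q * \sum_j p j * Re (log_poly R N).[(xi j)^* * z].
  rewrite log_potentialE Re_realM Re_sum; congr (_ * _).
  by apply: eq_bigr => j _; rewrite Re_realM.
have gI z : Im g.[z] = q * \sum_j p j * Im (log_poly R N).[(xi j)^* * z].
  rewrite log_potentialE Im_realM Im_sum; congr (_ * _).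
  by apply: eq_bigr => j _; rewrite Im_realM.
have sum_le (F : 'I_N -> R) (b : R) : (forall j, 0 < p j -> F j <= b) ->
    \sum_j p j * F j <= b.
  move=> Fb; rewrite -[leRHS]mul1r -psum mulr_suml; apply: ler_sum => j _.
  have [pj|pj] := ltP 0 (p j); first by rewrite ler_wpM2l // Fb.
  have -> : p j = 0 by apply/eqP; rewrite eq_le pj p0.
  by rewrite !mul0r.
have sum_ge (F : 'I_N -> R) (b : R) : (forall j, b <= F j) -> b <= \sum_j p j * F j.
  move=> Fb; rewrite -[leLHS]mul1r -psum mulr_suml; apply: ler_sum => j _.
  by rewrite ler_wpM2l.
have g00 : g.[0] = 0.
  rewrite log_potentialE big1 ?mulr0 // => j _.
  by rewrite mulr0 horner_poly big1 ?mulr0 // => k _; case: (k) => -[|l] /= lt;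
     rewrite ?invr0 ?mul0r // expr0n mulr0.
have gup z : modc z = 1 -> Re g.[z] <= 2.
  move=> z1; have [i0 pi0] : exists i, 0 < p i.
    apply: contrapT => H; have := psum; rewrite big1 => [/eqP|i _].
      by rewrite eq_sym oner_eq0.
    by apply/eqP; rewrite eq_le p0 andbT leNgt; apply/negP => pi; apply: H; exists i.
  (* A discrete maximum principle: at the charged point nearest to [z] the potential is [Q], and
     distances to charged points at most double in passing from [z] to it. *)
  have [i pi imin] := @arg_minP _ _ _ i0 (fun i => 0 < p i) (fun i : 'I_N => modc (z - xi i)) pi0.
  rewrite gE; apply: (@le_trans _ _ (q * (Q + 11))); last by rewrite mulrDr qQ; lra.
  rewrite ler_wpM2l ?(ltW q0) // -(peq i pi).
  have -> : \sum_j p j * kappa j i + 11 = \sum_j p j * (kappa i j + 11).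
    rewrite [X in _ + X = _]cst -big_split /=; apply: eq_bigr => j _.
    by rewrite (kappaC j i) -mulrDr.
  apply: ler_sum => j _; have [pj|pj] := ltP 0 (p j); last first.
    have -> : p j = 0 by apply/eqP; rewrite eq_le pj p0.
    by rewrite !mul0r.
  rewrite ler_wpM2l //.
  have mij : m (xi i) j <= 2 * m z j.
    rewrite /m ge_max; apply/andP; split.
      have := modcD (xi i - z) (z - xi j); rewrite subrKA (modcBC (xi i) z).
      have := imin j pj.
      have : modc (z - xi j) <= Num.max (modc (z - xi j)) e by rewrite le_max lexx.
      lra.
    have : e <= Num.max (modc (z - xi j)) e by rewrite le_max lexx orbT.
    by move: e0; lra.
  have lnm : ln (m (xi i) j) <= 1 + ln (m z j).
    apply: (@le_trans _ _ (ln (2 * m z j))); first by rewrite ler_ln ?posrE ?mulr_gt0.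
    by rewrite lnM ?posrE // lerD2r; apply: le_trans (ln_sub1 _ _) _; lra.
  have := estR z j; rewrite z1 lexx mdE // => /(_ isT).
  have := kappa_est i j; rewrite !ler_norml; lra.
have gsize : (size g <= N.+1)%N by exact: size_poly.
exists g; split => //.
- move=> z z1; split.
    rewrite gI normrM (gtr0_norm q0); apply: (@le_trans _ _ (q * 5)); last by lra.
    rewrite ler_wpM2l ?(ltW q0) // ler_norml; apply/andP; split.
      apply: sum_ge => j; have := est z j z1.
      move/(le_trans (Im_le_modc _)); rewrite ImD /= addr0 ler_norml; lra.
    apply: sum_le => j _; have := est z j z1.
    by move/(le_trans (Im_le_modc _)); rewrite ImD /= addr0 ler_norml; lra.
  rewrite gE; apply: (@le_trans _ _ (q * - 6)); first by lra.
  rewrite ler_wpM2l ?(ltW q0) //; apply: sum_ge => j.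
  have := estR z j z1; rewrite ler_norml.
  have : ln (md z j) <= 1.
    apply: le_trans (ln_sub1 _ (md_gt0 _ _)) _; rewrite lerBlDr ge_max; apply/andP; split; last lra.
    apply: le_trans (modcB _ _) _; rewrite Normc.normc1 Normc.normcM modc_conj xi1 mul1r; lra.
  lra.
(* The potential at [z] is compared with its value at a grid point of [S], which is at least [Q]
   whether that point is charged or not; 18 is 8 for the factor 9 between distances and twice 5 for
   the kernel. *)
- move=> z z1 zt; have [i Si zi] := Snear z z1 zt.
  rewrite gE; apply: (@le_trans _ _ (q * (Q - 18))); first by rewrite mulrBr qQ; lra.
  rewrite ler_wpM2l ?(ltW q0) //; apply: (@le_trans _ _ (\sum_j p j * (kappa i j - 18))).
    have -> : \sum_j p j * (kappa i j - 18) = \sum_j p j * kappa j i - 18.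
      rewrite [X in _ = _ - X]cst -sumrB; apply: eq_bigr => j _.
      by rewrite (kappaC j i) -mulrBr.
    by rewrite lerD2r; exact: pge.
  apply: ler_sum => j _; rewrite ler_wpM2l //.
  have mij : m z j <= 9 * m (xi i) j.
    rewrite /m ge_max; apply/andP; split.
      have := modcD (z - xi i) (xi i - xi j); rewrite subrKA.
      have : modc (xi i - xi j) <= Num.max (modc (xi i - xi j)) e by rewrite le_max lexx.
      have : e <= Num.max (modc (xi i - xi j)) e by rewrite le_max lexx orbT.
      by move: zi; lra.
    have : e <= Num.max (modc (xi i - xi j)) e by rewrite le_max lexx orbT.
    by move: e0; lra.
  have lnm : ln (m z j) <= 8 + ln (m (xi i) j).
    apply: (@le_trans _ _ (ln (9 * m (xi i) j))); first by rewrite ler_ln ?posrE ?mulr_gt0.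
    by rewrite lnM ?posrE // lerD2r; apply: le_trans (ln_sub1 _ _) _; lra.
  have := estR z j; rewrite z1 lexx mdE // => /(_ isT).
  have := kappa_est i j; rewrite !ler_norml; lra.
move=> h B sh h0 B0 hB.
have shN : (size h <= N.+1)%N by rewrite (leq_trans sh) // ltnW.
rewrite (dirichlet_polyD shN gsize) log_potential_repr //.
(* The energy of [g] is its pairing with itself, hence [q] times an average of [Re g], which is at
   most 2. *)
have -> : dirichlet_poly g = q * \sum_j p j * Re g.[xi j].
  rewrite (dirichlet_polyE gsize) -(log_potential_repr p q gsize g00).
  by apply: eq_bigr => k _; rewrite -sqr_modc_conj.
have H1 : \sum_j p j * Re g.[xi j] <= 2 by apply: sum_le => j _; exact: gup.
have H2 : \sum_j p j * Re h.[unity_root R N ^+ j] <= B.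
  by apply: sum_le => j _; apply: hB; exact: xi1.
rewrite -addrA lerD2l.
apply: (@le_trans _ _ (q * 2 + 2 * (q * B))).
  by rewrite lerD // ?ler_wpM2l // ?(ltW q0) // ler_wpM2l // ltW.
have : q * (B + 1) <= 2 * c * (B + 1) by rewrite ler_wpM2r //; lra.
have : 0 <= c * (B + 1) by rewrite mulr_ge0 ?(ltW c0) //; lra.
lra.
Qed.

End Block.

Section SumBlocks.
Variable R : realType.
Implicit Types (E : set R[i]) (z : R[i]).

(** Block [k] meets a sum of [k] blocks, whose real part is at most [2 k] on the circle, so it costs
    [36 c k (2 k + 1)]. A block contributes almost 1 where its scale reaches [z] and is almost
    nonnegative elsewhere. *)
Lemma exists_sum_blocks E (s c : nat -> R) (K : nat) :
  E !=set0 -> E `<=` unit_circle ->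
  (forall k, 0 < s k) -> (forall k, 0 < c k <= 1 / 80) ->
  (forall k, ((c k)^-1%:E <= min_energy (nbhdT E (s k)))%E) ->
  exists h : {poly R[i]}, [/\ h.[0] = 0,
    forall z, modc z <= 1 -> `|Im h.[z]| <= 36 * \sum_(k < K) c k
      /\ - (36 * \sum_(k < K) c k) <= Re h.[z],
    forall z, modc z = 1 -> Re h.[z] <= 2 * K%:R,
    dirichlet_poly h <= 36 * \sum_(k < K) c k * (2 * k%:R + 1) &
    forall z, modc z = 1 ->
      (\sum_(k < K) (distE E z <= 2 * s k / 3)%R)%N%:R - 36 * \sum_(k < K) c k
        <= Re h.[z]].
Proof.
move=> E0 ET s0 c0 cE; elim: K => [|K [h [h0 hdisc hup hD hlow]]].
  exists 0; split=> [|z _|z _||z _]; rewrite ?horner0 ?big_ord0 ?mulr0 ?oppr0 ?subr0 ?normr0 //.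
    by rewrite /dirichlet_poly size_poly0 big_ord0.
  by rewrite addr0.
have [cK0 cK80] : 0 < c K /\ c K <= 1 / 80 by apply/andP; exact: c0.
have [g [g0 gdisc gup glow gD]] := exists_block (size h) E0 ET (s0 K) cK0 cK80 (cE K).
exists (h + g); rewrite !big_ord_recr /=; split=> [|z z1|z z1||z z1].
- by rewrite hornerD h0 g0 addr0.
- rewrite hornerD ImD ReD mulrDr; have [h1 h2] := hdisc z z1; have [g1 g2] := gdisc z z1.
  split; last by lra.
  by apply: le_trans (ler_normD _ _) _; lra.
- rewrite hornerD ReD -natr1; have := hup z z1; have := gup z z1; lra.
- rewrite mulrDr; have K0 : 0 <= 2 * K%:R :> R by rewrite mulr_ge0.
  have := gD h (2 * K%:R) (leqnn _) h0 K0 hup; lra.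
- rewrite hornerD ReD big_ord_recr natrD /=; have := hlow z z1.
  have [d|_] := boolP (distE E z <= _).
    by have := glow z z1 d; rewrite mulr1n; lra.
  have /gdisc[_] : modc z <= 1 by rewrite z1.
  by rewrite mulr0n; lra.
Qed.

End SumBlocks.

(** * Polynomial approximation of the double exponential *)

Section ExpApprox.
Variable R : realType.
Implicit Types (w z : R[i]) (x : R).

(** The lower bound that complements [1 + x <= expR x]; it is the same inequality taken at
    [- x / (1 + x)]. *)
Lemma expR_le_1Dx x : -1 < x -> expR (x / (1 + x)) <= 1 + x.
Proof.
move=> x1; have p : 0 < 1 + x by lra.
have : expR (- (x / (1 + x))) >= 1 - x / (1 + x) by exact: expR_ge1Dx.
have -> : 1 - x / (1 + x) = (1 + x)^-1 by field; rewrite gt_eqF.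
by rewrite expRN lef_pV2 ?posrE ?expR_gt0.
Qed.

(** The squared modulus of [1 + w / m] is [1 + 2 Re w / m + modc w ^ 2 / m ^ 2], bounded by an
    exponential. The exponent [j] may also be [m - 1], which occurs in derivatives. *)
Lemma modc_1DdivX_le w (m j : nat) (r : R) : (0 < m)%N -> modc w <= r ->
  2 * r <= m%:R -> r ^+ 2 <= m%:R -> (m <= j.+1)%N -> (j <= m)%N ->
  modc ((1 + w / m%:R) ^+ j) <= expR (Re w + 1).
Proof.
move=> m0 wr rm r2m mj jm; have mR : 0 < (m%:R : R) by rewrite ltr0n.
have r0 : 0 <= r by apply: le_trans wr; exact: modc_ge0.
have Rew : `|Re w| <= r by apply: le_trans (Re_le_modc w) wr.
rewrite -ler_sqr ?nnegrE ?modc_ge0 ?expR_ge0 //.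
have u2 : modc (1 + w / m%:R) ^+ 2 = 1 + (2 * Re w / m%:R + modc w ^+ 2 / m%:R ^+ 2).
  rewrite -real_complex_natr -fmorphV mulrC !sqr_modcE ReD ImD Re_realM Im_realM /= add0r.
  by field; rewrite gt_eqF.
rewrite modcX -exprM mulnC exprM u2.
apply: (@le_trans _ _ (expR (2 * Re w / m%:R + modc w ^+ 2 / m%:R ^+ 2) ^+ j)).
  by rewrite lerXn2r ?nnegrE ?expR_ge0 ?expR_ge1Dx // -u2 sqr_ge0.
rewrite -expRM_natl -[leRHS]expRM_natl ler_expR.
have jm1 : (j%:R : R) / m%:R <= 1 by rewrite ler_pdivrMr // mul1r ler_nat.
have jm2 : 1 - (m%:R)^-1 <= (j%:R : R) / m%:R.
  rewrite ler_pdivlMr // mulrBl mul1r mulVf ?gt_eqF // lerBlDr natr1 ler_nat //.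
have -> : j%:R * (2 * Re w / m%:R + modc w ^+ 2 / m%:R ^+ 2) =
   2 * Re w * (j%:R / m%:R) + modc w ^+ 2 / m%:R * (j%:R / m%:R).
  by field; rewrite gt_eqF.
have h1 : modc w ^+ 2 / m%:R <= 1.
  by rewrite ler_pdivrMr // mul1r; apply: le_trans r2m; rewrite lerXn2r ?nnegrE ?modc_ge0.
have h10 : 0 <= modc w ^+ 2 / m%:R by rewrite divr_ge0 ?sqr_ge0 // ltW.
have h2 : modc w ^+ 2 / m%:R * (j%:R / m%:R) <= 1.
  have jm0 : 0 <= (j%:R : R) / m%:R by rewrite divr_ge0 // ltW.
  exact: mulr_ile1.
have h3 : Re w * (j%:R / m%:R) <= Re w + 1 / 2.
  rewrite -lerBlDl -[X in _ - X]mulr1 -mulrBr.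
  apply: (@le_trans _ _ (`|Re w| * (m%:R)^-1)).
    apply: le_trans (ler_norm _) _; rewrite normrM ler_wpM2l //.
    by rewrite ler0_norm ?subr_le0 //; lra.
  by rewrite ler_pdivrMr //; lra.
lra.
Qed.

(** While the moduli stay below 2, induction on the exponent [j] bounds the imaginary part by
    [2 j |t|], and then the real part from below by [1 - j ^ 2 t ^ 2]. *)
Lemma Re_1DiX_ge (t : R) (m : nat) : m%:R * t ^+ 2 <= 1 / 2 -> m%:R ^+ 2 * t ^+ 2 <= 1 / 2 ->
  1 / 2 <= Re ((1 +i* t) ^+ m).
Proof.
move=> mt1 mt2.
have bound j : (j <= m)%N -> modc ((1 +i* t) ^+ j) <= 2.
  move=> jm; rewrite modcX -(@ler_sqr _ _ 2) ?nnegrE ?exprn_ge0 ?modc_ge0 //.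
  rewrite -exprM mulnC exprM sqr_modcE /= expr1n.
  apply: (@le_trans _ _ (expR (1 / 2))); last first.
    have : 1 - 1 / 2 <= expR (- (1 / 2)) :> R by exact: expR_ge1Dx.
    rewrite expRN; have := expR_gt0 (1 / 2 : R); move: (expR _) => y y0 h.
    have := ler_wpM2r (ltW y0) h; rewrite mulVf ?gt_eqF //.
    lra.
  apply: (@le_trans _ _ (expR (t ^+ 2) ^+ j)).
    by rewrite lerXn2r ?nnegrE ?expR_ge0 ?expR_ge1Dx // addr_ge0 ?sqr_ge0.
  rewrite -expRM_natl ler_expR; apply: le_trans mt1.
  by rewrite ler_wpM2r ?sqr_ge0 // ler_nat.
have ImB j : (j <= m)%N -> `|Im ((1 +i* t) ^+ j)| <= 2 * j%:R * `|t|.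
  elim: j => [|j IHj] jm; first by rewrite expr0 /= normr0 mulr0 mul0r.
  rewrite exprS ImM /= mul1r; apply: le_trans (ler_normD _ _) _.
  rewrite normrM -[j.+1%:R]natr1 mulrDr mulrDl lerD //; first by apply: IHj; exact: ltnW.
  rewrite mulr1 mulrC ler_wpM2r //; apply: le_trans (Re_le_modc _) _.
  by apply: bound; exact: ltnW.
have ReB j : (j <= m)%N -> 1 - j%:R ^+ 2 * t ^+ 2 <= Re ((1 +i* t) ^+ j).
  elim: j => [|j IHj] jm; first by rewrite expr0 expr0n /= mul0r subr0.
  rewrite [X in _ <= Re X]exprS ReM /= mul1r; have := IHj (ltnW jm).
  have : t * Im ((1 +i* t) ^+ j) <= 2 * j%:R * t ^+ 2.
    apply: le_trans (ler_norm _) _; rewrite normrM -(real_normK (num_real t)) expr2 mulrA.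
    by rewrite mulrC ler_wpM2r // ImB // ltnW.
  rewrite -[j.+1%:R]natr1; have := sqr_ge0 t; move: (t ^+ 2) => T T0 h1 h2; lra.
by apply: le_trans (ReB m (leqnn m)); lra.
Qed.

(** With [s = Re w / m], the base is [1 + s] times [1 + i t]. The power of [1 + s] is at least half
    of [expR (Re w)]; as [|Im w| <= 1 / 2], the power of [1 + i t] turns too little to lose more
    than another half. *)
Lemma Re_1DdivX_ge w (m : nat) (r : R) : (0 < m)%N -> modc w <= r -> `|Im w| <= 1 / 2 ->
  4 * r <= m%:R -> 4 * r ^+ 2 <= m%:R -> 2 <= (m%:R : R) ->
  expR (Re w) / 4 <= Re ((1 + w / m%:R) ^+ m).
Proof.
move=> m0 wr wI rm r2m m2; have mR : 0 < (m%:R : R) by rewrite ltr0n.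
have mV : m%:R * (m%:R)^-1 = 1 :> R by rewrite mulfV // gt_eqF.
have Rew : `|Re w| <= r by apply: le_trans (Re_le_modc w) wr.
pose s := Re w / m%:R; pose b := Im w / m%:R.
have s4 : `|s| <= 1 / 4.
  by rewrite normrM normfV (gtr0_norm mR) ler_pdivrMr //; lra.
move: s4; rewrite ler_norml => /andP[s4 s4'].
have a0 : 0 < 1 + s by lra.
pose t := b / (1 + s).
have -> : 1 + w / m%:R = (1 + s)%:C * (1 +i* t).
  rewrite -real_complex_natr -fmorphV mulrC; apply/eqP; rewrite eq_complex.
  apply/andP; split; apply/eqP.
    by rewrite ReD !Re_realM /= /s; ring.
  have tE : (1 + s) * t = b by rewrite /t mulrC divfK ?gt_eqF.
  by rewrite ImD !Im_realM /= tE /b; ring.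
rewrite exprMn -rmorphXn /= Re_realM.
have tm : m%:R * `|t| <= 2 / 3.
  rewrite /t /b !normrM !normfV (gtr0_norm mR) (gtr0_norm a0) !mulrA.
  rewrite ler_pdivrMr // [m%:R * _]mulrC mulfK ?gt_eqF //; lra.
have t0 := normr_ge0 t.
have t2 : t ^+ 2 = `|t| ^+ 2 by rewrite real_normK // num_real.
have mt2 : m%:R ^+ 2 * t ^+ 2 <= 4 / 9.
  have mt0 : 0 <= m%:R * `|t| by rewrite mulr_ge0 // ltW.
  by rewrite t2 -exprMn; move: tm mt0; move: (_ * _) => y; nra.
have mt1 : m%:R * t ^+ 2 <= m%:R ^+ 2 * t ^+ 2.
  by rewrite ler_wpM2r ?sqr_ge0 // expr2 ler_peMr ?ltW //; lra.
have X : 1 / 2 <= Re ((1 +i* t) ^+ m) by apply: Re_1DiX_ge; lra.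
have aX : expR (Re w) / 2 <= (1 + s) ^+ m.
  apply: (@le_trans _ _ (expR (s / (1 + s)) ^+ m)); last first.
    by rewrite lerXn2r ?nnegrE ?expR_ge0 ?(ltW a0) // expR_le_1Dx //; lra.
  rewrite -expRM_natl; apply: (@le_trans _ _ (expR (Re w - 1 / 2))).
    rewrite expRD ler_wpM2l ?expR_ge0 //.
    by have : 1 + - (1 / 2) <= expR (- (1 / 2)) :> R by [exact: expR_ge1Dx]; lra.
  rewrite ler_expR.
  have -> : m%:R * (s / (1 + s)) = Re w - m%:R * s ^+ 2 / (1 + s).
    rewrite /s; field; rewrite gt_eqF //= gt_eqF //; move: a0.
    by rewrite /s -(ltr_pM2l mR) mulr0 mulrDr mulr1 mulrC divfK // gt_eqF.
  rewrite lerD2l lerN2 ler_pdivrMr //.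
  have -> : m%:R * s ^+ 2 = Re w ^+ 2 / m%:R by rewrite /s; field; rewrite gt_eqF.
  have : Re w ^+ 2 / m%:R <= 1 / 4.
    rewrite ler_pdivrMr // -(real_normK (num_real (Re w))).
    have := normr_ge0 (Re w); have : `|Re w| ^+ 2 <= r ^+ 2.
      by rewrite lerXn2r ?nnegrE //; apply: le_trans Rew.
    lra.
  lra.
have -> : expR (Re w) / 4 = expR (Re w) / 2 * (1 / 2) by field.
by rewrite ler_pM // divr_ge0 // expR_ge0.
Qed.

End ExpApprox.

Section Outer.
Variable R : realType.
Implicit Types (z : R[i]) (h f : {poly R[i]}).

Lemma modc_horner_le h z : modc z <= 1 -> modc h.[z] <= \sum_(i < size h) modc h`_i.
Proof.
move=> z1; rewrite horner_coef; apply: le_trans (modc_sum _ _ _) _.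
apply: ler_sum => i _; rewrite Normc.normcM modcX ler_piMr ?modc_ge0 //.
by rewrite exprn_ile1 ?modc_ge0.
Qed.

(* [f] approximates [exp (- C e^h)]; since [|Im h| <= 1/2], the real part of
   [e^h] is comparable to its modulus. *)
Lemma exists_double_exp h (C : R) : 1 <= C -> h.[0] = 0 ->
  (forall z, modc z <= 1 -> `|Im h.[z]| <= 1 / 2) ->
  exists f : {poly R[i]}, [/\
    forall z, modc z <= 1 -> modc f^`().[z] <= 4 * expR 2 * modc h^`().[z],
    forall z, modc z <= 1 ->
      modc f.[z] ^+ 2 <= expR (2 - C * expR (Re h.[z]) / 2) &
    expR (- (2 * C)) <= modc f.[0]].
Proof.
move=> C1 h0 hI; pose r := \sum_(i < size h) modc h`_i.
have r0 : 0 <= r by apply: sumr_ge0 => i _; exact: modc_ge0.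
pose r' := C * expR (r + 1); have r'0 : 0 <= r' by rewrite mulr_ge0 ?expR_ge0 //; lra.
have hr z : modc z <= 1 -> modc h.[z] <= r by exact: modc_horner_le.
(* The sum of all lower bounds on [m] that the approximations of both exponentials ask for. *)
pose B := 4 * r + 4 * r ^+ 2 + 2 + 2 * r' + r' ^+ 2 + 2 * C.
have B0 : 0 <= B by rewrite /B !addr_ge0 // ?mulr_ge0 ?sqr_ge0 //; lra.
pose m := Num.bound B.
have mB : B <= m%:R by apply/ltW/Num.Theory.archi_boundP.
have rr0 := sqr_ge0 r; have rr0' := sqr_ge0 r'.
have mR : 0 < (m%:R : R) by move: mB; rewrite /B; lra.
have m0 : (0 < m)%N by move: mR; rewrite ltr0n.
pose a : R[i] := (m%:R)^-1.
have am : a * m%:R = 1 by rewrite mulVf // pnatr_eq0 -lt0n.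
pose u : {poly R[i]} := 1 + a *: h; pose v : {poly R[i]} := - (C%:C *: u ^+ m).
pose f : {poly R[i]} := (1 + a *: v) ^+ m.
have uE z : u.[z] = 1 + h.[z] / m%:R by rewrite /u !hornerE mulrC.
have vE z : v.[z] = - (C%:C * u.[z] ^+ m) by rewrite /v !hornerE.
have fE z : f.[z] = (1 + v.[z] / m%:R) ^+ m by rewrite /f horner_exp !hornerE mulrC.
have modu z (j : nat) : modc z <= 1 -> (m <= j.+1)%N -> (j <= m)%N ->
    modc (u.[z] ^+ j) <= expR (Re h.[z] + 1).
  move=> z1 mj jm; rewrite uE; apply: (modc_1DdivX_le m0 (hr z z1)) => //;
    move: mB; rewrite /B; lra.
have modv z : modc z <= 1 -> modc v.[z] <= r'.
  move=> z1; rewrite vE modcN Normc.normcM modc_real ger0_norm ?ler_wpM2l; try lra.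
  apply: le_trans (modu z m z1 _ _) _ => //.
  by rewrite ler_expR lerD2r; apply: le_trans (ler_norm _) (le_trans (Re_le_modc _) (hr z z1)).
have Rev z : modc z <= 1 -> Re v.[z] <= - (C * (expR (Re h.[z]) / 4)).
  move=> z1; rewrite vE ReN Re_realM lerN2 ler_wpM2l; try lra.
  rewrite uE; apply: (Re_1DdivX_ge m0 (hr z z1) (hI z z1)); move: mB; rewrite /B; lra.
have modf z (j : nat) : modc z <= 1 -> (m <= j.+1)%N -> (j <= m)%N ->
    modc ((1 + v.[z] / m%:R) ^+ j) <= expR (Re v.[z] + 1).
  move=> z1 mj jm; apply: (modc_1DdivX_le m0 (modv z z1)) => //; move: mB; rewrite /B; lra.
exists f; split.
- move=> z z1.
  have -> : f^`().[z] = - (C%:C * h^`().[z] * u.[z] ^+ m.-1 * (1 + v.[z] / m%:R) ^+ m.-1).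
    have uD : (u ^+ m)^`() = m%:R *: (a *: h^`() * u ^+ m.-1).
      by rewrite deriv_exp /u derivD derivZ -[1]/(1%:P) derivC add0r scaler_nat.
    have fD : f^`() = m%:R *: (a *: v^`() * (1 + a *: v) ^+ m.-1).
      by rewrite /f deriv_exp derivD derivZ -[1]/(1%:P) derivC add0r scaler_nat.
    rewrite fD /v derivN derivZ uD !(hornerZ, hornerM, hornerN, horner_exp, hornerD) hornerC.
    rewrite -[X in _ = - (_ * (1 + X) ^+ _)]mulrC -/a.
    move: ((1 + a * - _) ^+ m.-1) ((1 + a * h.[z]) ^+ m.-1) => X Y.
    transitivity ((a * m%:R) ^+ 2 * - (C%:C * h^`().[z] * Y * X)); first by ring.
    by rewrite am expr1n mul1r.
  rewrite modcN !Normc.normcM modc_real ger0_norm; last lra.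
  have m1 : (m <= m.-1.+1)%N by rewrite leqSpred.
  have mm1 : (m.-1 <= m)%N by rewrite leq_pred.
  have b1 := modu z _ z1 m1 mm1; have b2 := modf z _ z1 m1 mm1.
  pose y := C * expR (Re h.[z]) / 4.
  have y0 : 0 <= y by rewrite divr_ge0 // mulr_ge0 ?expR_ge0 //; lra.
  have b3 : expR (Re v.[z] + 1) <= expR (1 - y).
    by rewrite ler_expR; have := Rev z z1; rewrite /y; lra.
  (* The factor [C e^h] from the inner derivative is absorbed by the outer exponential, so the bound
     does not depend on [C]. *)
  have yexp : y * expR (- y) <= 1.
    rewrite expRN ler_pdivrMr ?expR_gt0 // mul1r; apply: le_trans (expR_ge1Dx y); lra.
  rewrite -mulrA -mulrA mulrCA [leRHS]mulrC ler_wpM2l ?modc_ge0 //.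
  apply: (@le_trans _ _ (C * (expR (Re h.[z] + 1) * expR (1 - y)))).
    rewrite ler_wpM2l //; first lra.
    by rewrite ler_pM ?modc_ge0 //; apply: le_trans b2 b3.
  rewrite !expRD -[leRHS]mulr1.
  rewrite (_ : C * _ = 4 * (expR 1 * expR 1) * (y * expR (- y))); last by rewrite /y; field.
  by rewrite ler_wpM2l // !mulr_ge0 ?expR_ge0.
- move=> z z1; rewrite fE; apply: (@le_trans _ _ (expR (Re v.[z] + 1) ^+ 2)).
    by rewrite lerXn2r ?nnegrE ?modc_ge0 ?expR_ge0 // modf.
  rewrite -expRM_natl ler_expR; have := Rev z z1; lra.
rewrite fE vE uE h0 mul0r addr0 expr1n mulr1.
have -> : 1 + - C%:C / m%:R = (1 - C / m%:R)%:C :> R[i].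
  by rewrite rmorphB /= rmorphM /= fmorphV rmorph_nat mulNr.
have Cm : C / m%:R <= 1 / 2 by rewrite ler_pdivrMr //; move: mB; rewrite /B; lra.
have Cm0 : 0 <= C / m%:R by rewrite divr_ge0 ?ltW //; lra.
rewrite modcX modc_real ger0_norm; last lra.
apply: (@le_trans _ _ (expR (- (C / m%:R) / (1 + - (C / m%:R))) ^+ m)); last first.
  by rewrite lerXn2r ?nnegrE ?expR_ge0 ?expR_le_1Dx //; lra.
rewrite -expRM_natl ler_expR mulNr mulrN lerN2 mulrA.
rewrite ler_pdivrMr; last lra.
have -> : m%:R * (C / m%:R) = C by rewrite mulrC divfK // gt_eqF.
have : C * (1 / 2) <= C * (1 + - (C / m%:R)) by rewrite ler_wpM2l; lra.
lra.
Qed.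

End Outer.

(** * Adding many zeros *)

Section RiemannSum.
Variable R : realType.

(** The step function is compared with [g] pointwise, at most one cell containing a given point;
    this serves [W t / t ^ 2] and [psi x * x] alike. *)
Lemma step_sum_le_integral (D : set R) (g : R -> R) (c : nat -> R) (h : R) (n0 n1 : nat) :
  0 < h -> (forall t, D t -> 0 <= g t) -> (forall k, 0 <= c k) ->
  (forall k t, (n0 <= k < n1)%N -> k%:R * h <= t < k.+1%:R * h -> D t /\ c k <= g t) ->
  ((\sum_(n0 <= k < n1) h * c k)%:E <= \int[lebesgue_measure]_(t in D) (g t)%:E)%E.
Proof.
move=> h0 g0 c0 cg.
pose I (k : nat) : set R := `[k%:R * h, k.+1%:R * h[%classic.
have mIs k : measurable (I k : set (measurableTypeR R)) by exact: measurable_itv.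
have lebI k : lebesgue_measure (I k) = h%:E.
  rewrite lebesgue_measure_itv /= lte_fin ltr_pM2r // ltr_nat ltnSn.
  by rewrite -EFinB -mulrBl -natr1 addrAC subrr add0r mul1r.
have mI k : measurable_fun setT (fun t : measurableTypeR R => (\1_(I k) t : R)%:E).
  by apply/measurable_EFinP; apply: measurable_indic; exact: measurable_itv.
have I0 k (t : measurableTypeR R) : setT t -> (0 <= (\1_(I k) t : R)%:E)%E by rewrite lee_fin.
rewrite integral_mkcond /=.
apply: (@le_trans _ _ (\int[lebesgue_measure]_t
   (\sum_(k <- index_iota n0 n1) (c k)%:E * (\1_(I k) t : R)%:E))%E).
  rewrite ge0_integral_sum //; last 2 first.
  - by move=> k; apply: measurable_funeM; exact: mI.
  - by move=> k t _; apply: mule_ge0; rewrite lee_fin.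
  rewrite -sumEFin; apply: lee_sum => k _.
  rewrite (ge0_integralZl _ measurableT (mI k) (I0 k)) ?lee_fin //.
  rewrite (integral_indic _ measurableT (mIs k)) setIT [X in (_ * X)%E](lebI k).
  by rewrite -EFinM lee_fin mulrC.
apply: le_integralT => t.
have g1 : (0 <= ((fun t => (g t)%:E) \_ D) t)%E.
  by rewrite patchE; case: ifPn => // /set_mem tD; rewrite lee_fin g0.
have [[k /andP[kn tk]]|none] :=
  pselect (exists k, (k \in index_iota n0 n1) && (t \in I k)); last first.
  rewrite big1_seq // => k /andP[_ kn]; rewrite indicE.
  case: (boolP (t \in I k)) => tk; last by rewrite mule0.
  by exfalso; apply: none; exists k; rewrite ?kn.
rewrite (bigD1_seq k) ?iota_uniq //= big1_seq ?adde0; last first.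
  move=> j /andP[jk _]; rewrite indicE; case: (boolP (t \in I j)) => tj; last by rewrite mule0.
  exfalso; move: tk tj; rewrite !inE /I /= !in_itv /= => /andP[k1 k2] /andP[j1 j2].
  have : k%:R * h < j.+1%:R * h by exact: le_lt_trans j2.
  have : j%:R * h < k.+1%:R * h by exact: le_lt_trans k2.
  rewrite !ltr_pM2r // !ltr_nat => h1 h2; move: jk; rewrite eqn_leq.
  by rewrite -ltnS h1 -ltnS h2.
rewrite indicE tk mule1; move: tk; rewrite inE /I /= in_itv /= => tk.
rewrite mem_index_iota in kn; have [Dt ct] := cg k t kn tk.
by rewrite patchE mem_set // lee_fin.
Qed.

(** On each cell [W] is taken at the left end and [1 / t ^ 2] at the right end, both below their
    values inside. Every mesh is allowed, since the number of samples depends on the degree of the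
    polynomial at hand. *)
Lemma riemann_sum_le_integral (W : R -> R) (a b h : R) (n0 n1 : nat) :
  (forall s t, 0 < s -> s <= t -> t <= b -> W s <= W t) ->
  (forall t, 0 <= W t) -> 0 < a -> 0 < h ->
  a <= n0%:R * h -> n1%:R * h <= b ->
  ((\sum_(n0 <= k < n1) h * (W (k%:R * h) / (k.+1%:R * h) ^+ 2))%:E <=
   \int[lebesgue_measure]_(t in `[a, b]) (W t / t ^+ 2)%:E)%E.
Proof.
move=> Wnd W0 a0 h0 ha hb; apply: step_sum_le_integral => //.
- by move=> t _; rewrite divr_ge0 ?sqr_ge0.
- by move=> k; rewrite divr_ge0 ?sqr_ge0.
move=> k t /andP[kn0 kn1] /andP[k1 k2].
have at' : a <= t.
  by apply: le_trans ha (le_trans _ k1); rewrite ler_pM2r // ler_nat.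
have tb : t <= b.
  by apply: le_trans (ltW k2) (le_trans _ hb); rewrite ler_pM2r // ler_nat.
have t0 : 0 < t by apply: lt_le_trans at'.
have kh : 0 < k%:R * h by apply: lt_le_trans a0 (le_trans ha _); rewrite ler_pM2r // ler_nat.
split; first by rewrite /= in_itv /= at' tb.
rewrite ler_pM ?invr_ge0 ?sqr_ge0 //; first exact: Wnd.
rewrite lef_pV2 ?posrE ?exprn_gt0 ?mulr_gt0 ?ltr0n //.
apply: lerXn2r; rewrite ?nnegrE; [exact: ltW| |exact: ltW].
by rewrite ltW // mulr_gt0 ?ltr0n.
Qed.

End RiemannSum.

Section HardySample.
Variable R : realType.
Implicit Types (z e : R[i]).

Lemma sum_symm_le (g : nat -> R) (N : nat) : (forall k, 0 <= g k) ->
  \sum_(k < N) g (minn k (N - k)) <= 2 * \sum_(k < N.+1) g k.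
Proof.
move=> g0; apply: (@le_trans _ _ (\sum_(k < N) (g k + g (N - k)%N))).
  apply: ler_sum => k _; rewrite /minn; case: ifP => _; first by rewrite lerDl.
  by rewrite lerDr.
rewrite big_split /= mulr_natl mulr2n lerD //.
  by rewrite [leRHS]big_ord_recr /= lerDl.
rewrite (reindex_inj rev_ord_inj) /= [leRHS]big_ord_recl /=.
rewrite (eq_bigr (fun k : 'I_N => g k.+1)) ?lerDr // => k _.
by rewrite subnA // subnn.
Qed.

(** On the circle the denominator is the distance from [z] to [r e], at least [1 - r] and at least
    half of the distance from [z] to [e]. *)
Lemma quotient_sqr_le (q F : {poly R[i]}) e z (r B B' : R) :
  modc e = 1 -> 0 < r -> modc z = 1 ->
  modc (1 - (r%:C * e)^* * z) * modc q.[z] <= 2 * modc F.[z] ->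
  modc F.[z] ^+ 2 <= B -> 0 < B' -> (B' <= 1 - r) || (2 * B' <= modc (z - e)) ->
  modc q.[z] ^+ 2 <= 4 * B / B' ^+ 2.
Proof.
move=> e1 r0 z1 qF FB B'0 B'd; pose D := modc (1 - (r%:C * e)^* * z).
have DE : D = modc (z - r%:C * e) by rewrite /D -modcBcircle.
have mre : modc (r%:C * e) = r by rewrite Normc.normcM modc_real e1 mulr1 gtr0_norm.
have Dd : `|1 - r| <= D.
  rewrite DE ler_norml; have := modcD (z - r%:C * e) (r%:C * e).
  have := modcB z (z - r%:C * e); rewrite subKr subrK z1 mre => h1 h2.
  by apply/andP; split; lra.
have De : modc (z - e) <= 2 * D.
  have := modcD (z - r%:C * e) (r%:C * e - e); rewrite subrKA -DE.
  have -> : r%:C * e - e = (r - 1)%:C * e by rewrite rmorphB rmorph1 mulrBl mul1r.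
  by rewrite Normc.normcM modc_real e1 mulr1 distrC; move: Dd; lra.
have D0 : 0 <= D := modc_ge0 _.
have B'D : B' <= D.
  case/orP: B'd => h; first by apply: le_trans (le_trans h (ler_norm _)) Dd.
  by rewrite -(ler_pM2l (ltr0n R 2)) (le_trans h).
rewrite ler_pdivlMr ?exprn_gt0 //.
apply: (@le_trans _ _ ((D * modc q.[z]) ^+ 2)).
  rewrite exprMn mulrC ler_wpM2r ?sqr_ge0 // lerXn2r ?nnegrE //; exact: ltW.
apply: (@le_trans _ _ ((2 * modc F.[z]) ^+ 2)).
  by rewrite lerXn2r ?nnegrE ?mulr_ge0 ?modc_ge0.
by rewrite exprMn; lra.
Qed.

(** By Parseval [hardy_poly q] is a mean over [N] points of the circle, sorted by their distance to
    [e]. Near [e] the denominator is at least [1 - r]; in the middle range the samples form a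
    Riemann sum of [W t / t ^ 2]; far away all is bounded. The integral [I] enters only through its
    Riemann sums, and [eta] is the error in the decay of [F]. *)
Lemma hardy_sample (q F : {poly R[i]}) e (r t0 I M eta : R) (W : R -> R) :
  modc e = 1 -> 0 < r < 1 -> t0 <= 2 -> 4 * (1 - r) <= t0 ->
  0 <= M -> 0 <= eta -> (forall t, 0 <= W t) ->
  (forall h n0 n1, 0 < h -> 2 * (1 - r) <= n0%:R * h -> n1%:R * h <= t0 ->
     \sum_(n0 <= k < n1) h * (W (k%:R * h) / (k.+1%:R * h) ^+ 2) <= I) ->
  (forall z, modc z = 1 -> modc (1 - (r%:C * e)^* * z) * modc q.[z] <= 2 * modc F.[z]) ->
  (forall z, modc z = 1 -> modc F.[z] ^+ 2 <= M) ->
  (forall z t, modc z = 1 -> 0 < t <= t0 -> 2 * modc (z - e) <= t ->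
     modc F.[z] ^+ 2 <= M * (W t + eta)) ->
  hardy_poly q <= 16 ^+ 4 * (M * (I + 1 / t0 ^+ 2 + eta / (1 - r) ^+ 2)).
Proof.
move=> e1 /andP[r0 r1] t02 rt0 M0 eta0 W0 RS qF FM FW.
pose d := 1 - r; have d0 : 0 < d by rewrite /d; lra.
have t00 : 0 < t0 by move: rt0; rewrite -/d; lra.
pose N := maxn (size q).+1 (Num.bound (16 / d)).
have sqN : (size q <= N)%N by rewrite (leq_trans _ (leq_maxl _ _)).
have N0 : (0 < N)%N by rewrite (leq_trans _ (leq_maxl _ _)).
have NR : 0 < (N%:R : R) by rewrite ltr0n.
have N1 : 1 <= (N%:R : R) by rewrite ler1n.
have dN : 16 <= d * N%:R.
  rewrite mulrC -ler_pdivrMr // ltW //.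
  apply: lt_le_trans (Num.Theory.archi_boundP _) _; first by rewrite divr_ge0 // ltW.
  by rewrite ler_nat leq_maxr.
(* A sample of index [k] is within [8 k / N] of [e]; with mesh [16 / N], twice this distance is at
   most [k h], so [W (k h)] controls [F] there. *)
pose h : R := 16 / N%:R; have h0 : 0 < h by rewrite divr_gt0.
have hN : h * N%:R = 16 by rewrite divfK // gt_eqF.
have hd : h <= d by rewrite ler_pdivrMr.
have ht : h <= t0 / 2 by move: rt0; rewrite -/d; lra.
have kh k : k%:R * h = 16 * (k%:R / N%:R) :> R by rewrite /h; ring.
pose n0 := (Num.truncn (2 * d / h)).+1; pose n1 := Num.truncn (t0 / h).
have [n0a n0b] : (n0%:R : R) <= 2 * d / h + 1 /\ 2 * d <= n0%:R * h.
  have /truncn_itv/andP[a1 a2] : 0 <= 2 * d / h by rewrite divr_ge0 ?mulr_ge0 // ltW.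
  by rewrite /n0; split; [rewrite -natr1 lerD2r|rewrite -ler_pdivrMr // ltW].
have n0c k : (k < n0)%N -> k%:R * h <= 2 * d.
  have /truncn_itv/andP[a1 a2] : 0 <= 2 * d / h by rewrite divr_ge0 ?mulr_ge0 // ltW.
  by rewrite ltnS => kn; rewrite -ler_pdivlMr //; apply: le_trans a1; rewrite ler_nat.
have [n1a n1b] : n1%:R * h <= t0 /\ t0 < n1.+1%:R * h.
  have /truncn_itv/andP[a1 a2] : 0 <= t0 / h by rewrite divr_ge0 // ltW.
  by rewrite /n1; split; [rewrite -ler_pdivlMr|rewrite -ltr_pdivrMr].
have n1N : (n1 <= N.+1)%N.
  rewrite -(ler_nat R) -(ler_pM2r h0); apply: le_trans n1a _.
  rewrite -natr1 mulrDl [_ * h]mulrC hN; lra.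
(* The Riemann sum reduced to the cell from [2 d] to [4 d] bounds [W (2 d)] itself. *)
have W2d : W (2 * d) <= 8 * d * I.
  have := RS (2 * d) 1 2 _ _ _; rewrite big_nat1 mul1r -/d => H.
  have : 2 * d * (W (2 * d) / (2 * (2 * d)) ^+ 2) <= I.
    by apply: H; rewrite ?mul1r //; move: rt0 d0; rewrite -/d; lra.
  have -> : 2 * d * (W (2 * d) / (2 * (2 * d)) ^+ 2) = W (2 * d) / (8 * d).
    by field; rewrite gt_eqF.
  by rewrite ler_pdivrMr ?mulr_gt0 // => H2; apply: le_trans H2 _; rewrite mulrC.
have I0 : 0 <= I.
  have : 0 <= 8 * d * I by apply: le_trans W2d.
  by rewrite pmulr_rge0 // mulr_gt0.
pose a := 4 * (M * (W (2 * d) + eta)) / d ^+ 2.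
pose b k := 16 * (M * (W (k%:R * h) + eta)) / (k%:R / N%:R) ^+ 2.
pose c := 16 * M * (32 / t0) ^+ 2.
(* The three zones; in the last one [k / N >= t0 / 32], whence the value of [c]. *)
pose g k := if (k < n0)%N then a else if (k < n1)%N then b k else c.
have MW t : 0 <= M * (W t + eta) by rewrite mulr_ge0 // addr_ge0.
have a_ge0 : 0 <= a by rewrite divr_ge0 ?sqr_ge0 // mulr_ge0.
have b_ge0 k : 0 <= b k by rewrite divr_ge0 ?sqr_ge0 // mulr_ge0.
have c_ge0 : 0 <= c by rewrite mulr_ge0 ?sqr_ge0 // mulr_ge0.
have g_ge0 k : 0 <= g k by rewrite /g; case: ifP => // _; case: ifP.
have point z k : modc z = 1 -> k%:R / N%:R <= modc (z - e) -> modc (z - e) <= 8 * (k%:R / N%:R) ->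
    modc q.[z] ^+ 2 <= g k.
  move=> z1 k1 k2; have qD (B B' : R) : 0 < B' -> (B' <= d) || (2 * B' <= modc (z - e)) ->
      modc F.[z] ^+ 2 <= B -> modc q.[z] ^+ 2 <= 4 * B / B' ^+ 2.
    by move=> B'0 B'd FB; apply: (quotient_sqr_le e1 r0 z1 (qF z z1) FB B'0 B'd).
  rewrite /g; case: ifPn => [kn0|]; last rewrite -leqNgt => kn0.
    apply: qD => //; first by rewrite lexx.
    apply: FW => //; first by rewrite mulr_gt0 //=; move: rt0; rewrite -/d; lra.
    have := n0c _ kn0; rewrite kh; lra.
  have khd : 2 * d <= k%:R * h by apply: le_trans n0b _; rewrite ler_pM2r // ler_nat.
  have kN0 : 0 < k%:R / N%:R :> R by move: khd; rewrite kh; lra.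
  have kD : (k%:R / N%:R / 2 <= d) || (2 * (k%:R / N%:R / 2) <= modc (z - e)).
    by rewrite [X in _ || (X <= _)]mulrC divfK // k1 orbT.
  have E (B : R) : 4 * B / (k%:R / N%:R / 2) ^+ 2 = 16 * B / (k%:R / N%:R) ^+ 2.
    by move: (k%:R / N%:R) kN0 => y y0; field; rewrite gt_eqF.
  have k20 : 0 < k%:R / N%:R / 2 :> R by rewrite divr_gt0.
  case: ifPn => [kn1|]; last rewrite -leqNgt => kn1.
    rewrite /b -E; apply: qD => //; apply: FW => //; last by rewrite kh; lra.
    rewrite (lt_le_trans _ khd) ?mulr_gt0 //=; apply: le_trans n1a.
    by rewrite ler_pM2r // ler_nat ltnW.
  apply: le_trans (qD M _ k20 kD (FM z z1)) _; rewrite E /c.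
  apply: ler_wpM2l; first by rewrite mulr_ge0.
  have kt : t0 / 32 <= k%:R / N%:R.
    have : t0 < k.+1%:R * h by apply: lt_le_trans n1b _; rewrite ler_pM2r // ler_nat.
    rewrite -natr1 mulrDl mul1r kh; lra.
  rewrite -exprVn; apply: lerXn2r.
  - by rewrite nnegrE invr_ge0 ltW.
  - by rewrite nnegrE divr_ge0 // ltW.
  by rewrite -[32 / t0]invf_div lef_pV2 // posrE divr_gt0.
have wN := unity_root_prim R N0; have w1 := modc_unity_root R N.
have hardyE : N%:R * hardy_poly q = \sum_(k < N) modc q.[e * unity_root R N ^+ k] ^+ 2.
  rewrite (parseval e wN w1 sqN) (hardy_polyE sqN); congr (_ * _).
  by apply: eq_bigr => k _; rewrite e1 !expr1n mulr1.
have sum1 : N%:R * hardy_poly q <= 2 * \sum_(k < N.+1) g k.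
  rewrite hardyE; apply: le_trans (sum_symm_le N g_ge0).
  apply: ler_sum => k _; apply: point.
  - by rewrite Normc.normcM modcX w1 expr1n e1 mulr1.
  - rewrite -[X in _ - X]mulr1 -mulrBr Normc.normcM e1 mul1r unity_rootX.
    have kN : 0 <= (k%:R : R) / N%:R <= 1.
      by rewrite divr_ge0 ?(ltW NR) //= ler_pdivrMr // mul1r ler_nat ltnW.
    apply: le_trans (chord_ge kN); rewrite le_min.
    have -> : 1 - k%:R / N%:R = (N - k)%:R / N%:R :> R.
      by rewrite natrB 1?ltnW // mulrBl divff // gt_eqF.
    by rewrite !ler_pM2r ?invr_gt0 // !ler_nat geq_minl geq_minr.
  rewrite -[X in _ - X]mulr1 -mulrBr Normc.normcM e1 mul1r.
  have up (j : nat) : modc (unity_root R N ^+ j - 1) <= 8 * (j%:R / N%:R).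
    rewrite unity_rootX -cexpi0; apply: le_trans (cexpi_dist_le _ _) _.
    have jN : 0 <= (j%:R : R) / N%:R by rewrite divr_ge0 // ltW.
    rewrite subr0 ger0_norm ?mulr_ge0 ?pi_ge0 //.
    by rewrite ler_wpM2r //; have := pihalf_lt2 R; lra.
  rewrite /minn; case: ifP => _; first exact: up.
  have -> : unity_root R N ^+ k - 1 = - (unity_root R N ^+ k * (unity_root R N ^+ (N - k) - 1)).
    by rewrite mulrBr -exprD subnKC ?(prim_expr_order wN) 1?ltnW // mulr1 opprB.
  by rewrite modcN Normc.normcM modcX w1 expr1n mul1r; exact: up.
pose c' := c + 16 * 65 * (M * eta / d ^+ 2).
(* The Riemann sums have [(k + 1) h] in the denominator; passing to it from [k h] costs a factor 4,
   as [k >= 1] here. *)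
pose b' k := if (n0 <= k < n1)%N then
  16 * (16 * 64) / h * M * (h * (W (k%:R * h) / (k.+1%:R * h) ^+ 2)) else 0.
pose a' k : R := if (k < n0)%N then 4 * (M * W (2 * d)) / d ^+ 2 else 0.
have Med : 0 <= M * eta / d ^+ 2 by rewrite divr_ge0 ?sqr_ge0 // mulr_ge0.
have gle k : g k <= a' k + b' k + c'.
  have c'c : c <= c' by rewrite /c'; move: Med; lra.
  rewrite /g /a' /b'; have [kn0|kn0] := ltnP k n0.
    have -> : a = 4 * (M * W (2 * d)) / d ^+ 2 + 4 * (M * eta / d ^+ 2) by rewrite /a; ring.
    by rewrite addr0 lerD2l /c'; move: Med c_ge0; lra.
  rewrite add0r; have [kn1|kn1] := ltnP k n1; last by rewrite add0r.
  have khd : 2 * d <= k%:R * h by apply: le_trans n0b _; rewrite ler_pM2r // ler_nat.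
  have khp : 0 < k%:R * h by apply: lt_le_trans khd; rewrite mulr_gt0.
  have -> : b k = 16 * 256 * M * (W (k%:R * h) / (k%:R * h) ^+ 2) +
                  16 * 256 * (M * eta) / (k%:R * h) ^+ 2.
    have k0 : 0 < (k%:R : R) by rewrite -(pmulr_lgt0 _ h0).
    by rewrite /b /h; field; rewrite !gt_eqF.
  apply: lerD.
    have -> : 16 * (16 * 64) / h * M * (h * (W (k%:R * h) / (k.+1%:R * h) ^+ 2)) =
      16 * 256 * M * (4 * (W (k%:R * h) / (k.+1%:R * h) ^+ 2)).
      by move: (W _ / _) => y; field; rewrite gt_eqF.
    apply: ler_wpM2l; first by move: M0; lra.
    rewrite [leRHS]mulrCA; apply: ler_wpM2l; first exact: W0.
    have kS : 0 < k.+1%:R * h by rewrite mulr_gt0 ?ltr0n.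
    rewrite -[leLHS]mul1r ler_pdivrMr ?exprn_gt0 // mulrAC ler_pdivlMr ?exprn_gt0 // mul1r.
    rewrite (_ : 4 * _ = (2 * (k%:R * h)) ^+ 2); last by ring.
    rewrite lerXn2r ?nnegrE ?mulr_ge0 ?ler0n ?(ltW h0) //.
    rewrite mulrA ler_pM2r // -natrM ler_nat mul2n -addnn -addn1 leq_add2l.
    by rewrite -(ltr0n R) -(pmulr_lgt0 _ h0).
  apply: (@le_trans _ _ (16 * 256 * (M * eta) / (2 * d) ^+ 2)).
    apply: ler_wpM2l; first by rewrite !mulr_ge0.
    have p1 : 0 < (k%:R * h) ^+ 2 by rewrite exprn_gt0.
    have p2 : 0 < (2 * d) ^+ 2 by rewrite exprn_gt0 // mulr_gt0.
    rewrite lef_pV2 ?posrE //; apply: lerXn2r khd; rewrite nnegrE ltW //.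
    by rewrite mulr_gt0.
  have -> : 16 * 256 * (M * eta) / (2 * d) ^+ 2 = (16 * 64) * (M * eta / d ^+ 2).
    by field; rewrite gt_eqF.
  by rewrite /c'; lra.
have sum2 : \sum_(k < N.+1) g k <= N%:R * ((16 * 65) * (M * I) + 2 * c').
  apply: (@le_trans _ _ (\sum_(k < N.+1) (a' k + b' k + c'))).
    by apply: ler_sum => k _; exact: gle.
  rewrite big_split [X in X + _ <= _]big_split /= sumr_const card_ord.
  have n0N : n0%:R <= d * N%:R / 4.
    have dh : d * N%:R = 16 * (d / h) by rewrite /h; field; rewrite !gt_eqF.
    by move: n0a dN; rewrite dh; lra.
  have n0N1 : (n0 <= N.+1)%N.
    rewrite -(ler_nat R) -natr1; apply: le_trans n0N _.
    by have : d * N%:R <= 1 * N%:R by [rewrite ler_wpM2r //; rewrite /d; lra]; lra.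
  have A : \sum_(k < N.+1) a' k <= N%:R * (8 * (M * I)).
    apply: (@le_trans _ _ (n0%:R * (4 * (M * W (2 * d)) / d ^+ 2))).
      rewrite -(big_mkord xpredT a') (big_cat_nat (n := n0)) //=.
      rewrite [X in _ + X]big_nat_cond [X in _ + X]big1 ?addr0; last first.
        by move=> k /andP[/andP[k1 _] _]; rewrite /a' ltnNge k1.
      rewrite big_nat_cond (eq_bigr (fun=> 4 * (M * W (2 * d)) / d ^+ 2)); last first.
        by move=> k /andP[/andP[k1 k2] _]; rewrite /a' k2.
      by rewrite -big_nat_cond sumr_const_nat subn0 -[leLHS]mulr_natl.
    apply: (@le_trans _ _ (d * N%:R / 4 * (4 * (M * (8 * d * I)) / d ^+ 2))).
      rewrite ler_pM // ?divr_ge0 ?sqr_ge0 // ?mulr_ge0 //.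
      by rewrite ler_wpM2r ?invr_ge0 ?sqr_ge0 // ler_wpM2l // ler_wpM2l.
    by rewrite le_eqVlt; apply/orP; left; apply/eqP; field; rewrite gt_eqF.
  have B : \sum_(k < N.+1) b' k <= N%:R * ((16 * 64) * (M * I)).
    have hV : N%:R = 16 / h by rewrite -hN mulrC mulKf // gt_eqF.
    rewrite -(big_mkord xpredT b') (big_cat_nat (n := n1)) //=.
    rewrite [X in _ + X]big_nat_cond [X in _ + X]big1 ?addr0; last first.
      by move=> k /andP[/andP[k1 _] _]; rewrite /b' [(k < n1)%N]ltnNge k1 andbF.
    have [n01|n10] := leqP n0 n1; last first.
      rewrite big_nat_cond big1; first by rewrite !mulr_ge0.
      move=> k /andP[/andP[_ k1] _]; rewrite /b' leqNgt.
      by rewrite (ltn_trans k1 n10).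
    rewrite (big_cat_nat (n := n0)) //= big_nat_cond big1 ?add0r; last first.
      by move=> k /andP[/andP[_ k1] _]; rewrite /b' leqNgt k1.
    rewrite big_nat_cond (eq_bigr (fun k =>
      16 * (16 * 64) / h * M * (h * (W (k%:R * h) / (k.+1%:R * h) ^+ 2)))); last first.
      by move=> k /andP[/andP[k1 k2] _]; rewrite /b' k1 k2.
    rewrite -big_nat_cond -mulr_sumr [X in _ <= X * _]hV.
    have -> : 16 / h * ((16 * 64) * (M * I)) = 16 * (16 * 64) / h * M * I by ring.
    apply: ler_wpM2l; first by rewrite !mulr_ge0 // invr_ge0 ltW.
    exact: RS.
  have C : c' *+ N.+1 <= N%:R * (2 * c').
    rewrite -mulr_natl mulrA ler_wpM2r //; first by rewrite addr_ge0 // mulr_ge0.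
    by rewrite -natr1; lra.
  have NMI : 0 <= N%:R * (M * I) by rewrite !mulr_ge0.
  rewrite mulrDr; apply: lerD; last exact: C.
  apply: le_trans (lerD A B) _.
  by move: NMI; rewrite ![N%:R * (_ * _)]mulrCA; move: (N%:R * (M * I)) => x; lra.
have : N%:R * hardy_poly q <= N%:R * (2 * ((16 * 65) * (M * I) + 2 * c')) by lra.
rewrite ler_pM2l // => H; apply: le_trans H _.
rewrite -/d; pose x1 := M * (eta / d ^+ 2); pose x2 := M * (1 / t0 ^+ 2); pose x3 := M * I.
have x10 : 0 <= x1 by rewrite /x1 mulrA.
have x20 : 0 <= x2 by rewrite /x2 mulr_ge0 // divr_ge0 ?sqr_ge0.
have x30 : 0 <= x3 by rewrite /x3 mulr_ge0.
have -> : M * (I + 1 / t0 ^+ 2 + eta / d ^+ 2) = x3 + x2 + x1 by rewrite /x1 /x2 /x3; ring.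
have -> : c' = 16 * (16 * 64) * x2 + 16 * 65 * x1.
  by rewrite /c' /c /x1 /x2; field; rewrite !gt_eqF.
rewrite -/x3; move: x10 x20 x30; clear; move: x1 x2 x3 => x1 x2 x3; lra.
Qed.

End HardySample.

Section Zeros.
Variable R : realType.
Implicit Types (z : R[i]) (F q : {poly R[i]}).

Lemma hardy_poly_le_sup q (B : R) : (forall z, modc z = 1 -> modc q.[z] ^+ 2 <= B) ->
  hardy_poly q <= B.
Proof.
move=> qB; pose N := (size q).+1.
have w1 := modc_unity_root R N.
have := parseval 1 (unity_root_prim R (ltn0Sn (size q))) w1 (leqnSn (size q)).
rewrite Normc.normc1 => H.
have NR : 0 < (N%:R : R) by rewrite ltr0n.
rewrite -(ler_pM2l NR) (hardy_polyE (leqnSn (size q))).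
apply: (@le_trans _ _ (\sum_(k < N) modc q.[1 * unity_root R N ^+ k] ^+ 2)).
  rewrite H ler_wpM2l ?(ltW NR) //; apply: ler_sum => i _.
  by rewrite !expr1n mulr1.
rewrite -[N%:R]/(N%:R) mulr_natl -[in leRHS](card_ord N) -sumr_const.
by apply: ler_sum => k _; apply: qB; rewrite mul1r modcX w1 expr1n.
Qed.

(** [H] refers to [F] alone although each zero is added to the previous polynomial: on the circle
    the modulus grows in all by a factor below 2, and this factor is carried through the
    induction. *)
Lemma add_zeros F (w : nat -> R[i]) (H : nat -> R) (M : nat) :
  (forall j, modc (w j) < 1) ->
  (forall j q, (j < M)%N -> (forall z, modc z = 1 ->
     modc (1 - (w j)^* * z) * modc q.[z] <= 2 * modc F.[z]) -> hardy_poly q <= H j) ->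
  exists f : {poly R[i]}, [/\
    forall j, (j < M)%N -> f.[w j] = 0,
    modc f.[0] = modc F.[0] * \prod_(j < M) modc (w j) &
    dirichlet_poly f <= dirichlet_poly F + 1 +
      \sum_(j < M) (1 - modc (w j) ^+ 2) * H j].
Proof.
move=> w1 HH.
suff [f [f1 f2 f3 f4]] : exists f : {poly R[i]}, [/\
    forall j, (j < M)%N -> f.[w j] = 0,
    modc f.[0] = modc F.[0] * \prod_(j < M) modc (w j),
    forall z, modc z = 1 -> modc f.[z] <= (2 - (2 ^+ M)^-1) * modc F.[z] &
    dirichlet_poly f <= dirichlet_poly F + (1 - (2 ^+ M)^-1) +
      \sum_(j < M) (1 - modc (w j) ^+ 2) * H j].
  exists f; split => //; apply: le_trans f4 _; rewrite lerD2r lerD2l lerBlDr lerDl.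
  by rewrite invr_ge0 exprn_ge0.
elim: M HH => [|M IHM] HH.
  exists F; split=> [//||z _|]; rewrite ?big_ord0 ?mulr1 ?addr0 ?expr0 ?invr1 ?subrr ?addr0 //.
  by rewrite (_ : 2 - 1 = 1) ?mul1r //; lra.
have [|f [f1 f2 f3 f4]] := IHM; first by move=> j q jM; apply: HH; exact: ltnW.
(* Chosen so that [(1 + e) (2 - 4 e) <= 2 - 2 e], which passes the factor [2 - 2 ^ -M] on to
   [M + 1]; the same errors add up to less than 1 in the energy. *)
pose e : R := (2 ^+ M.+2)^-1; have e0 : 0 < e by rewrite invr_gt0 exprn_gt0.
have eM : (2 ^+ M)^-1 = 4 * e by rewrite /e !exprS !invfM; field.
have eM1 : (2 ^+ M.+1)^-1 = 2 * e by rewrite /e !exprS !invfM; field.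
have e1 : 4 * e <= 1 by rewrite -eM invf_le1 ?exprn_gt0 // exprn_ege1 // ler1n.
have [q [q1 q2 q3 q4]] := add_zero f (w1 M) e0.
have qF z : modc z = 1 -> modc (1 - (w M)^* * z) * modc q.[z] <= (2 - 2 * e) * modc F.[z].
  move=> z1; apply: le_trans (q2 z z1) _.
  apply: (@le_trans _ _ ((1 + e) * ((2 - 4 * e) * modc F.[z]))).
    by rewrite ler_wpM2l ?(addr_ge0 _ (ltW e0)) // -eM f3.
  rewrite mulrA ler_wpM2r ?modc_ge0 //; nra.
exists (('X - (w M)%:P) * q); split.
- move=> j; rewrite ltnS leq_eqVlt => /predU1P[->|jM].
    by rewrite !hornerE subrr mul0r.
  by rewrite hornerM q4 ?mulr0 // f1.
- rewrite hornerM q3 Normc.normcM f2 hornerD hornerX hornerN hornerC add0r modcN.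
  rewrite big_ord_recr /= mulrA.
  by rewrite [modc (w M) * _]mulrC -mulrA [_ * modc (w M)]mulrC mulrA.
- move=> z z1; rewrite hornerM Normc.normcM !hornerE (modcBcircle _ z1) eM1.
  exact: qF.
rewrite big_ord_recr /= eM1; apply: le_trans q1 _.
have : (1 - modc (w M) ^+ 2) * hardy_poly q <= (1 - modc (w M) ^+ 2) * H M.
  rewrite ler_wpM2l //; first by rewrite subr_ge0 expr_le1 ?modc_ge0 // ltW.
  apply: HH => // z z1; apply: le_trans (qF z z1) _; rewrite ler_wpM2r ?modc_ge0 //; lra.
by move: f4; rewrite eM; lra.
Qed.

End Zeros.

(** * Passing to the limit *)

Section Limit.
Variable R : realType.
Implicit Types (z w : R[i]).

Lemma ultra_bounded_cvg (G : set_system nat) (u : nat -> R) (B : R) :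
  UltraFilter G -> (forall n, `|u n| <= B) -> exists l : R, u @ G --> l.
Proof.
move=> GU uB; have GF : ProperFilter G by exact: ultra_proper.
have uG : (u @ G) `[- B, B]%classic.
  apply: (@filterS _ G _ setT) filterT => n _; have := uB n; rewrite ler_norml => h.
  by rewrite /= in_itv.
have [l [_ lcl]] := @segment_compact R (- B) B _ _ uG.
exists l => A Al; have [//|nA] := in_ultra_setVsetC (u @^-1` A) GU.
by have [y [nAy Ay]] := lcl (~` A) A nA Al.
Qed.

Definition tends (G : set_system nat) (u : nat -> R[i]) (l : R[i]) :=
  (fun n => Re (u n)) @ G --> Re l /\ (fun n => Im (u n)) @ G --> Im l.

Section TendsTheory.
Context (G : set_system nat) {GF : ProperFilter G}.

Lemma tends_sum (I : Type) (s : seq I) (u : I -> nat -> R[i]) (l : I -> R[i]) :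
  (forall i, tends G (u i) (l i)) ->
  tends G (fun n => \sum_(i <- s) u i n) (\sum_(i <- s) l i).
Proof.
move=> ul; split.
  rewrite Re_sum; under eq_fun do rewrite Re_sum.
  by apply: cvg_fsum => i; have [] := ul i.
rewrite Im_sum; under eq_fun do rewrite Im_sum.
by apply: cvg_fsum => i; have [] := ul i.
Qed.

Lemma tends_mulr (u : nat -> R[i]) l (c : R[i]) :
  tends G u l -> tends G (fun n => u n * c) (l * c).
Proof.
move=> [uR uI]; split.
  rewrite ReM; under eq_fun do rewrite ReM.
  by apply: cvgB; apply: cvgM => //; apply: cvg_cst.
rewrite ImM; under eq_fun do rewrite ImM.
by apply: cvgD; apply: cvgM => //; apply: cvg_cst.
Qed.

Lemma tends_sqr_modc (u : nat -> R[i]) l :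
  tends G u l -> (fun n => modc (u n) ^+ 2) @ G --> modc l ^+ 2.
Proof.
move=> [uR uI]; rewrite sqr_modcE; under eq_fun do rewrite sqr_modcE.
by apply: cvgD; under eq_fun do rewrite expr2; rewrite expr2; apply: cvgM.
Qed.

Lemma tends_modc_le (u : nat -> R[i]) l (B : R) : 0 <= B -> tends G u l ->
  (\forall n \near G, modc (u n) <= B) -> modc l <= B.
Proof.
move=> B0 /tends_sqr_modc ul uB; rewrite -(@ler_pXn2r _ 2) ?nnegrE ?modc_ge0 //.
apply: (cvgr_to_le ul); apply: filterS uB => n uB.
by rewrite ler_pXn2r ?nnegrE ?modc_ge0.
Qed.

Lemma tends_modc_ge (u : nat -> R[i]) l (B : R) : 0 <= B -> tends G u l ->
  (\forall n \near G, B <= modc (u n)) -> B <= modc l.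
Proof.
move=> B0 /tends_sqr_modc ul uB; rewrite -(@ler_pXn2r _ 2) ?nnegrE ?modc_ge0 //.
apply: (cvgr_to_ge ul); apply: filterS uB => n uB.
by rewrite ler_pXn2r ?nnegrE ?modc_ge0.
Qed.

End TendsTheory.

Lemma ultra_bounded_tends (G : set_system nat) (u : nat -> R[i]) (B : R) :
  UltraFilter G -> (forall n, modc (u n) <= B) -> exists l, tends G u l.
Proof.
move=> GU uB.
have [a ua] : exists a : R, (fun n => Re (u n)) @ G --> a.
  apply: (ultra_bounded_cvg (B := B)) => n.
  exact: le_trans (Re_le_modc _) (uB n).
have [b ub] : exists b : R, (fun n => Im (u n)) @ G --> b.
  apply: (ultra_bounded_cvg (B := B)) => n.
  exact: le_trans (Im_le_modc _) (uB n).
by exists (a +i* b).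
Qed.

Lemma cvg_modcP (u : nat -> R[i]) l :
  u @ \oo --> l <-> forall e : R, 0 < e -> \forall n \near \oo, modc (l - u n) < e.
Proof.
split=> [ul e e0|ul A /nbhs_modcP[e e0 eA]].
  by apply: (ul [set z | modc (l - z) < e]); apply/nbhs_modcP; exists e.
by apply: filterS (ul _ e0) => n /= /eA.
Qed.

Lemma tends_cvg (u : nat -> R[i]) l : tends \oo u l -> u @ \oo --> l.
Proof.
move=> [uR uI]; apply/cvg_modcP => e e0.
have e2 : 0 < e / 2 by rewrite divr_gt0.
move/cvgrPdist_lt : uR => /(_ _ e2) uR; move/cvgrPdist_lt : uI => /(_ _ e2) uI.
near=> n.
have H1 : `|Re l - Re (u n)| < e / 2 by near: n.
have H2 : `|Im l - Im (u n)| < e / 2 by near: n.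
rewrite -(@ltr_pXn2r _ 2) ?nnegrE ?modc_ge0 ?(ltW e0) // sqr_modcE.
rewrite ReD ReN ImD ImN -(real_normK (num_real (Re l - _))) -(real_normK (num_real (Im l - _))).
have := normr_ge0 (Re l - Re (u n)); have := normr_ge0 (Im l - Im (u n)).
move: H1 H2; move: (`|_|) (`|_|) => a b; clear -e0; nra.
Unshelve. all: by end_near. Qed.

Lemma cvg_power_series (a : nat -> R[i]) (B : R) z : (forall n, modc (a n) <= B) ->
  modc z < 1 ->
  exists l : R[i], series (fun n => a n * z ^+ n : R[i]) @ \oo --> l.
Proof.
move=> aB z1; have B0 : 0 <= B := le_trans (modc_ge0 _) (aB 0).
have part (p : R[i] -> R) : (forall x, `|p x| <= modc x) ->
    cvgn (series (fun n => p (a n * z ^+ n))).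
  move=> pm; apply: normed_cvg.
  apply: (series_le_cvg (v_ := geometric B (modc z))).
  - by move=> n; apply: normr_ge0.
  - by move=> n; rewrite /geometric /= mulr_ge0 ?exprn_ge0 ?modc_ge0.
  - move=> n; apply: (le_trans (pm _)); rewrite Normc.normcM modcX /=.
    by rewrite ler_wpM2r ?exprn_ge0 ?modc_ge0.
  - by apply: is_cvg_geometric_series; rewrite ger0_norm ?modc_ge0.
exists (limn (series (fun n => Re (a n * z ^+ n))) +i*
        limn (series (fun n => Im (a n * z ^+ n)))).
apply: tends_cvg; split.
  rewrite [X in X @ _ --> _](_ : _ = series (fun n => Re (a n * z ^+ n))).
    by apply: part => x; apply: Re_le_modc.
  by apply/funext => n; rewrite /series /= Re_sum.
rewrite [X in X @ _ --> _](_ : _ = series (fun n => Im (a n * z ^+ n))).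
  by apply: part => x; apply: Im_le_modc.
by apply/funext => n; rewrite /series /= Im_sum.
Qed.

(** At a root the partial sum is minus the tail, of geometric size. The bound depends on [p] only
    through [B], so it survives a limit of the coefficients and makes the limit function vanish. *)
Lemma root_partial_sum_le (p : {poly R[i]}) (B : R) z L : 0 <= B ->
  (forall n, modc p`_n <= B) -> modc z < 1 -> p.[z] = 0 ->
  modc (\sum_(n < L) p`_n * z ^+ n) <= B * modc z ^+ L / (1 - modc z).
Proof.
move=> B0 pB z1 pz; have z0 := modc_ge0 z.
have LN : (L <= maxn L (size p))%N by rewrite leq_maxl.
have pN : (size p <= maxn L (size p))%N by rewrite leq_maxr.
have := pz; rewrite (horner_coef_wide _ pN) -(big_mkord xpredT (fun n => p`_n * z ^+ n)).
rewrite (big_cat_nat (n := L)) //= big_mkord => /eqP; rewrite addr_eq0 => /eqP ->.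
rewrite modcN; apply: (le_trans (modc_sum _ _ _)).
apply: (@le_trans _ _ (\sum_(L <= i < maxn L (size p)) B * modc z ^+ i)).
  by apply: ler_sum => i _; rewrite Normc.normcM modcX ler_wpM2r ?exprn_ge0.
rewrite -mulr_sumr -mulrA ler_wpM2l // ler_pdivlMr ?subr_gt0 // mulr_suml.
under eq_bigr do rewrite mulrBr mulr1 -exprSr -opprB.
rewrite sumrN telescope_sumr // opprB lerBlDr lerDl exprn_ge0 //.
Qed.

Lemma dirichlet_zero_set_limit (w : nat -> R[i]) (B c : R) :
  (forall j, modc (w j) < 1) -> 0 < c ->
  (forall M, exists p : {poly R[i]}, [/\ dirichlet_poly p <= B,
     c <= modc p.[0] <= B & forall j, (j < M)%N -> p.[w j] = 0]) ->
  dirichlet_zero_set w.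
Proof.
move=> w1 c0 /choice[F FP].
have FD M : dirichlet_poly (F M) <= B by have [] := FP M.
have F0 M : c <= modc (F M).[0] <= B by have [] := FP M.
have Fw j M : (j < M)%N -> (F M).[w j] = 0 by have [_ _ /(_ j)] := FP M.
have B0 : 0 < B by have /andP[h1 h2] := F0 0%N; apply: lt_le_trans c0 (le_trans h1 h2).
have B1 : 0 <= B + 1 by rewrite addr_ge0 // ltW.
have FB M n : modc (F M)`_n <= B + 1.
  case: n => [|n].
    rewrite -horner_coef0; have /andP[_ h] := F0 M.
    by apply: (le_trans h); rewrite lerDl.
  have [/(nth_default 0) ->|sn] := leqP (size (F M)) n.+1.
    by rewrite Normc.normc0.
  have h : modc (F M)`_n.+1 ^+ 2 <= B.
    apply: le_trans (FD M); rewrite /dirichlet_poly (bigD1 (Ordinal sn)) //=.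
    apply: (@le_trans _ _ (n.+1%:R * modc (F M)`_n.+1 ^+ 2)).
      by rewrite ler_peMl ?sqr_ge0 // ler1n.
    by rewrite lerDl sumr_ge0 // => i _; rewrite mulr_ge0 ?sqr_ge0.
  rewrite -(@ler_pXn2r _ 2) ?nnegrE ?modc_ge0 //; apply: (le_trans h).
  by clear -B0; nra.
(* All coefficients converge along the same ultrafilter, in place of a diagonal extraction. *)
have [G [GU GT]] := ultraFilterLemma (F := \oo) _.
have GF : ProperFilter G by exact: ultra_proper.
have [n|a aT] := @choice _ _ (fun n l => tends G (fun M => (F M)`_n) l).
  exact: ultra_bounded_tends (FB^~ n).
have aB n : modc (a n) <= B + 1.
  by apply: (tends_modc_le B1 (aT n)); near=> M; apply: FB.
have [z|f fP] := @choice _ _ (fun z l => unit_disk z ->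
    series (fun n => a n * z ^+ n : R[i]) @ \oo --> (l : R[i])).
  have [z1|z1] := pselect (unit_disk z); last by exists 0.
  by have [l zl] := cvg_power_series aB z1; exists l.
have disk0 : unit_disk (0 : R[i]) by rewrite /unit_disk /mkset Normc.normc0 ltr01.
split => //; exists f; split.
- exists a; split => //.
  apply: (@le_lt_trans _ _ B%:E); last exact: ltry.
  apply: lime_le => [|].
    by apply: is_cvg_nneseries => n _ _; rewrite lee_fin mulr_ge0 ?sqr_ge0.
  apply: nearW => L; rewrite sumEFin lee_fin.
  have cv : (fun M => \sum_(0 <= n < L) n%:R * modc (F M)`_n ^+ 2) @ G -->
      \sum_(0 <= n < L) n%:R * modc (a n) ^+ 2.
    by apply: cvg_fsum => n; apply: cvgM; [apply: cvg_cst|apply: tends_sqr_modc].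
  apply: (cvgr_to_le cv); apply: nearW => M; apply: le_trans (FD M).
  rewrite (@dirichlet_polyE _ _ (maxn L (size (F M)))) ?leq_maxr //.
  rewrite -[leRHS](big_mkord xpredT (fun n => n%:R * modc (F M)`_n ^+ 2)).
  rewrite [leRHS](big_cat_nat (n := L)) ?leq_maxl //= lerDl.
  by apply: sumr_ge0 => i _; rewrite mulr_ge0 ?sqr_ge0.
- exists 0 => //; apply/eqP => f0.
  have a0 : c <= modc (a 0%N).
    apply: (tends_modc_ge (ltW c0) (aT 0%N)); apply: nearW => M.
    by rewrite -horner_coef0; have /andP[] := F0 M.
  have /cvg_modcP/(_ _ c0)[N _ Nc] := fP 0 disk0.
  have := Nc N.+1 (leqnSn N); rewrite f0 sub0r modcN /series /= big_nat_recl //=.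
  rewrite expr0 mulr1 big1 ?addr0 => [/lt_le_trans/(_ a0)|i _]; first by rewrite ltxx.
  by rewrite expr0n mulr0.
- move=> j; have wj := w1 j; have w0 := modc_ge0 (w j).
  have part L : modc (\sum_(n < L) a n * w j ^+ n) <=
      (B + 1) * modc (w j) ^+ L / (1 - modc (w j)).
    have cv : tends G (fun M => \sum_(n < L) (F M)`_n * w j ^+ n) (\sum_(n < L) a n * w j ^+ n).
      by apply: tends_sum => n; apply: tends_mulr.
    apply: (tends_modc_le _ cv).
      by rewrite divr_ge0 ?mulr_ge0 ?exprn_ge0 ?subr_ge0 ?(ltW wj).
    (* [G] refines the filter at infinity, so it contains the set of all [M > j], for which [w j] is
       a root of [F M]. *)
    apply: GT; exists j.+1 => // M /= jM.
    by apply: root_partial_sum_le => //; exact: Fw.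
  have small (e : R) : 0 < e -> modc (f (w j)) <= e + e.
    move=> e0; have /cvg_modcP/(_ _ e0) fw := fP (w j) wj.
    have geo : (fun L => (B + 1) * modc (w j) ^+ L / (1 - modc (w j))) @ \oo --> (0 : R).
      rewrite [X in _ --> X](_ : 0 = (B + 1) * 0 / (1 - modc (w j))).
        apply: cvgM; last exact: cvg_cst.
        by apply: cvgM; [exact: cvg_cst|apply: cvg_expr; rewrite ger0_norm].
      by rewrite mulr0 mul0r.
    move/cvgrPdist_lt : geo => /(_ _ e0) geo.
    near \oo => L.
    have h1 : modc (f (w j) - series (fun n => a n * w j ^+ n) L) < e by near: L.
    have h2 : `|0 - (B + 1) * modc (w j) ^+ L / (1 - modc (w j))| < e by near: L.
    rewrite -[f _](subrK (series (fun n => a n * w j ^+ n) L)).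
    apply: (le_trans (modcD _ _)); apply: lerD; first exact: ltW.
    rewrite /series /= big_mkord; apply: (le_trans (part L)).
    by move: h2; rewrite sub0r normrN => /ltW; apply: le_trans; exact: ler_norm.
  apply: Normc.eq0_normc; apply/eqP; rewrite eq_le modc_ge0 andbT.
  apply/ler_addgt0Pl => e e0; rewrite addr0 [e]splitr.
  by apply: small; rewrite divr_gt0.
Unshelve. all: by end_near. Qed.

End Limit.

(** * The scales given by the capacity *)

Lemma pinv_default (T U : Type) (dflt : U -> T) (A : set T) (f : T -> U) y :
  ~ (f @` A) y -> 'pinv_dflt A f y = dflt y.
Proof.
move=> nfA; rewrite /pinv_ splitV.
rewrite -[LHS]/(odflt (dflt y) (if pselect ((f @` A) y) is left By then
  Some (projT1 (cid2 (((fun _ => id) : set_surj A (f @` A) f) y By))) else None)).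
by case: pselect.
Qed.

Section Omega.
Variables (R : realType) (E : set R[i]) (x0 : R) (psi : R -> R) (t0 : R) (r : nat -> R).
Hypotheses (psi_gt0 : forall x, x0 <= x -> 0 < psi x)
  (psi_cont : {within `[x0, +oo[, continuous psi})
  (psi_decr : forall x y, x0 <= x -> x < y -> psi y < psi x)
  (psi_cvg0 : psi x @[x --> +oo] --> (0 : R))
  (t0_gt0 : 0 < t0)
  (r_bounds : forall n, 0 < r n < 1)
  (r_cvg1 : r @ \oo --> (1 : R))
  (r_sum : (\sum_(0 <= n <oo) ((1 - r n)%:E *
     \int[lebesgue_measure]_(t in `[(2 * (1 - r n))%R, t0])
        (omega E x0 psi t / t ^+ 2)%:E) < +oo)%E).

Definition level (t : R) : R :=
  'pinv_(fun=> x0) `[x0, +oo[ psi (fine (cap (nbhdT E t))).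

Lemma omega_gt0 t : 0 < omega E x0 psi t.
Proof. exact: expR_gt0. Qed.

Lemma omegaE t : omega E x0 psi t = expR (- expR (level t)).
Proof. by []. Qed.

Lemma le_omega s t : (omega E x0 psi s <= omega E x0 psi t) = (level t <= level s).
Proof. by rewrite !omegaE ler_expR lerN2 ler_expR. Qed.

Let range_psi : set R := psi @` `[x0, +oo[.

Lemma level_range t : range_psi (fine (cap (nbhdT E t))) ->
  x0 <= level t /\ psi (level t) = fine (cap (nbhdT E t)).
Proof.
move=> ran; have inj : {in `[x0, +oo[%classic &, injective psi}.
  move=> x y; rewrite !inE /= !in_itv /= !andbT => xx xy pxy.
  case: (ltgtP x y) => // [/(psi_decr xx)|/(psi_decr xy)]; by rewrite pxy ltxx.
split; last by rewrite /level pinvK // inE.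
have : ('pinv_(fun=> x0) `[x0, +oo[ psi @` range_psi) (level t) by exists (fine (cap (nbhdT E t))).
by rewrite injpinv_image //= in_itv /= andbT.
Qed.

Lemma level_ge t : x0 <= level t.
Proof.
have [/level_range[]//|nr] := pselect (range_psi (fine (cap (nbhdT E t)))).
by rewrite /level pinv_default.
Qed.

(** A level above [x0] cannot be the default value, so the capacity lies in the range of [psi], is
    positive and can be inverted. *)
Lemma min_energy_level t : x0 < level t ->
  min_energy (nbhdT E t) = ((psi (level t))^-1)%:E.
Proof.
move=> xt; have [/level_range[_]|nr] := pselect (range_psi (fine (cap (nbhdT E t)))); last first.
  by move: xt; rewrite /level pinv_default // ltxx.
move=> pl; have := psi_gt0 (ltW xt); rewrite pl /cap -/(min_energy _).
case: (min_energy _) => [y| |] /=; rewrite ?ltxx // inver.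
by case: eqVneq => [_|y0] /=; rewrite ?ltxx // invrK.
Qed.

Lemma min_energy_anti s t : s <= t -> (min_energy (nbhdT E t) <= min_energy (nbhdT E s))%E.
Proof.
move=> st; apply: le_ereal_inf => _ [mu [K [cK KF muK]] <-]; exists mu => //.
exists K; split => // z /KF[zT dz]; split => //; exact: le_trans st.
Qed.

Lemma range_psiP y : 0 < y -> y <= psi x0 -> range_psi y.
Proof.
move=> y0 yx; have [X X0 pX] : exists2 X, x0 <= X & psi X <= y.
  have /cvgrPdist_le/(_ _ y0)[M [_ MP]] := psi_cvg0.
  exists (Num.max x0 M + 1); first by rewrite ler_wpDr // le_max lexx.
  have := MP (Num.max x0 M + 1); rewrite sub0r normrN => /(_ _)/ler_normlW; apply.
  by rewrite ltr_pwDr // le_max lexx orbT.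
have [//||c cI pc] := @IVT R psi x0 X y X0.
- by apply: continuous_subspaceW psi_cont => x /=; rewrite !in_itv /= andbT => /andP[].
- by rewrite ge_min pX orbT le_max yx.
- by exists c => //; move: cI; rewrite in_itv /= => /andP[h _]; rewrite /= in_itv /= h.
Qed.

(** Were [omega] at least [a] up to [t1], then for large [n], with [d = 1 - r n], the part of the
    integral from [2 d] to [4 d] would make the [n]-th term at least
    [d * 2 d * a / (4 d) ^ 2 = a / 8], and the series would diverge. *)
Lemma omega_not_bounded_below a t1 : 0 < a -> 0 < t1 -> t1 <= t0 ->
  exists2 t, 0 < t <= t1 & omega E x0 psi t < a.
Proof.
move=> a0 t10 t1t0; apply: contrapT => nex.
have om t : 0 < t -> t <= t1 -> a <= omega E x0 psi t.
  by move=> t_0 tt1; rewrite leNgt; apply/negP => h; apply: nex; exists t; rewrite ?t_0.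
pose u n := ((1 - r n)%:E * \int[lebesgue_measure]_(t in `[(2 * (1 - r n))%R, t0])
  (omega E x0 psi t / t ^+ 2)%:E)%E.
have uS : (\sum_(0 <= n <oo) u n < +oo)%E by exact: r_sum.
have u0 n : (0 <= u n)%E.
  have /andP[_ rn] := r_bounds n; apply: mule_ge0; first by rewrite lee_fin subr_ge0 ltW.
  by apply: integral_ge0 => t _; rewrite lee_fin divr_ge0 ?sqr_ge0 // ltW // omega_gt0.
have t14 : 0 < t1 / 4 by rewrite divr_gt0.
have /cvgrPdist_le/(_ _ t14)[N _ NP] := r_cvg1.
have uN n : (N <= n)%N -> ((a / 8)%:E <= u n)%E.
  move=> Nn; have /andP[_ rn] := r_bounds n.
  have := NP n Nn; set d := 1 - r n; have d0 : 0 < d by rewrite /d subr_gt0.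
  rewrite ger0_norm ?(ltW d0) // => dt.
  have mI : measurable (`[2 * d, 4 * d]%classic : set (measurableTypeR R)) by exact: measurable_itv.
  have c0 : 0 <= a / (4 * d) ^+ 2 by rewrite divr_ge0 ?sqr_ge0 ?(ltW a0).
  have -> : (a / 8)%:E = (d%:E * ((a / (4 * d) ^+ 2)%:E *
      lebesgue_measure (`[(2 * d)%R, (4 * d)%R]%classic : set R)))%E.
    rewrite lebesgue_measure_itv /= lte_fin ltr_pM2r // ltr_nat /= -EFinB -!EFinM.
    by congr _%:E; field; rewrite gt_eqF.
  apply: lee_wpmul2l; first by rewrite lee_fin ltW.
  rewrite -(@integral_cst _ _ _ lebesgue_measure _ mI).
  rewrite [leLHS]integral_mkcond [leRHS]integral_mkcond; apply: le_integralT => t.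
  rewrite !patchE; case: ifPn => [|_]; last first.
    by case: ifP => // _; rewrite lee_fin divr_ge0 ?sqr_ge0 // ltW // omega_gt0.
  rewrite inE /= in_itv /= => /andP[ta tb].
  have t_0 : 0 < t by apply: lt_le_trans ta; rewrite mulr_gt0.
  have tt1 : t <= t1 by lra.
  rewrite mem_set /= ?in_itv /= ?ta ?(le_trans tt1) // lee_fin.
  apply: ler_pM; rewrite ?(ltW a0) ?invr_ge0 ?sqr_ge0 //; first exact: om.
  rewrite lef_pV2 ?posrE ?exprn_gt0 ?mulr_gt0 //.
  by apply: lerXn2r; rewrite ?nnegrE ?(ltW t_0) // mulr_ge0 // ltW.
have SS : (\sum_(0 <= n <oo) u n)%E \is a fin_num.
  by rewrite ge0_fin_numE //; apply: nneseries_ge0.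
move: SS; case S : (\sum_(0 <= n <oo) u n)%E => [s| |] // _.
pose K := (Num.truncn (s / (a / 8))).+1.
have : ((\sum_(0 <= n < N + K) u n) <= s%:E)%E.
  by rewrite -S; apply: nneseries_lim_ge => n _ _.
rewrite (big_cat_nat (n := N)) ?leq_addr //=.
have h1 : (0 <= \sum_(0 <= n < N) u n)%E by apply: sume_ge0.
have h2 : ((K%:R * (a / 8))%:E <= \sum_(N <= n < N + K) u n)%E.
  have -> : (K%:R * (a / 8))%:E = (\sum_(N <= n < N + K) (a / 8)%:E)%E.
    by rewrite sumEFin sumr_const_nat addKn mulr_natl.
  rewrite big_nat [leRHS]big_nat; apply: lee_sum => n /andP[Nn _]; exact: uN.
move=> h3; have := le_trans (leeD h1 h2) h3; rewrite add0e lee_fin leNgt => /negP; apply.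
rewrite -ltr_pdivrMr ?divr_gt0 //; exact: truncnS_gt.
Qed.

(** If every measure on [E_t] had infinite energy, so it would be at all smaller scales; the
    capacity would be 0, outside the range of [psi], and [omega] would keep its default value near
    0. *)
Lemma min_energy_lt_pinfty t : 0 < t -> t <= t0 -> (min_energy (nbhdT E t) < +oo)%E.
Proof.
move=> t_0 tt0; rewrite ltey; apply/eqP => vt.
have lx s : 0 < s -> s <= t -> level s <= x0.
  move=> s0 st; rewrite leNgt; apply/negP => xs.
  by have := min_energy_anti st; rewrite vt min_energy_level // leye_eq.
have [s /andP[s0 st]] := omega_not_bounded_below (expR_gt0 (- expR x0)) t_0 tt0.
by rewrite omegaE ltNge ler_expR lerN2 ler_expR lx.
Qed.

(** Capacity increases with the scale and [psi] decreases, but a default value at [s] could break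
    monotonicity. When [level t > x0], it is excluded: [cap (E_s)] is positive and at most
    [psi (level t) < psi x0], hence in the range of the continuous [psi]. *)
Lemma omega_mono s t : 0 < s -> s <= t -> t <= t0 -> omega E x0 psi s <= omega E x0 psi t.
Proof.
move=> s0 st tt0; rewrite le_omega; have [xt|xt] := leP (level t) x0.
  exact: le_trans xt (level_ge s).
have := min_energy_level xt; set v := psi (level t) => vt.
have v0 : 0 < v by exact: psi_gt0 (ltW xt).
have := min_energy_anti st; have := min_energy_lt_pinfty s0 (le_trans st tt0).
rewrite vt; case vs : (min_energy _) => [y| |] // _; rewrite lee_fin => yv.
have y0 : 0 < y by apply: lt_le_trans yv; rewrite invr_gt0.
have cs : fine (cap (nbhdT E s)) = y^-1.
  by rewrite /cap -/(min_energy _) vs inver gt_eqF.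
have yv' : y^-1 <= v by rewrite -[v]invrK lef_pV2 ?posrE ?invr_gt0.
have [|_] := @level_range s.
  rewrite cs; apply: range_psiP; rewrite ?invr_gt0 //; apply: (le_trans yv').
  by apply: ltW; apply: psi_decr.
rewrite cs => ls; rewrite leNgt; apply/negP => /(psi_decr (level_ge s)).
by rewrite ls -/v ltNge yv'.
Qed.

(** [s] is taken near the supremum of the scales with energy at least [1 / psi k]. As the supremum
    need not be attained, [s] is only known to exceed three quarters of it, whence [4 / 3]; this
    fits the blocks, since [t / 2 <= 2 s / 3]. *)
Lemma exists_scale k : x0 <= k -> exists s, [/\ 0 < s,
  (((psi k)^-1)%:E <= min_energy (nbhdT E s))%E &
  forall t, 0 < t -> t <= t0 -> k < level t -> t <= 4 / 3 * s].
Proof.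
move=> xk; pose A := [set t | [/\ 0 < t, t <= t0 & (((psi k)^-1)%:E <= min_energy (nbhdT E t))%E]].
have AP t : 0 < t -> t <= t0 -> k < level t -> A t.
  move=> t_0 tt0 kt; split => //; rewrite min_energy_level ?(le_lt_trans xk) // lee_fin.
  rewrite lef_pV2 ?posrE ?psi_gt0 ?(le_trans xk (ltW kt)) //.
  by apply: ltW; apply: psi_decr.
have supA : has_sup A.
  split; last by exists t0 => t [].
  have [t /andP[t_0 tt0]] := omega_not_bounded_below (expR_gt0 (- expR k)) t0_gt0 (lexx t0).
  by rewrite omegaE ltr_expR ltrN2 ltr_expR => kt; exists t; apply: AP.
have sA0 : 0 < sup A.
  have [[t At] _] := supA; have [t_0 _ _] := At.
  by apply: lt_le_trans t_0 _; apply: sup_upper_bound.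
have [s As sS] := @sup_adherent R A (sup A / 4) ltac:(lra) supA.
have [s0 _ vs] := As; exists s; split => // t t_0 tt0 kt.
have : t <= sup A by apply: sup_upper_bound => //; apply: AP.
lra.
Qed.

End Omega.

(** * Outer polynomials adapted to [omega] *)

Section Outer.
Variable R : realType.

(** On [[m, m + 1]] the product [psi (m + 1) * m] is below [psi x * x], factor by factor. *)
Lemma weight_sum_bounded (x0 : R) (psi : R -> R) :
  0 <= x0 -> (forall x, x0 <= x -> 0 < psi x) ->
  (forall x y, x0 <= x -> x < y -> psi y < psi x) ->
  (\int[lebesgue_measure]_(x in `[x0, +oo[) (psi x * x)%:E < +oo)%E ->
  exists2 S : R, 0 <= S & forall k1 K, (0 < k1)%N -> x0 <= k1%:R ->
    \sum_(k < K) psi (k1 + k).+1%:R * (k1 + k)%:R <= S.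
Proof.
move=> x00 psi_gt0 psi_decr psi_int.
have psi_ge0 t : `[x0, +oo[%classic t -> 0 <= psi t * t.
  rewrite /= in_itv /= andbT => xt; have t0 := le_trans x00 xt.
  by rewrite mulr_ge0 // ltW // psi_gt0.
have SS : (\int[lebesgue_measure]_(x in `[x0, +oo[) (psi x * x)%:E)%E \is a fin_num.
  by rewrite ge0_fin_numE //; apply: integral_ge0 => t /psi_ge0; rewrite lee_fin.
exists (fine (\int[lebesgue_measure]_(x in `[x0, +oo[) (psi x * x)%:E)%E).
  by apply: fine_ge0; apply: integral_ge0 => t /psi_ge0; rewrite lee_fin.
move=> k1 K k10 xk1; rewrite -lee_fin fineK //.
pose c m := if (k1 <= m)%N then psi m.+1%:R * m%:R else 0.
have xm m : (k1 <= m)%N -> x0 <= m%:R by move=> h; apply: le_trans xk1 _; rewrite ler_nat.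
have -> : \sum_(k < K) psi (k1 + k).+1%:R * (k1 + k)%:R = \sum_(k1 <= k < k1 + K) 1 * c k.
  rewrite -[X in \sum_(X <= _ < _) _]add0n big_addn addnC addnK big_mkord; apply: eq_bigr => k _.
  by rewrite mul1r /c leq_addl (addnC k1).
apply: step_sum_le_integral => //.
  move=> m; rewrite /c; case: ifP => // /xm h; rewrite mulr_ge0 // ltW // psi_gt0 //.
  by apply: (le_trans h); rewrite ler_nat.
move=> m t /andP[km _]; rewrite !mulr1 => /andP[mt tm].
have xt := le_trans (xm m km) mt.
split; first by rewrite /= in_itv /= andbT.
rewrite /c km; apply: ler_pM => //; first by rewrite ltW // psi_gt0 // (le_trans xt) // ltW.
by apply: ltW; apply: psi_decr.
Qed.

Lemma min_le_count (b : nat -> bool) (y : R) K :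
  (forall k, k%:R < y -> b k) -> Num.min K%:R y <= (\sum_(k < K) b k)%N%:R.
Proof.
move=> by_; elim: K => [|K IH]; first by rewrite big_ord0 ge_min lexx.
rewrite big_ord_recr /= natrD; have [Ky|yK] := ltP K%:R y.
  move: IH; rewrite minElt Ky (by_ K Ky) => IH; rewrite ge_min -natr1; apply/orP; left.
  by rewrite lerD2r.
move: IH; rewrite (min_idPr yK) => IH; rewrite ge_min; apply/orP; right.
by apply: (le_trans IH); rewrite lerDl.
Qed.

Variables (E : set R[i]) (x0 : R) (psi : R -> R) (t0 : R) (r : nat -> R).
Hypotheses (E_circle : E `<=` unit_circle) (E_nonempty : E !=set0)
  (x0_ge0 : 0 <= x0)
  (psi_gt0 : forall x, x0 <= x -> 0 < psi x)
  (psi_decr : forall x y, x0 <= x -> x < y -> psi y < psi x)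
  (psi_int : (\int[lebesgue_measure]_(x in `[x0, +oo[) (psi x * x)%:E < +oo)%E)
  (t0_gt0 : 0 < t0)
  (r_bounds : forall n, 0 < r n < 1)
  (r_cvg1 : r @ \oo --> (1 : R))
  (r_sum : (\sum_(0 <= n <oo) ((1 - r n)%:E *
     \int[lebesgue_measure]_(t in `[(2 * (1 - r n))%R, t0])
        (omega E x0 psi t / t ^+ 2)%:E) < +oo)%E).

(** [B] and [c] come before [e], because [e] will depend on the number of zeros. *)
Lemma exists_outer_poly : exists B c : R, [/\ 0 <= B, 0 < c &
  forall e : R, 0 < e -> exists F : {poly R[i]}, [/\
    dirichlet_poly F <= B, c <= modc F.[0],
    forall z, modc z <= 1 -> modc F.[z] ^+ 2 <= expR 2 &
    forall z t, modc z = 1 -> 0 < t <= t0 -> 2 * distE E z <= t ->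
      modc F.[z] ^+ 2 <= expR 2 * (omega E x0 psi t + e)]].
Proof.
have [S S0 Ssum] := weight_sum_bounded x0_ge0 psi_gt0 psi_decr psi_int.
(* The sums bounded by [S] carry the factor [k1 + k], so a large [k1] forces the sum of the weights
   below [1 / 80]; then [36 / 80 <= 1 / 2] bounds [Im h] as the double exponential requires. *)
pose k1 := (Num.truncn (x0 + 80 * S)).+2.
have k1P : x0 + 80 * S < k1%:R.
  by apply: (lt_trans (truncnS_gt _)); rewrite ltr_nat.
have xk1 : x0 <= k1%:R by apply: ltW; apply: le_lt_trans k1P; rewrite lerDl mulr_ge0.
pose c k := psi (k1 + k).+1%:R.
have xk k : x0 <= (k1 + k).+1%:R.
  by apply: (le_trans xk1); rewrite ler_nat -addnS leq_addr.
have c0 k : 0 < c k by apply: psi_gt0.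
have k1S : 80 * S <= k1%:R by apply: ltW; apply: le_lt_trans k1P; rewrite lerDr.
have k10 : (0 : R) < k1%:R by rewrite ltr0n.
have csum K : \sum_(k < K) c k <= 1 / 80.
  have h : k1%:R * \sum_(k < K) c k <= S.
    apply: le_trans (Ssum k1 K isT xk1); rewrite mulr_sumr; apply: ler_sum => k _.
    by rewrite mulrC ler_pM2l // ler_nat leq_addr.
  rewrite ler_pdivlMr // mulrC -(ler_pM2l k10) mulr1 mulrCA; apply: le_trans k1S.
  by rewrite ler_pM2l.
have c80 k : 0 < c k <= 1 / 80.
  rewrite c0 /=; apply: le_trans (csum k.+1); rewrite big_ord_recr /= lerDr.
  by apply: sumr_ge0 => i _; apply: ltW.
have wsum K : \sum_(k < K) c k * (2 * k%:R + 1) <= 2 * S.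
  apply: (@le_trans _ _ (2 * \sum_(k < K) psi (k1 + k).+1%:R * (k1 + k)%:R)).
    rewrite mulr_sumr; apply: ler_sum => k _; rewrite mulrCA ler_pM2l // natrD mulrDr addrC.
    by rewrite lerD2r -natrM ler1n.
  by rewrite ler_pM2l // Ssum.
have [k|s sP] := @choice _ _ (fun k s => [/\ 0 < s,
    (((c k)^-1)%:E <= min_energy (nbhdT E s))%E &
    forall t, 0 < t -> t <= t0 -> (k1 + k).+1%:R < level E x0 psi t -> t <= 4 / 3 * s]).
  exact: exists_scale.
(* Compensates the loss of [k1 + 3 / 2] in [Re h] and the factor [1 / 2] in the exponent. *)
pose C : R := 2 * expR (k1%:R + 2).
have C1 : 1 <= C.
  have := expR_ge1Dx (k1%:R + 2 : R); rewrite /C; lra.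
exists ((4 * expR 2) ^+ 2 * (72 * S)), (expR (- (2 * C))); split.
- by rewrite mulr_ge0 ?sqr_ge0 // mulr_ge0.
- exact: expR_gt0.
(* Finitely many blocks suffice: where the level is at least [K], the bound [exp (- e^K)] is already
   at most [e]. *)
move=> e e0; pose K := Num.truncn e^-1.
have [|||h [h0 hdisc _ hD hcount]] := @exists_sum_blocks R E s c K E_nonempty E_circle.
- by move=> k; have [] := sP k.
- exact: c80.
- by move=> k; have [] := sP k.
have small : 36 * \sum_(k < K) c k <= 1 / 2 by have := csum K; lra.
have [|f [fh fb f0]] := exists_double_exp C1 h0.
- by move=> z z1; have [hI _] := hdisc z z1; apply: le_trans small.
exists f; split => //.
- apply: (le_trans (dirichlet_poly_le _ fh)); first by rewrite mulr_ge0 ?expR_ge0.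
  rewrite ler_wpM2l ?sqr_ge0 //; apply: (le_trans hD); have := wsum K; lra.
- move=> z z1; apply: (le_trans (fb z z1)); rewrite ler_expR gerBl.
  by rewrite divr_ge0 // mulr_ge0 ?expR_ge0 // (le_trans _ C1).
move=> z t z1 /andP[t_0 tt0] dz; apply: (le_trans (fb z _)); first by rewrite z1.
set y := level E x0 psi t.
(* Block [k] counts when the level exceeds [k1 + k + 1]: then [t <= 4 / 3 * s k], so
   [distE E z <= t / 2 <= 2 * s k / 3]. *)
have cnt : Num.min K%:R (y - k1%:R - 1) <=
    (\sum_(k < K) (distE E z <= 2 * s k / 3)%R)%N%:R.
  apply: (min_le_count (b := fun k => distE E z <= 2 * s k / 3)) => k ky.
  have [s0 _ /(_ t t_0 tt0)] := sP k.
  rewrite -natr1 natrD => /(_ _) ts; have {}ts : t <= 4 / 3 * s k by apply: ts; rewrite -/y; lra.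
  lra.
have hz := hcount z z1; have hm : Num.min K%:R y - k1%:R - 3 / 2 <= Re h.[z].
  apply: le_trans hz; have : Num.min K%:R y - k1%:R - 1 <= Num.min K%:R (y - k1%:R - 1).
    rewrite le_min; apply/andP; split.
      have : Num.min K%:R y <= K%:R by rewrite ge_min lexx.
      by move: k10; lra.
    have : Num.min K%:R y <= y by rewrite ge_min lexx orbT.
    by lra.
  by move: cnt small; lra.
have big : expR (Num.min K%:R y) <= C * expR (Re h.[z]) / 2.
  have -> : C * expR (Re h.[z]) / 2 = expR (k1%:R + 2) * expR (Re h.[z]) by rewrite /C; field.
  rewrite -expRD ler_expR.
  by move: hm; lra.
rewrite expRD ler_pM2l ?expR_gt0 //; apply: (@le_trans _ _ (expR (- expR (Num.min K%:R y)))).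
  by rewrite ler_expR lerN2.
rewrite omegaE -/y; case: (leP K%:R y) => _; last by rewrite lerDl ltW.
apply: (@le_trans _ _ e); last by rewrite lerDr expR_ge0.
rewrite expRN -[e]invrK lef_pV2 ?posrE ?invr_gt0 ?expR_gt0 //.
apply: (le_trans (ltW (truncnS_gt _))); rewrite -natr1 addrC -/K.
apply: (le_trans (expR_ge1Dx _)); rewrite ler_expR.
by apply: le_trans (expR_ge1Dx _); rewrite lerDr.
Qed.

End Outer.

(** * From outer polynomials to zero sets *)

Section ZeroSet.
Variable R : realType.

Lemma sum_if_lt_le (g : nat -> R) (J M : nat) : (forall j, 0 <= g j) ->
  \sum_(j < M) (if (j < J)%N then g j else 0) <= \sum_(j < J) g j.
Proof.
move=> g0; pose F j := if (j < J)%N then g j else 0.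
have F0 j : 0 <= F j by rewrite /F; case: ifP.
apply: (@le_trans _ _ (\sum_(0 <= j < J + M) F j)).
  rewrite -(big_mkord xpredT F) [leRHS](big_cat_nat (n := M)) ?leq_addl //=.
  by rewrite lerDl sumr_ge0.
rewrite (big_cat_nat (n := J)) ?leq_addr //=.
have -> : \sum_(J <= j < J + M) F j = 0.
  by rewrite big_nat big1 // => j /andP[Jj _]; rewrite /F ltnNge Jj.
by rewrite addr0 big_mkord; apply: ler_sum => j _; rewrite /F ltn_ord.
Qed.

Lemma prod_ge_expR (r : nat -> R) (M : nat) : (forall j, 0 < r j < 1) ->
  expR (- \sum_(j < M) (1 - r j) / r j) <= \prod_(j < M) r j.
Proof.
move=> r01; rewrite -sumrN expR_sum; apply: ler_prod => j _; rewrite expR_ge0 /=.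
have /andP[r0 r1] := r01 j; have := @expR_le_1Dx R (r j - 1).
rewrite subrKC -opprB mulNr; apply; lra.
Qed.

Variables (W : R -> R) (t0 : R) (r : nat -> R).
Hypotheses (W_gt0 : forall t, 0 < W t)
  (W_mono : forall s t : R, 0 < s -> s <= t -> t <= t0 -> W s <= W t)
  (t0_gt0 : 0 < t0) (t0_le2 : t0 <= 2)
  (r_bounds : forall n, 0 < r n < 1)
  (r_cvg1 : r @ \oo --> (1 : R))
  (r_sum : (\sum_(0 <= n <oo) ((1 - r n)%:E *
     \int[lebesgue_measure]_(t in `[(2 * (1 - r n))%R, t0]) (W t / t ^+ 2)%:E) < +oo)%E).

(** [W] is at least [W (t0 / 2) > 0] on [[t0 / 2, t0]], which keeps the integrals away from 0 for
    large [n], so the convergent series contains the Blaschke condition. The divisor [r j] is the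
    form in which the product of the [r j] is bounded below. *)
Lemma weight_integrals_bounded : exists I : nat -> R, exists L : R, [/\
  forall n, 0 <= I n,
  forall n, (I n)%:E = (\int[lebesgue_measure]_(t in `[(2 * (1 - r n))%R, t0]) (W t / t ^+ 2)%:E)%E,
  forall M, \sum_(j < M) (1 - r j) * I j <= L &
  forall M, \sum_(j < M) (1 - r j) / r j <= L].
Proof.
pose i n := (\int[lebesgue_measure]_(t in `[(2 * (1 - r n))%R, t0]) (W t / t ^+ 2)%:E)%E.
have iS : (\sum_(0 <= n <oo) ((1 - r n)%:E * i n) < +oo)%E by exact: r_sum.
have i0 n : (0 <= i n)%E.
  by apply: integral_ge0 => t _; rewrite lee_fin divr_ge0 ?sqr_ge0 // ltW // W_gt0.
have d0 n : 0 < 1 - r n by have /andP[_ h] := r_bounds n; rewrite subr_gt0.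
have u0 n : (0 <= (1 - r n)%:E * i n)%E by rewrite mule_ge0 // lee_fin ltW.
have Sfin : (\sum_(0 <= n <oo) ((1 - r n)%:E * i n))%E \is a fin_num.
  by rewrite ge0_fin_numE //; apply: nneseries_ge0.
set S := fine (\sum_(0 <= n <oo) ((1 - r n)%:E * i n))%E.
have part M : (\sum_(0 <= n < M) ((1 - r n)%:E * i n) <= S%:E)%E.
  by rewrite /S fineK //; apply: nneseries_lim_ge.
have ifin n : (fine (i n))%:E = i n.
  apply: fineK; rewrite ge0_fin_numE // ltey; apply/eqP => iy.
  have := part n.+1; rewrite big_nat_recr //= iy gt0_muley ?lte_fin //.
  by rewrite addey ?leye_eq // gt_eqF // (lt_le_trans (ltNy0)) // sume_ge0.
have I0 n : 0 <= fine (i n) by rewrite fine_ge0.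
have Ipart M : \sum_(j < M) (1 - r j) * fine (i j) <= S.
  rewrite -lee_fin -sumEFin; apply: le_trans (part M); rewrite big_mkord.
  by apply: lee_sum => j _; rewrite -ifin.
have S0 : 0 <= S by have := Ipart 0%N; rewrite big_ord0.
(* From [J] on, [2 (1 - r n) <= t0 / 2] puts [[t0 / 2, t0]] in the interval of integration, and
   [r n >= 1 / 2] controls the divisor. *)
have t04 : 0 < Num.min (t0 / 4) (1 / 2) by rewrite lt_min !divr_gt0.
have /cvgrPdist_le/(_ _ t04)[J _ JP] := r_cvg1.
have k0 : 0 < W (t0 / 2) / (2 * t0) by rewrite divr_gt0 // mulr_gt0.
have ik n : (J <= n)%N -> W (t0 / 2) / (2 * t0) <= fine (i n).
  move=> Jn; have := JP n Jn; rewrite ger0_norm ?(ltW (d0 n)) // le_min => /andP[dt _].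
  have := @step_sum_le_integral R `[2 * (1 - r n), t0]%classic (fun t => W t / t ^+ 2)
    (fun=> W (t0 / 2) / t0 ^+ 2) (t0 / 2) 1 2.
  rewrite big_nat1 -/(i n) -ifin lee_fin => st.
  rewrite [leLHS](_ : _ = t0 / 2 * (W (t0 / 2) / t0 ^+ 2)); last first.
    by field; rewrite gt_eqF.
  apply: st => //.
  - by rewrite divr_gt0.
  - by move=> t _; rewrite divr_ge0 ?sqr_ge0 // ltW // W_gt0.
  - by move=> _; rewrite divr_ge0 ?sqr_ge0 // ltW // W_gt0.
  move=> k t; rewrite ltnS -eqn_leq => /eqP <-; rewrite mul1r => /andP[ht tt].
  have t_0 : 0 < t by apply: lt_le_trans ht; rewrite divr_gt0.
  have {}tt : t <= t0 by lra.
  split; first by rewrite /= in_itv /= tt andbT; lra.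
  apply: ler_pM; rewrite ?invr_ge0 ?sqr_ge0 ?(ltW (W_gt0 _)) //.
    by apply: W_mono => //; rewrite divr_gt0.
  rewrite lef_pV2 ?posrE ?exprn_gt0 //.
  by apply: lerXn2r; rewrite ?nnegrE ?(ltW t_0) ?(ltW t0_gt0).
set k := W (t0 / 2) / (2 * t0) in k0 ik.
exists (fun n => fine (i n)), (S + \sum_(j < J) (r j)^-1 + 2 / k * S); split => //.
  move=> M; apply: (le_trans (Ipart M)); rewrite -addrA lerDl addr_ge0 //.
    by apply: sumr_ge0 => j _; have /andP[h _] := r_bounds j; rewrite invr_ge0 ltW.
  by rewrite mulr_ge0 // divr_ge0 // ltW.
have rV j : 0 <= (r j)^-1 by have /andP[h _] := r_bounds j; rewrite invr_ge0 ltW.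
move=> M; apply: (@le_trans _ _ (\sum_(j < M) ((if (j < J)%N then (r j)^-1 else 0)
    + 2 / k * ((1 - r j) * fine (i j))))).
  apply: ler_sum => j _; have /andP[r0 r1] := r_bounds j.
  have kI : 0 <= 2 / k * ((1 - r j) * fine (i j)).
    by rewrite !mulr_ge0 ?invr_ge0 ?(ltW k0) // (ltW (d0 j)).
  case: ltnP => Jj.
    apply: (@le_trans _ _ (r j)^-1); last by rewrite lerDl.
    by rewrite ler_piMl // gerBl ltW.
  rewrite add0r; have := JP j Jj; rewrite ger0_norm ?(ltW (d0 j)) // le_min => /andP[_ dh].
  have rV2 : (r j)^-1 <= 2 by rewrite -[2]invrK lef_pV2 ?posrE ?invr_gt0 //; lra.
  have ki : 1 <= k^-1 * fine (i j) by rewrite mulrC ler_pdivlMr // mul1r ik.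
  rewrite [leRHS](_ : _ = (1 - r j) * (2 * (k^-1 * fine (i j)))); last by ring.
  rewrite ler_pM2l //; lra.
rewrite big_split /= -mulr_sumr.
have h1 := sum_if_lt_le J M rV.
have h2 : 2 / k * (\sum_(j < M) (1 - r j) * fine (i j)) <= 2 / k * S.
  by rewrite ler_wpM2l // divr_ge0 // ltW.
by apply: lerD => //; apply: (le_trans h1); rewrite lerDr.
Qed.

Variables (E : set R[i]) (B c M0 : R).
Hypotheses (E_circle : E `<=` unit_circle) (c_gt0 : 0 < c) (M0_ge1 : 1 <= M0)
  (outer : forall eta : R, 0 < eta -> exists F : {poly R[i]}, [/\
    dirichlet_poly F <= B, c <= modc F.[0],
    forall z, modc z <= 1 -> modc F.[z] ^+ 2 <= M0 &
    forall z t, modc z = 1 -> 0 < t <= t0 -> 2 * distE E z <= t ->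
      modc F.[z] ^+ 2 <= M0 * (W t + eta)]).

(** All bounds are uniform in the number [M] of zeros. The finitely many indices before [J], where
    [4 (1 - r j) <= t0] may fail and the sampling estimate with it, get a crude bound, collected in
    [Q]. *)
Lemma dirichlet_zero_set_of_outer (e : nat -> R[i]) : (forall j, E (e j)) ->
  dirichlet_zero_set (fun j => (r j)%:C * e j).
Proof.
move=> Ee; have [I [L [I0 IE IL rL]]] := weight_integrals_bounded.
have M0_ge0 : 0 <= M0 by apply: le_trans M0_ge1.
have e1 j : modc (e j) = 1 by apply: E_circle.
have d0 n : 0 < 1 - r n by have /andP[_ h] := r_bounds n; rewrite subr_gt0.
have wr j : modc ((r j)%:C * e j) = r j.
  by have /andP[h _] := r_bounds j; rewrite Normc.normcM modc_real e1 mulr1 gtr0_norm.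
have dL M : \sum_(j < M) (1 - r j) <= L.
  apply: le_trans (rL M); apply: ler_sum => j _; have /andP[h1 h2] := r_bounds j.
  by rewrite ler_pdivlMr // ler_piMr // ltW.
have L0 : 0 <= L by have := dL 0%N; rewrite big_ord0.
have t04 : 0 < t0 / 4 by rewrite divr_gt0.
have /cvgrPdist_le/(_ _ t04)[J _ JP] := r_cvg1.
pose A : R := 16 ^+ 4.
have A0 : 0 <= A by rewrite exprn_ge0.
pose Q : R := \sum_(j < J) 8 * M0 / (1 - r j).
have Q0 : 0 <= Q by apply: sumr_ge0 => j _; rewrite divr_ge0 ?mulr_ge0 ?(ltW (d0 _)).
pose B' := B + 1 + (2 * A * M0 * (L + L / t0 ^+ 2 + 1) + Q) + M0.
apply: (@dirichlet_zero_set_limit R _ B' (c * expR (- L))).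
- by move=> j; rewrite wr; have /andP[] := r_bounds j.
- by rewrite mulr_gt0 ?expR_gt0.
move=> M; pose T : R := \sum_(j < M) (1 - r j)^-1.
have T0 : 0 <= T by apply: sumr_ge0 => j _; rewrite invr_ge0 ltW.
(* Chosen after [M], so that the errors [eta / (1 - r j)] add up to at most 1; [F] depends on [M]
   through it. *)
pose eta := (1 + T)^-1.
have eta0 : 0 < eta by rewrite invr_gt0; lra.
have [F [FD F0 Fdisc Fcirc]] := outer eta0.
pose H j : R := A * (M0 * (I j + 1 / t0 ^+ 2 + eta / (1 - r j) ^+ 2)) +
  (if (j < J)%N then 4 * M0 / (1 - r j) ^+ 2 else 0).
have HA j : 0 <= A * (M0 * (I j + 1 / t0 ^+ 2 + eta / (1 - r j) ^+ 2)).
  by rewrite !mulr_ge0 // !addr_ge0 // divr_ge0 ?sqr_ge0 // ltW.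
have [||f [fz f0 fD]] := @add_zeros R F (fun j => (r j)%:C * e j) H M.
- by move=> j; rewrite wr; have /andP[] := r_bounds j.
- move=> j q _ qF; rewrite /H; case: (ltnP j J) => Jj.
    rewrite -[hardy_poly q]add0r; apply: lerD => //; apply: hardy_poly_le_sup => z z1.
    have h1 : 1 - r j <= modc (1 - ((r j)%:C * e j)^* * z).
      rewrite -(modcBcircle _ z1).
      by have := modcD (z - (r j)%:C * e j) ((r j)%:C * e j); rewrite subrK z1 wr; lra.
    have h2 := qF z z1; have h3 := Fdisc z; rewrite z1 lexx in h3.
    have h4 : (1 - r j) * modc q.[z] <= 2 * modc F.[z].
      by apply: le_trans h2; rewrite ler_wpM2r ?modc_ge0.
    rewrite ler_pdivlMr ?exprn_gt0 // -exprMn mulrC.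
    apply: (@le_trans _ _ ((2 * modc F.[z]) ^+ 2)).
      by apply: lerXn2r; rewrite ?nnegrE ?mulr_ge0 ?modc_ge0 ?(ltW (d0 _)).
    by rewrite exprMn; have := h3 isT; lra.
  rewrite addr0; apply: (@hardy_sample R q F (e j) (r j) t0 (I j) M0 eta W) => //.
  - by have := JP j Jj; rewrite ger0_norm ?(ltW (d0 j)) //; lra.
  - exact: ltW.
  - by move=> t; apply: ltW.
  - move=> h n0 n1 h0 a0 b0; rewrite -lee_fin IE.
    by apply: riemann_sum_le_integral => //; [move=> t; apply: ltW|rewrite mulr_gt0].
  - by move=> z z1; apply: Fdisc; rewrite z1.
  - move=> z t z1 tt0 zt; apply: Fcirc => //; apply: le_trans zt.
    by rewrite ler_pM2l // distE_le.
exists f; split => //.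
- apply: (le_trans fD); rewrite /B' -[leLHS]addr0; apply: lerD => //.
  rewrite -!addrA lerD // lerD2l.
  apply: (@le_trans _ _ (\sum_(j < M) (2 * A * M0 * ((1 - r j) * I j)
      + 2 * A * M0 / t0 ^+ 2 * (1 - r j) + 2 * A * M0 * eta * (1 - r j)^-1
      + (if (j < J)%N then 8 * M0 / (1 - r j) else 0)))).
    apply: ler_sum => j _; rewrite wr.
    have H0 : 0 <= H j.
      apply: addr_ge0; first exact: HA.
      by case: ifP => // _; apply: divr_ge0; [exact: mulr_ge0|exact: sqr_ge0].
    apply: (@le_trans _ _ (2 * (1 - r j) * H j)).
      rewrite ler_wpM2r //; have /andP[h1 h2] := r_bounds j.
      by rewrite expr2; nra.
    have dn := lt0r_neq0 (d0 j); have tn := lt0r_neq0 t0_gt0.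
    rewrite le_eqVlt; apply/orP; left; apply/eqP; rewrite /H.
    by case: ifP => _; field; rewrite ?dn ?tn.
  rewrite !big_split /= -!mulr_sumr lerD //; last first.
    apply: (sum_if_lt_le (g := fun j => 8 * M0 / (1 - r j))) => j.
    by rewrite divr_ge0 ?(ltW (d0 j)) // mulr_ge0.
  have AM : 0 <= 2 * A * M0 by rewrite !mulr_ge0.
  rewrite [leRHS](_ : _ = 2 * A * M0 * L + 2 * A * M0 / t0 ^+ 2 * L + 2 * A * M0 * 1); last first.
    by field; rewrite gt_eqF.
  apply: lerD; first apply: lerD.
  - by apply: ler_wpM2l => //; apply: IL.
  - by apply: ler_wpM2l; [apply: divr_ge0 => //; exact: sqr_ge0|exact: dL].
  - rewrite -mulrA; apply: ler_wpM2l => //.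
    by rewrite -/T /eta mulrC ler_pdivrMr; lra.
- rewrite f0; apply/andP; split.
    have -> : \prod_(j < M) modc ((r j)%:C * e j) = \prod_(j < M) r j.
      by apply: eq_bigr => j _; rewrite wr.
    apply: ler_pM; rewrite ?(ltW c_gt0) ?expR_ge0 //.
    by apply: le_trans (prod_ge_expR _ r_bounds); rewrite ler_expR lerN2.
  have p1 : \prod_(j < M) modc ((r j)%:C * e j) <= 1.
    by apply: prodr_ile1 => j; rewrite wr; have /andP[/ltW -> /ltW] := r_bounds j.
  have F1 : modc F.[0] <= M0.
    have := Fdisc 0; rewrite Normc.normc0 => /(_ ler01); have := modc_ge0 F.[0].
    by move: (modc _) M0_ge1 => x; nra.
  apply: (@le_trans _ _ (modc F.[0])); first by rewrite ler_piMr ?modc_ge0.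
  apply: (le_trans F1); rewrite /B' lerDr.
  have B0 : 0 <= B by apply: le_trans FD; apply: dirichlet_poly_ge0.
  by rewrite addr_ge0 // ?addr_ge0 // ?mulr_ge0 // ?addr_ge0 // divr_ge0 ?sqr_ge0.
Qed.

End ZeroSet.

(** * Choice of the angles *)

Section Angles.
Variable R : realType.

(** The indices from [2 ^ k] to [2 ^ k.+1 - 1] run through the roots of unity of order [2 ^ k], and
    [e n] is a point of [E] within [8 / 2 ^ k] of its root whenever there is one. A point of [E] is
    that close to some root, so each [k] gives an [e n] within [16 / 2 ^ k] of it. *)
Lemma exists_frequent_points (E : set R[i]) : E `<=` unit_circle -> E !=set0 ->
  exists e : nat -> R[i], (forall n, E (e n)) /\
    forall z (d : R) N, E z -> 0 < d -> exists2 n, (N <= n)%N & modc (z - e n) < d.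
Proof.
move=> E_circle [x0 Ex0].
pose near_root (n : nat) (x : R[i]) := modc (x -
  unity_root R (2 ^ trunc_log 2 n) ^+ (n - 2 ^ trunc_log 2 n)) <= 8 / (2 ^ trunc_log 2 n)%:R.
have [n|e eP] := @choice _ _ (fun n x => E x /\ forall y, E y -> near_root n y -> near_root n x).
  have [[y [Ey yn]]|none] := pselect (exists y, E y /\ near_root n y).
    by exists y.
  by exists x0; split => // y Ey yn; exfalso; apply: none; exists y.
exists e; split => [n|z d N Ez d0]; first by have [] := eP n.
pose k := maxn N (Num.truncn (16 / d)).
have kP : 16 / d < (2 ^ k)%:R.
  apply: lt_le_trans (truncnS_gt _) _; rewrite ler_nat.
  by apply: (@leq_trans k.+1); rewrite ?ltnS ?leq_maxr // ltn_expl.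
have k0 : (0 < 2 ^ k)%N by rewrite expn_gt0.
have [i zi] := unity_root_near k0 (E_circle _ Ez).
have log : trunc_log 2 (2 ^ k + i) = k.
  by apply: trunc_log_eq => //; rewrite leq_addr /= expnS mul2n -addnn ltn_add2l.
exists (2 ^ k + i)%N.
  apply: leq_trans (leq_addr _ _); apply: leq_trans (ltnW (ltn_expl k _)) => //.
  exact: leq_maxl.
have [_ /(_ z Ez)] := eP (2 ^ k + i)%N; rewrite /near_root log addKn => /(_ zi) ei.
have -> : z - e (2 ^ k + i)%N = (z - unity_root R (2 ^ k) ^+ i) -
    (e (2 ^ k + i)%N - unity_root R (2 ^ k) ^+ i) by ring.
apply: (le_lt_trans (modcB _ _)).
have : 16 / (2 ^ k)%:R < d by rewrite ltr_pdivrMr ?ltr0n // mulrC -ltr_pdivrMr.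
by lra.
Qed.

(** The sequence is asymptotic to [e n]; closedness of [E] gives one inclusion, the infinitely many
    returns near each point of [E] the other. *)
Lemma cluster_radial (E : set R[i]) (r : nat -> R) (e : nat -> R[i]) :
  closed E -> E `<=` unit_circle -> r @ \oo --> (1 : R) -> (forall n, E (e n)) ->
  (forall z (d : R) N, E z -> 0 < d -> exists2 n, (N <= n)%N & modc (z - e n) < d) ->
  unit_circle `&` cluster ((fun n => (r n)%:C * e n) @ \oo) = E.
Proof.
move=> E_closed E_circle r1 Ee Efreq.
have near_e n : modc ((r n)%:C * e n - e n) = `|1 - r n|.
  rewrite -{2}[e n]mul1r -mulrBl Normc.normcM (E_circle _ (Ee n)) mulr1.
  have -> : (r n)%:C - 1 = (r n - 1)%:C :> R[i] by rewrite rmorphB rmorph1.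
  by rewrite modc_real distrC.
apply/seteqP; split=> [z [_ zc]|z Ez].
  apply: E_closed => A /nbhs_modcP[d d0 dA]; have d2 : 0 < d / 2 by rewrite divr_gt0.
  have /cvgrPdist_lt/(_ _ d2)[N _ NP] := r1.
  have [||_ [[n Nn <-] /= zn]] := zc [set (r n)%:C * e n | n in [set n | (N <= n)%N]]
      [set w | modc (z - w) < d / 2].
  - by exists N => // n /= Nn; exists n.
  - by apply/nbhs_modcP; exists (d / 2).
  exists (e n); split => //; apply: dA.
  have -> : z - e n = (z - (r n)%:C * e n) + ((r n)%:C * e n - e n) by ring.
  apply: (le_lt_trans (modcD _ _)); rewrite near_e.
  by have := NP n Nn; lra.
split; first exact: E_circle.
move=> A B [N _ NA] /nbhs_modcP[d d0 dB]; have d2 : 0 < d / 2 by rewrite divr_gt0.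
have /cvgrPdist_lt/(_ _ d2)[N' _ NP] := r1.
have [n Nn zn] := Efreq z (d / 2) (maxn N N') Ez d2.
exists ((r n)%:C * e n); split.
  by apply: NA => /=; apply: leq_trans Nn; apply: leq_maxl.
apply: dB; have -> : z - (r n)%:C * e n = (z - e n) - ((r n)%:C * e n - e n) by ring.
apply: (le_lt_trans (modcB _ _)); rewrite near_e.
by have /= := NP n (leq_trans (leq_maxr _ _) Nn); lra.
Qed.

End Angles.

Theorem theorem1p2 (R : realType) (E : set R[i]) (x0 : R) (psi : R -> R)
    (t0 : R) (r : nat -> R)
  (E_circle : E `<=` unit_circle) (E_nonempty : E !=set0)
  (E_closed : closed E) (E_cap : cap E = 0%E)
  (x0_ge0 : 0 <= x0)
  (psi_gt0 : forall x, x0 <= x -> 0 < psi x)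
  (psi_cont : {within `[x0, +oo[, continuous psi})
  (psi_decr : forall x y, x0 <= x -> x < y -> psi y < psi x)
  (psi_cvg0 : psi x @[x --> +oo] --> (0 : R))
  (psi_int : (\int[lebesgue_measure]_(x in `[x0, +oo[) (psi x * x)%:E < +oo)%E)
  (t0_gt0 : 0 < t0) (t0_le2 : t0 <= 2)
  (t0_cap : (cap (nbhdT E t0) <= (psi x0)%:E)%E)
  (r_bounds : forall n, 0 < r n < 1)
  (r_cvg1 : r @ \oo --> (1 : R))
  (r_sum : (\sum_(0 <= n <oo) ((1 - r n)%:E *
     \int[lebesgue_measure]_(t in `[(2 * (1 - r n))%R, t0])
        (omega E x0 psi t / t ^+ 2)%:E) < +oo)%E) :
  exists theta : nat -> R,
    let z := fun n => (r n)%:C * cexpi (theta n) in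
    dirichlet_zero_set z /\
    unit_circle `&` cluster (z @ \oo) = E.
Proof.
have [e [Ee Efreq]] := exists_frequent_points E_circle E_nonempty.
have [n|theta thetaE] := @choice _ _ (fun n t => cexpi t = e n).
  by have [t _ <-] := cexpi_surj (E_circle _ (Ee n)); exists t.
exists theta => z; have -> : z = fun n => (r n)%:C * e n.
  by apply/funext => n; rewrite /z thetaE.
split; last exact: cluster_radial.
have [B [c [_ c0 outer]]] := exists_outer_poly E_circle E_nonempty x0_ge0 psi_gt0
  psi_decr psi_int t0_gt0 r_bounds r_cvg1 r_sum.
have W_gt0 t : 0 < omega E x0 psi t by apply: omega_gt0.
have W_mono s t : 0 < s -> s <= t -> t <= t0 -> omega E x0 psi s <= omega E x0 psi t.
  by apply: (omega_mono psi_gt0 psi_cont psi_decr psi_cvg0 r_bounds r_cvg1 r_sum).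
have M0_ge1 : 1 <= expR 2 :> R by rewrite -expR0 ler_expR.
exact: (dirichlet_zero_set_of_outer W_gt0 W_mono t0_gt0 t0_le2 r_bounds r_cvg1 r_sum
  E_circle c0 M0_ge1 outer Ee).
Qed.
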